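(* Let $0<R_1<R_2$ and fix $\alpha,\beta,\gamma\in\mathbb{R}$. Let $$\underline{\widetilde\Lambda}(\Omega)=\inf_{v\in\underline{\widetilde V}\setminus\{0\}}\frac{\|\nabla\times v\|_{L^2(\Omega)}^2}{\|v\|_{L^2(\Omega)}^2},$$ $$M_{\rm in}(\alpha,\beta,\gamma)=\max_{\rho\in[R_1,R_2]}\left[\alpha^2\frac{R_1^4R_2^2}{(R_2^2-R_1^2)^2\rho^4}+\left(\frac1\rho\Big(\frac{\beta-\gamma}{4}R_2^2-\frac{\beta}{8}\frac{R_2^2-R_1^2}{\log(R_2/R_1)}\Big)+\rho\frac{\gamma}{4}\right)^2\right]^{1/2}.$$ Assume that $(v,q)\in\underline{\widetilde V}\times L^2(\Omega)$ is such that $(u,p)=(\widetilde{\mathcal{U}}_{\alpha,\beta,\gamma}+v,\widetilde{\mathcal{P}}_{\alpha,\gamma}+q)$ solves $$-\Delta u+u\cdot\nabla u+\nabla p=0,\quad \nabla\cdot u=0\ \text{ in }\Omega,$$ $$u=0\ \text{ on }\Gamma_1,\qquad u\cdot\nu=0,\quad (\nabla\times u)\times\nu=\widetilde\omega_{\alpha,\beta}\times\nu\ \text{ on }\Gamma_2 .$$ If $M_{\rm in}(\alpha,\beta,\gamma)<\underline{\widetilde\Lambda}(\Omega)$, then $(v,q)\equiv(0,0)$ in $\Omega$.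
   Context: For $0<R_1<R_2$, $\Omega=\{(x,y,z)\in\mathbb{R}^3: R_1^2<x^2+y^2<R_2^2\}$, and $\Gamma_i=\{(x,y,z)\in\mathbb{R}^3: x^2+y^2=R_i^2\}$ for $i=1,2$; $\nu$ is the outward unit normal to $\Omega$. Cylindrical coordinates $(\rho,\theta,z)$ are used, with $e_\theta=(-\sin\theta,\cos\theta,0)$, $e_z=(0,0,1)$. Solutions $(u,p)$ are classical (smooth up to the boundary, which is automatic by standard regularity theory). The space of perturbations is $$\underline{\widetilde V}=\{v\in H^1(\Omega):\ \nabla\cdot v=0\text{ in }\Omega,\ v=0\text{ on }\Gamma_1,\ v\cdot\nu=0\text{ on }\Gamma_2\}$$ (vector fields with values in $\mathbb{R}^3$). For $\rho\in[R_1,R_2]$, $z\in\mathbb{R}$: $$\widetilde{\mathcal{U}}_{\alpha,\beta,\gamma}(\rho)=\alpha\,\widetilde{\mathcal{U}}^C(\rho)\,e_\theta+\Big[\frac{\gamma}{4}\big(\rho^2-R_1^2-2R_2^2\log(\rho/R_1)\big)-\beta R_2(\widetilde\omega_{0,1})_\theta(R_2)\log(\rho/R_1)\Big]e_z,$$ $$\widetilde{\mathcal{P}}_{\alpha,\gamma}(\rho,z)=\alpha^2\widetilde{\mathcal{P}}^C(\rho)+\gamma z,$$ $$\widetilde{\mathcal{U}}^C(\rho)=\frac{R_2}{R_2^2-R_1^2}\Big(\rho-\frac{R_1^2}{\rho}\Big),\qquad \widetilde{\mathcal{P}}^C(\rho)=\frac12\Big[\frac{R_2}{R_2^2-R_1^2}\Big]^2\Big(\rho^2-\frac{R_1^4}{\rho^2}-4R_1^2\log\rho\Big),$$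 $$\widetilde\omega_{\alpha,\beta}(\rho)=\frac{\beta}{4}\Big(\frac{R_2^2-R_1^2}{\log(R_2/R_1)\,\rho}-2\rho\Big)e_\theta+\frac{2\alpha R_2}{R_2^2-R_1^2}e_z,\qquad (\widetilde\omega_{0,1})_\theta(\rho)=\frac14\Big(\frac{R_2^2-R_1^2}{\log(R_2/R_1)\,\rho}-2\rho\Big).$$ The pair $(\widetilde{\mathcal{U}}_{\alpha,\beta,\gamma},\widetilde{\mathcal{P}}_{\alpha,\gamma})$ is itself a solution of the boundary value problem in the claim. *)

(* Defs.v *)
From HB Require Import structures.
From mathcomp Require Import all_boot all_order all_algebra.
From mathcomp Require Import all_classical all_reals all_analysis.

Set Implicit Arguments.
Unset Strict Implicit.
Unset Printing Implicit Defensive.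

Import Order.TTheory GRing.Theory Num.Theory.
Import numFieldNormedType.Exports.

Local Open Scope classical_set_scope.
Local Open Scope ring_scope.

Notation pt R := ((R * R) * R)%type.
Notation scalar_field R := (pt R -> R).
Notation vector_field R := (pt R -> 'rV[R]_3).

Section Calculus.
Context {R : realType}.

Definition evec (i : 'I_3) : pt R :=
  ((i == 0%N :> nat)%:R, (i == 1%N :> nat)%:R, (i == 2%N :> nat)%:R).

Definition component (v : vector_field R) (i : 'I_3) : scalar_field R :=
  fun x => v x 0 i.

Definition dot (a b : 'rV[R]_3) : R := \sum_i a 0 i * b 0 i.

(* The indices i + 1 and i + 2 are computed in 'I_3, i.e. modulo 3. *)
Definition cross (a b : 'rV[R]_3) : 'rV[R]_3 :=
  \row_i (a 0 (i + 1) * b 0 (i + 2%:R) - a 0 (i + 2%:R) * b 0 (i + 1)).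

Definition pd (i : 'I_3) (f : scalar_field R) : scalar_field R :=
  fun x => 'D_(evec i) f x.

(* Divergence and curl are parametrized by the operators that play the role of
   the partial derivatives: [pd] for the classical ones, [wpd] below for the
   weak ones. *)
Definition divergence (d : 'I_3 -> scalar_field R -> scalar_field R)
    (v : vector_field R) : scalar_field R :=
  fun x => \sum_i d i (component v i) x.

Definition curl (d : 'I_3 -> scalar_field R -> scalar_field R)
    (v : vector_field R) : vector_field R :=
  fun x => \row_i (d (i + 1) (component v (i + 2%:R)) x
                   - d (i + 2%:R) (component v (i + 1)) x).

Definition laplacian (f : scalar_field R) : scalar_field R :=
  fun x => \sum_j pd j (pd j f) x.

(* f is C^oo on the open set D up to the boundary: all its iterated partial
   derivatives exist in D and extend continuously to the closure of D.
   F [:: i1; ...; ik] is the extension of d_i1 ... d_ik f; for the empty word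
   it coincides with f on the whole closure.  For D = setT this is plain C^oo
   smoothness on R^3. *)
Definition smooth_upto_boundary (D : set (pt R)) (f : scalar_field R) : Prop :=
  exists F : seq 'I_3 -> scalar_field R,
    [/\ forall x, closure D x -> F [::] x = f x,
        forall s, {within closure D, continuous (F s)} &
        forall s i x, D x -> is_derive x (evec i) (F s) (F (i :: s) x)].

Definition test_function (D : set (pt R)) (phi : scalar_field R) : Prop :=
  smooth_upto_boundary setT phi /\
  exists K : set (pt R),
    [/\ compact K, K `<=` D & forall x, ~ K x -> phi x = 0].

End Calculus.

Section Sobolev.
Context {R : realType}.

(* [measurableTypeR R] is convertible to R; it carries the Borel sigma-algebra
   on which the library defines Lebesgue measure. *)
Local Notation mR := (measurableTypeR R).

Definition leb2 : {measure set (mR * mR) -> \bar R} :=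
  (@lebesgue_measure R \x @lebesgue_measure R)%E.

Definition leb3 : {measure set ((mR * mR) * mR) -> \bar R} :=
  ((@lebesgue_measure R \x @lebesgue_measure R) \x @lebesgue_measure R)%E.

Definition sqnorm d (T : measurableType d) (mu : {measure set T -> \bar R})
    (D : set T) (f : T -> R) : \bar R :=
  (\int[mu]_(x in D) ((f x) ^+ 2)%:E)%E.

Definition L2 d (T : measurableType d) (mu : {measure set T -> \bar R})
    (D : set T) (f : T -> R) : Prop :=
  measurable_fun D f /\ (sqnorm mu D f < +oo)%E.

Definition weak_partial (D : set (pt R)) (i : 'I_3) (f g : scalar_field R) :
    Prop :=
  L2 leb3 D g /\
  forall phi, test_function D phi ->
    \int[leb3]_(x in D) (f x * pd i phi x) =
    - \int[leb3]_(x in D) (g x * phi x).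

Definition H1 (D : set (pt R)) (f : scalar_field R) : Prop :=
  L2 leb3 D f /\ forall i, exists g, weak_partial D i f g.

(* A representative of the weak partial derivative, which is unique up to
   equality almost everywhere in D; only meaningful when f is in H1 D. *)
Definition wpd (D : set (pt R)) (i : 'I_3) (f : scalar_field R) :
    scalar_field R :=
  get [set g | weak_partial D i f g].

End Sobolev.

Section Cylinders.
Context {R : realType}.

Definition radius (x : pt R) : R := Num.sqrt (x.1.1 ^+ 2 + x.1.2 ^+ 2).

Definition e_rho (x : pt R) : 'rV[R]_3 :=
  \row_i nth 0 [:: x.1.1 / radius x; x.1.2 / radius x; 0] i.
Definition e_theta (x : pt R) : 'rV[R]_3 :=
  \row_i nth 0 [:: - (x.1.2 / radius x); x.1.1 / radius x; 0] i.
Definition e_z : 'rV[R]_3 := \row_i nth 0 [:: 0; 0; 1] i.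

Definition Omega (R1 R2 : R) : set (pt R) :=
  [set x | R1 ^+ 2 < x.1.1 ^+ 2 + x.1.2 ^+ 2 < R2 ^+ 2].

Definition Gamma (r : R) : set (pt R) :=
  [set x | x.1.1 ^+ 2 + x.1.2 ^+ 2 = r ^+ 2].

(* The outward unit normal to Omega at the points of the outer cylinder. *)
Definition nu (x : pt R) : 'rV[R]_3 := e_rho x.

(* Parametrization of Gamma r over [0, 2 pi] x R.  The surface measure is
   r dtheta dz; the constant factor r affects neither null sets nor L2
   convergence and is omitted. *)
Definition cyl (r : R) (t : R * R) : pt R := (r * cos t.1, r * sin t.1, t.2).
Definition cyl_dom : set (R * R) := `[0, 2 * pi] `*` setT.

(* g is the trace on Gamma r of f in H1 D: the trace operator is the continuous
   extension of the restriction to Gamma r from the restrictions to D of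
   functions of C_c^oo(R^3), which are dense in H1 D. *)
Definition is_trace (D : set (pt R)) (r : R) (f g : scalar_field R) : Prop :=
  L2 leb2 cyl_dom (g \o cyl r) /\
  exists phi : nat -> scalar_field R,
    [/\ forall n, test_function setT (phi n),
        sqnorm leb3 D (fun x => phi n x - f x) @[n --> \oo] --> 0%E,
        forall i, sqnorm leb3 D (fun x => pd i (phi n) x - wpd D i f x)
          @[n --> \oo] --> 0%E &
        sqnorm leb2 cyl_dom (fun t => phi n (cyl r t) - g (cyl r t))
          @[n --> \oo] --> 0%E].

Definition V_space (R1 R2 : R) (v : vector_field R) : Prop :=
  let D := Omega R1 R2 in
  [/\ forall i, H1 D (component v i),
      {ae leb3, forall x, D x -> divergence (wpd D) v x = 0},
      forall i, is_trace D R1 (component v i) (cst 0) &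
      exists g : vector_field R,
        (forall i, is_trace D R2 (component v i) (component g i)) /\
        {ae leb2, forall t, cyl_dom t ->
           dot (g (cyl R2 t)) (nu (cyl R2 t)) = 0}].

Definition V_nonzero (R1 R2 : R) (v : vector_field R) : Prop :=
  ~ {ae leb3, forall x, Omega R1 R2 x -> v x = 0}.

Definition sqnormv (D : set (pt R)) (v : vector_field R) : R :=
  fine (\sum_i sqnorm leb3 D (component v i))%E.

Definition Lambda (R1 R2 : R) : R :=
  let D := Omega R1 R2 in
  inf [set sqnormv D (curl (wpd D) v) / sqnormv D v | v in
         [set v | V_space R1 R2 v /\ V_nonzero R1 R2 v]].

End Cylinders.

Section Flow.
Context {R : realType}.

Definition omega01 (R1 R2 rho : R) : R :=
  4^-1 * ((R2 ^+ 2 - R1 ^+ 2) / (ln (R2 / R1) * rho) - 2 * rho).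

Definition omega_tilde (R1 R2 alpha beta : R) : vector_field R := fun x =>
  (beta * omega01 R1 R2 (radius x)) *: e_theta x
  + (2 * alpha * R2 / (R2 ^+ 2 - R1 ^+ 2)) *: e_z.

Definition U_C (R1 R2 rho : R) : R :=
  R2 / (R2 ^+ 2 - R1 ^+ 2) * (rho - R1 ^+ 2 / rho).

Definition P_C (R1 R2 rho : R) : R :=
  2^-1 * (R2 / (R2 ^+ 2 - R1 ^+ 2)) ^+ 2
  * (rho ^+ 2 - R1 ^+ 4 / rho ^+ 2 - 4 * R1 ^+ 2 * ln rho).

Definition U_tilde (R1 R2 alpha beta gamma : R) : vector_field R := fun x =>
  let rho := radius x in
  (alpha * U_C R1 R2 rho) *: e_theta x
  + (gamma / 4 * (rho ^+ 2 - R1 ^+ 2 - 2 * R2 ^+ 2 * ln (rho / R1))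
     - beta * R2 * omega01 R1 R2 R2 * ln (rho / R1)) *: e_z.

Definition P_tilde (R1 R2 alpha gamma : R) : scalar_field R := fun x =>
  alpha ^+ 2 * P_C R1 R2 (radius x) + gamma * x.2.

Definition M_in (R1 R2 alpha beta gamma : R) : R :=
  sup [set Num.sqrt
         (alpha ^+ 2 * (R1 ^+ 4 * R2 ^+ 2
                        / ((R2 ^+ 2 - R1 ^+ 2) ^+ 2 * rho ^+ 4))
          + (rho^-1 * ((beta - gamma) / 4 * R2 ^+ 2
                       - beta / 8 * ((R2 ^+ 2 - R1 ^+ 2) / ln (R2 / R1)))
             + rho * (gamma / 4)) ^+ 2) | rho in `[R1, R2]].

(* The boundary values of curl u on the outer cylinder are its limits from
   inside Omega; they exist because u is smooth up to the boundary. *)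
Definition classical_solution (R1 R2 alpha beta : R)
    (u : vector_field R) (p : scalar_field R) : Prop :=
  let D := Omega R1 R2 in
  (forall i, smooth_upto_boundary D (component u i)) /\
  smooth_upto_boundary D p /\
  (forall x i, D x ->
     - laplacian (component u i) x
     + \sum_j component u j x * pd j (component u i) x
     + pd i p x = 0) /\
  (forall x, D x -> divergence pd u x = 0) /\
  (forall x, Gamma R1 x -> u x = 0) /\
  (forall x, Gamma R2 x -> dot (u x) (nu x) = 0) /\
  (forall x, Gamma R2 x ->
     cross (curl pd u y) (nu x) @[y --> within D (nbhs x)] -->
     cross (omega_tilde R1 R2 alpha beta x) (nu x)).

End Flow.

(* Main.v *)
(* The perturbation v satisfies -lap v + (U + v).grad v + v.grad U + grad q = 0
   with v = 0 on the inner cylinder and v.nu = 0, curl v x nu = 0 on the outer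
   one.  Multiplying by v, the nonlinear term and the pressure become
   divergences, and by the boundary conditions the energy balance over the slab
   a < z < b reads
     int |curl v|^2 + int v.(grad U) v = Phi(a) - Phi(b),
   where Phi(z) is the flux through the section at height z.  By Gagliardo's
   inequality on the section, Phi(z) is bounded by E(z) + E(z)^2 up to a
   constant, where E(z) is the integral over the section of
   |v|^2 + |grad v|^2 + q^2.  As E is integrable in z, there are heights tending
   to -oo and +oo at which E, hence Phi, is arbitrarily small.  Since pointwise
   |v.(grad U) v| <= M_in |v|^2, this gives
     int |curl v|^2 <= M_in int |v|^2   over Omega,
   which contradicts M_in < Lambda unless v = 0.  Then grad q = 0, and q = 0
   because it is square integrable on the unbounded domain. *)

Require Import Defs.
From HB Require Import structures.
From mathcomp Require Import all_boot all_order all_algebra.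
From mathcomp Require Import all_classical all_reals all_analysis.
From mathcomp Require Import measurable_realfun.
From mathcomp Require Import ring lra.
Import Order.TTheory GRing.Theory Num.Theory.
Import numFieldNormedType.Exports.
Local Open Scope classical_set_scope.
Local Open Scope ring_scope.

(** The obstacle is the outer cylinder, where [v] slips. Writing -laplacian v as curl (curl v) makes
    the viscous boundary term the normal component of (curl v) x v, which the vorticity condition
    kills. Since [v] is not zero there, Gagliardo's inequality does not apply to [v] extended by
    zero; it is applied to sigma f^2 with sigma = R2^2 - rho^2, and an integration by parts trades
    the cubic integral for weighted ones. No surface measure occurs in the energy balance: a
    boundary condition enters as a bound by the weight s = (R2^2 - rho^2) (rho^2 - R1^2), and the
    cutoffs s^2 / (s^2 + 1/n) are removed by dominated convergence, which tolerates their
    derivative, of order 1/s, against a field of order s. [Lambda] is stated with weak derivatives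
    and the energy balance with classical ones; their identification also yields the square
    integrability of grad v, on which the choice of the heights rests. [M_in] is the maximum over
    rho of the largest eigenvalue of the symmetric gradient of the base flow. *)

(** * Measurability of continuous functions on products *)

Section MeasurableContinuous.
#[local] Set Implicit Arguments.
#[local] Unset Strict Implicit.
Context {R : realType}.
Local Notation mR := (measurableTypeR R).

(** Intervals with rational endpoints, enumerated through [pickle]; a code that decodes to nothing
    gives the empty set. *)
Lemma R_measurable_base : exists B : nat -> set R,
  (forall n, measurable (B n : set mR)) /\
  (forall x O, nbhs x O -> exists2 n, B n x & B n `<=` O).
Proof.
exists (fun n => if @unpickle (rat * rat)%type n is Some ab then
  [set` `]ratr ab.1, ratr ab.2[] : set R else set0); split.
  by move=> n; case: (unpickle n) => [ab|]//; exact: measurable_itv.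
move=> x O /nbhs_ballP [e /= e0 eO].
have [a] := rat_in_itvoo (ltac:(lra) : x - e < x); rewrite in_itv/= => /andP[a1 a2].
have [b] := rat_in_itvoo (ltac:(lra) : x < x + e); rewrite in_itv/= => /andP[b1 b2].
exists (pickle (a, b)); rewrite pickleK /=; first by rewrite in_itv/= a2 b1.
move=> y; rewrite /= in_itv/= => /andP[ay yb]; apply: eO.
by rewrite /ball/= ltr_norml; apply/andP; split; lra.
Qed.

(* A countable family of measurable sets that generates the neighborhoods; it
   makes the opens of a product measurable for the product sigma-algebra. *)
Definition measurable_base d (T : measurableType d) (nb : T -> set (set T)) : Prop :=
  exists B : nat -> set T,
  (forall n, measurable (B n)) /\
  (forall x O, nb x O -> exists2 n, B n x & B n `<=` O).

Lemma measurable_baseX d1 d2 (T1 : measurableType d1) (T2 : measurableType d2)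
  (n1 : T1 -> set (set T1)) (n2 : T2 -> set (set T2)) :
  measurable_base n1 -> measurable_base n2 ->
  @measurable_base _ (T1 * T2)%type (fun x => filter_prod (n1 x.1) (n2 x.2)).
Proof.
move=> [B1 [mB1 hB1]] [B2 [mB2 hB2]].
exists (fun n => if @unpickle (nat * nat)%type n is Some ab then
  B1 ab.1 `*` B2 ab.2 else set0); split.
  by move=> n; case: (unpickle n) => [ab|]//; exact: measurableX.
move=> [x y] O [[P Q]] /= [/hB1[n Bx BP] /hB2[m By BQ]] PQO.
exists (pickle (n, m)); rewrite pickleK //=.
move=> [u v] [/= /BP Pu /BQ Qv]; exact: (PQO (u, v)).
Qed.

Lemma measurable_base_measurable d (T : measurableType d) (nb : T -> set (set T))
  (O : set T) : measurable_base nb -> (forall x, O x -> nb x O) -> measurable O.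
Proof.
move=> [B [mB hB]] oO.
have -> : O = \bigcup_(n in [set n | B n `<=` O]) B n.
  apply/seteqP; split => [x Ox|x [n /=]]; last exact.
  by have [n Bx BO] := hB _ _ (oO _ Ox); exists n.
exact: bigcup_measurable.
Qed.

Lemma open_measurable2 (O : set (R * R)) : open O ->
  measurable (O : set (mR * mR)).
Proof.
move=> oO; apply: (measurable_base_measurable (measurable_baseX
  (R_measurable_base : measurable_base (nbhs : mR -> _))
  (R_measurable_base : measurable_base (nbhs : mR -> _)))).
by move=> x Ox; move: oO; rewrite openE => /(_ _ Ox).
Qed.

Lemma open_measurable3 (O : set (pt R)) : open O ->
  measurable (O : set (mR * mR * mR)).
Proof.
move=> oO; apply: (measurable_base_measurable (measurable_baseX (measurable_baseX
  (R_measurable_base : measurable_base (nbhs : mR -> _))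
  (R_measurable_base : measurable_base (nbhs : mR -> _)))
  (R_measurable_base : measurable_base (nbhs : mR -> _)))).
by move=> x Ox; move: oO; rewrite openE => /(_ _ Ox).
Qed.

(* [R] rather than an arbitrary target: opens of [R] generate its Borel sets. *)
Lemma measurable_fun_opens d (T : measurableType d) (D : set T) (f : T -> R) :
  (forall U : set R, open U -> measurable (D `&` f @^-1` U)) ->
  measurable_fun D f.
Proof.
move=> h mD; apply: (measurability _ (RGenOpens.measurableE R)) => //.
by move=> _ [_ [a [b ->] <-]]; apply: h; exact: interval_open.
Qed.

Lemma continuous_measurable2 (D : set (R * R)) (f : R * R -> R) :
  open D -> (forall x, D x -> {for x, continuous f}) ->
  measurable_fun (D : set (mR * mR)) f.
Proof.
move=> oD cf; apply: measurable_fun_opens => U oU; apply: open_measurable2.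
rewrite openE => x [Dx Ux]; apply: filterI; first by move: oD; rewrite openE; exact.
by apply: (cf x Dx); move: oU; rewrite openE; exact.
Qed.

Lemma continuous_measurable3 (D : set (pt R)) (f : pt R -> R) :
  open D -> (forall x, D x -> {for x, continuous f}) ->
  measurable_fun (D : set (mR * mR * mR)) f.
Proof.
move=> oD cf; apply: measurable_fun_opens => U oU; apply: open_measurable3.
rewrite openE => x [Dx Ux]; apply: filterI; first by move: oD; rewrite openE; exact.
by apply: (cf x Dx); move: oU; rewrite openE; exact.
Qed.

End MeasurableContinuous.

(** * Integrals of bounded and of square-integrable functions *)

Section Integration.
#[local] Set Implicit Arguments.
#[local] Unset Strict Implicit.
Context d (T : measurableType d) (R : realType).
Variable mu : {measure set T -> \bar R}.
Implicit Types (E : set T) (f g : T -> R).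

Definition bdd_measurable E f : Prop :=
  measurable_fun E f /\ exists C, forall x, E x -> `|f x| <= C.

Lemma bdd_measurable_integrable E f : measurable E -> (mu E < +oo)%E -> bdd_measurable E f ->
  mu.-integrable E (EFin \o f).
Proof.
move=> mE muE [mf [C fC]]; apply: measurable_bounded_integrable => //.
exists C; split; first exact: num_real.
by move=> M CM x Ex /=; rewrite (le_trans (fC _ Ex))// ltW.
Qed.

Lemma bdd_measurable_cst E c : bdd_measurable E (cst c).
Proof. by split; [exact: measurable_cst|exists `|c|]. Qed.

(** Dominated convergence with a constant, which is integrable on a set of finite measure; this is
    what removes the cutoffs near the boundary. *)
Lemma bounded_cvg E (f_ : nat -> T -> R) f C :
  measurable E -> (mu E < +oo)%E ->
  (forall n, measurable_fun E (f_ n)) -> measurable_fun E f ->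
  (forall n x, E x -> `|f_ n x| <= C) ->
  (forall x, E x -> f_ ^~ x @ \oo --> f x) ->
  \int[mu]_(x in E) f_ n x @[n --> \oo] --> \int[mu]_(x in E) f x.
Proof.
move=> mE muE mf_ mf fC cf.
have iC : mu.-integrable E (EFin \o cst C).
  by apply: bdd_measurable_integrable => //; exact: bdd_measurable_cst.
have [|||||H1 _ H2] := dominated_convergence (mu := mu) (D := E) mE
  (f_ := fun n => EFin \o f_ n) (f := EFin \o f) (g := EFin \o cst C).
- by move=> n; exact/measurable_EFinP.
- exact/measurable_EFinP.
- by apply: aeW => x Ex; apply: cvg_EFin; [exact: nearW|exact: cf].
- by [].
- by apply: aeW => x n Ex /=; rewrite lee_fin fC.
by apply/fine_cvg; rewrite /Rintegral fineK//; exact: integrable_fin_num.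
Qed.

Lemma sqr_int_measurable E f g : measurable E -> measurable_fun E f ->
  measurable_fun E g ->
  mu.-integrable E (EFin \o (fun x => f x ^+ 2)) ->
  mu.-integrable E (EFin \o (fun x => g x ^+ 2)) ->
  mu.-integrable E (EFin \o (fun x => f x * g x)).
Proof.
move=> mE mf mg if2 ig2.
apply: (le_integrable mE _ _ (integrableD mE if2 ig2)).
  by apply/measurable_EFinP; exact: measurable_funM.
move=> x Ex /=; rewrite lee_fin normrM [leRHS]ger0_norm ?addr_ge0 ?sqr_ge0//.
rewrite -(real_normK (num_real (f x))) -(real_normK (num_real (g x))).
by have := sqr_ge0 (`|f x| - `|g x|); have := normr_ge0 (f x);
  have := normr_ge0 (g x); nra.
Qed.

Lemma Rintegral_ext E f g : (forall x, E x -> f x = g x) ->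
  \int[mu]_(x in E) f x = \int[mu]_(x in E) g x.
Proof. by move=> fg; apply: eq_Rintegral => x /set_mem; exact: fg. Qed.

(** Discriminant argument: the integral of (t f + g)^2 is a nonnegative polynomial in [t]. *)
Lemma cauchy_schwarz E f g : measurable E -> measurable_fun E f ->
  measurable_fun E g ->
  mu.-integrable E (EFin \o (fun x => f x ^+ 2)) ->
  mu.-integrable E (EFin \o (fun x => g x ^+ 2)) ->
  (\int[mu]_(x in E) (f x * g x)) ^+ 2 <=
  (\int[mu]_(x in E) f x ^+ 2) * (\int[mu]_(x in E) g x ^+ 2).
Proof.
move=> mE mf mg if2 ig2.
have ifg := sqr_int_measurable mE mf mg if2 ig2.
set a := \int[mu]_(x in E) f x ^+ 2; set b := \int[mu]_(x in E) g x ^+ 2.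
set c := \int[mu]_(x in E) (f x * g x).
have P t : 0 <= t ^+ 2 * a + 2 * t * c + b.
  have i1 : mu.-integrable E (EFin \o (fun x => t ^+ 2 * f x ^+ 2)).
    exact: (integrableZl mE (t ^+ 2) if2).
  have i2 : mu.-integrable E (EFin \o (fun x => 2 * t * (f x * g x))).
    exact: (integrableZl mE (2 * t) ifg).
  rewrite /a /b /c -RintegralZl// -RintegralZl// -RintegralD//.
  rewrite -RintegralD//; last exact: (integrableD mE i1 i2).
  apply: Rintegral_ge0 => x _.
  by rewrite [leRHS](_ : _ = (t * f x + g x) ^+ 2) ?sqr_ge0//; ring.
have a0 : 0 <= a by apply: Rintegral_ge0 => x _; exact: sqr_ge0.
have [a1|a1] := eqVneq a 0.
  have b0 : 0 <= b by apply: Rintegral_ge0 => x _; exact: sqr_ge0.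
  rewrite a1 mul0r; have [->|c0] := eqVneq c 0; first by rewrite expr0n.
  (* With [a = 0] the polynomial is affine, and this [t] gives it the value -1. *)
  have := P (- (b + 1) / (2 * c)).
  rewrite a1 mulr0 add0r (_ : 2 * (- (b + 1) / (2 * c)) * c = - (b + 1)); first lra.
  by field.
have {}a1 : 0 < a by rewrite lt_def a1.
(* The minimum of the polynomial. *)
have := P (- c / a).
rewrite (_ : _ + b = b - c ^+ 2 / a); last by field; rewrite gt_eqF.
by rewrite subr_ge0 ler_pdivrMr// mulrC.
Qed.

Lemma ge0_le_Rintegral_subset E F f : measurable E -> measurable F ->
  mu.-integrable F (EFin \o f) -> (forall x, 0 <= f x) -> E `<=` F ->
  \int[mu]_(x in E) f x <= \int[mu]_(x in F) f x.
Proof.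
move=> mE mF intf f0 EF; apply: fine_le.
- by apply: (integrable_fin_num mE); exact: (integrableS mF).
- exact: integrable_fin_num.
apply: ge0_subset_integral => //; first exact: (measurable_int _ intf).
by move=> x _; rewrite lee_fin.
Qed.

Lemma integrable_Rsum E n (f : 'I_n -> T -> R) : measurable E ->
  (forall i, mu.-integrable E (EFin \o f i)) ->
  mu.-integrable E (EFin \o (fun x => \sum_i f i x)).
Proof.
move=> mE fi.
have -> : EFin \o (fun x => \sum_i f i x) = (fun x => \sum_i (f i x)%:E)%E.
  by apply/funext => x /=; rewrite sumEFin.
by apply: (integrable_sum mE) => i _; exact: fi.
Qed.

End Integration.

(** * Fubini for real-valued integrals *)

Section RFubini.
#[local] Set Implicit Arguments.
#[local] Unset Strict Implicit.
Context d1 d2 (T1 : measurableType d1) (T2 : measurableType d2) (R : realType).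
Variables (m1 : {sigma_finite_measure set T1 -> \bar R})
  (m2 : {sigma_finite_measure set T2 -> \bar R}).
Variable f : T1 * T2 -> R.
Hypothesis fi : (m1 \x m2)%E.-integrable setT (EFin \o f).

(** Integrability of every section, and not only of almost every one, makes each inner integral
    finite, so that [fine] can be undone pointwise. The zero extensions used below have this
    property. *)
Lemma Rintegral_fubini12 : (forall x, m2.-integrable setT (EFin \o (fun y => f (x, y)))) ->
  \int[(m1 \x m2)%E]_z f z = \int[m1]_x \int[m2]_y f (x, y).
Proof.
move=> h; rewrite /Rintegral -integral12_prod_meas1//; congr fine.
apply: eq_integral => x _; rewrite /fubini_F fineK//.
by apply: (@integrable_fin_num _ _ _ m2 setT measurableT (EFin \o (fun y => f (x, y)))).
Qed.

Lemma Rintegral_fubini21 : (forall y, m1.-integrable setT (EFin \o (fun x => f (x, y)))) ->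
  \int[(m1 \x m2)%E]_z f z = \int[m2]_y \int[m1]_x f (x, y).
Proof.
move=> h; rewrite /Rintegral -integral21_prod_meas1//; congr fine.
apply: eq_integral => y _; rewrite /fubini_G fineK//.
by apply: (@integrable_fin_num _ _ _ m1 setT measurableT (EFin \o (fun x => f (x, y)))).
Qed.

Lemma integrable_fubini12 :
  (forall x, m2.-integrable setT (EFin \o (fun y => f (x, y)))) ->
  m1.-integrable setT (EFin \o (fun x => \int[m2]_y f (x, y))).
Proof.
move=> h; apply: eq_integrable (integrable_fubini_F fi) => // x _ /=.
rewrite /fubini_F /Rintegral fineK//.
by apply: (@integrable_fin_num _ _ _ m2 setT measurableT (EFin \o (fun y => f (x, y)))).
Qed.

Lemma integrable_fubini21 :
  (forall y, m1.-integrable setT (EFin \o (fun x => f (x, y)))) ->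
  m2.-integrable setT (EFin \o (fun y => \int[m1]_x f (x, y))).
Proof.
move=> h; have mf := measurable_int _ fi.
have E y : (\int[m1]_x f (x, y))%:E = fubini_G m1 (EFin \o f) y.
  rewrite /fubini_G /Rintegral fineK//.
  by apply: (@integrable_fin_num _ _ _ m1 setT measurableT (EFin \o (fun x => f (x, y)))).
have -> : EFin \o (fun y => \int[m1]_x f (x, y)) = fubini_G m1 (EFin \o f).
  by apply/funext => y /=; rewrite E.
apply/integrableP; split; first exact: (measurable_fubini_G fi).
have lty : (\int[m2]_y \int[m1]_x `|(f (x, y))%:E| < +oo)%E.
  exact: ((integrable21ltyP m1 m2 mf).1 fi).
apply: le_lt_trans lty.
apply: ge0_le_integral => //.
- by apply: measurableT_comp => //; exact: (measurable_fubini_G fi).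
- apply: (measurable_fun_fubini_tonelli_G (abse \o (EFin \o f))) => //=.
  exact: measurableT_comp.
- by move=> y _; apply: le_abse_integral => //; have /integrableP[] := h y.
Qed.

End RFubini.

(** * Extension by zero across the boundary *)

(* When s vanishes on the boundary of U, the factor s^2 makes m, bounded on U
   together with its derivative, differentiable after extension by zero.  This
   replaces traces and boundary integrals in all the integrations by parts. *)
Section ZeroExtension.
Context (R : realType) (V : normedModType R) (v : V) (U : set V).
Variables (s ds m dm : V -> R) (C : R).
Hypotheses (oU : open U) (cs : continuous s) (cds : continuous ds)
  (sD : forall x, is_derive x v s (ds x))
  (mc : forall x, U x -> {for x, continuous m})
  (dmc : forall x, U x -> {for x, continuous dm})
  (mD : forall x, U x -> is_derive x v m (dm x))
  (mC : forall x, U x -> `|m x| <= C) (dmC : forall x, U x -> `|dm x| <= C)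
  (sU : forall x, ~ U x -> s x = 0 \/ \forall y \near x, ~ U y).

Let H := (fun x => s x ^+ 2 * m x) \_ U.
Let H' := (fun x => 2 * s x * ds x * m x + s x ^+ 2 * dm x) \_ U.

(** If [U] is empty, [C] may be negative; the maximum with 0 keeps the bounds on [H] and [H'] valid
    on the whole space. *)
Let C0 : 0 <= Num.max C 0. Proof. by rewrite le_max lexx orbT. Qed.
Let mC' x : U x -> `|m x| <= Num.max C 0.
Proof. by move=> Ux; rewrite le_max mC. Qed.
Let dmC' x : U x -> `|dm x| <= Num.max C 0.
Proof. by move=> Ux; rewrite le_max dmC. Qed.

Let HE x : U x -> H x = s x ^+ 2 * m x.
Proof. by move=> Ux; rewrite /H patchE mem_set. Qed.
Let H'E x : U x -> H' x = 2 * s x * ds x * m x + s x ^+ 2 * dm x.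
Proof. by move=> Ux; rewrite /H' patchE mem_set. Qed.
Let H0 x : ~ U x -> H x = 0.
Proof. by move=> Ux; rewrite /H patchE memNset. Qed.
Let H'0 x : ~ U x -> H' x = 0.
Proof. by move=> Ux; rewrite /H' patchE memNset. Qed.

Let Hle x : `|H x| <= Num.max C 0 * `|s x| * `|s x|.
Proof.
have [Ux|Ux] := pselect (U x); last by rewrite H0// normr0 !mulr_ge0.
by rewrite HE// normrM normrX mulrC expr2 mulrA !ler_wpM2r// mC'.
Qed.

Let H'le x : `|H' x| <= Num.max C 0 * (2 * `|ds x| + `|s x|) * `|s x|.
Proof.
have [Ux|Ux] := pselect (U x); last by rewrite H'0// normr0 !mulr_ge0// addr_ge0// mulr_ge0.
rewrite H'E// (_ : _ + _ = (2 * ds x * m x + s x * dm x) * s x); last by ring.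
rewrite normrM ler_wpM2r// (le_trans (ler_normD _ _))// !normrM mulrDr.
rewrite (ger0_norm (ler0n R 2)).
rewrite lerD// mulrC; first by rewrite ler_wpM2r ?mulr_ge0// mC'.
by rewrite ler_wpM2r// dmC'.
Qed.

Let nearU x : U x -> \forall y \near x, U y.
Proof. by move: oU; rewrite openE; exact. Qed.

(** The delicate points are the zeros of [s] outside [U], where [H'] tends to 0 because [H'le]
    bounds it by a locally bounded multiple of |s|. *)
Lemma ext_derive_continuous : continuous H'.
Proof.
move=> x; have [Ux|Ux] := pselect (U x).
  have h : {for x, continuous (fun x => 2 * s x * ds x * m x + s x ^+ 2 * dm x)}.
    apply: cvgD.
      apply: cvgM; last exact: mc.
      by apply: cvgM; [apply: cvgM; [exact: cvg_cst|exact: cs]|exact: cds].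
    apply: cvgM; last exact: dmc.
    by rewrite expr2; under eq_fun do rewrite expr2; apply: cvgM; exact: cs.
  move: h; rewrite /prop_for /continuous_at -H'E//; apply: cvg_trans.
  apply: near_eq_cvg; near=> y; rewrite H'E//; near: y; exact: nearU.
rewrite /continuous_at H'0//.
case: (sU _ Ux) => [sx0|nU]; last first.
  have h : cst (0 : R) y @[y --> x] --> (0 : R) by exact: cvg_cst.
  apply: cvg_trans h; apply: near_eq_cvg.
  by near=> y; rewrite H'0//; near: y.
apply/norm_cvg0P; apply: (@squeeze_cvgr _ _ _ _ (cst 0)
  (fun y => Num.max C 0 * (2 * `|ds y| + `|s y|) * `|s y|)).
- by apply: nearW => y; rewrite normr_ge0/= H'le.
- exact: cvg_cst.
- rewrite [X in _ --> X](_ : _ =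
      Num.max C 0 * (2 * `|ds x| + `|s x|) * `|s x|); last first.
    by rewrite sx0 normr0 mulr0.
  have ns : {for x, continuous (fun y => `|s y|)} by apply: cvg_norm; exact: cs.
  have nds : {for x, continuous (fun y => `|ds y|)} by apply: cvg_norm; exact: cds.
  have c2 c : {for x, continuous (fun=> c : R)} by exact: cvg_cst.
  exact: (continuousM (continuousM (c2 _) (continuousD (continuousM (c2 2) nds) ns)) ns).
Unshelve. all: by end_near. Qed.

(** At a zero of [s] outside [U], the difference quotient of [H] is at most a constant times |(s(x +
    hv) - s(x)) / h| |s(x + hv)|: a convergent factor times one that tends to 0. *)
Lemma ext_derive x : is_derive x v H (H' x).
Proof.
have [Ux|Ux] := pselect (U x).
  apply: (@near_eq_is_derive _ _ _ (fun x => s x ^+ 2 * m x)).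
    by near=> y; rewrite HE//; near: y; exact: nearU.
  have h1 := @is_deriveX _ _ _ 2 _ _ _ (sD x).
  apply: is_derive_eq (is_deriveM h1 (mD _ Ux)) _.
  rewrite H'E// !fctE /GRing.scale/= expr1; ring.
rewrite H'0//; case: (sU _ Ux) => [sx0|nU]; last first.
  have h := is_derive_cst (0 : R) x v.
  apply: near_eq_is_derive h.
  by near=> y; rewrite H0//; near: y.
have P : h^-1 *: (H (h *: v + x) - H x) @[h --> 0^'] --> 0.
  apply/norm_cvg0P; apply: (@squeeze_cvgr _ _ _ _ (cst 0)
    (fun h => Num.max C 0 * `|h^-1 *: (s (h *: v + x) - s x)| *
     `|s (h *: v + x)|)).
  - near=> h; rewrite normr_ge0/= (H0 _ Ux) subr0 sx0 subr0.
    rewrite !normrZ [leRHS](_ : _ = `|h^-1| *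
      (Num.max C 0 * `|s (h *: v + x)| * `|s (h *: v + x)|)); last by ring.
    by rewrite ler_wpM2l// Hle.
  - exact: cvg_cst.
  - rewrite [X in _ --> X](_ : _ = Num.max C 0 * `|ds x| * `|s x|); last first.
      by rewrite sx0 normr0 mulr0.
    have d : h^-1 *: (s (h *: v + x) - s x) @[h --> 0^'] --> ds x.
      by have [+ <-] := sD x.
    have l : h *: v + x @[h --> (0 : R)^'] --> x.
      rewrite -[X in _ --> X]add0r -(scale0r v).
      apply: cvgD; last exact: cvg_cst.
      by apply: cvgZr_tmp; exact: cvg_within.
    have sl : s (h *: v + x) @[h --> (0 : R)^'] --> s x.
      exact: (continuous_cvg _ (cs x) l).
    have c1 : cst (Num.max C 0) h @[h --> (0 : R)^'] --> Num.max C 0.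
      exact: cvg_cst.
    exact: (cvgM (cvgM c1 (cvg_norm d)) (cvg_norm sl)).
apply: DeriveDef; first by apply/cvg_ex; exists 0.
exact/cvg_lim.
Unshelve. all: by end_near. Qed.

End ZeroExtension.

(** * Calculus along lines *)

Section Lines.
Context {R : realType}.

(** A directional derivative sees a function only along one line, so it can be moved between spaces;
    partial derivatives thus become one-variable derivatives and conversely. *)
Lemma is_derive_transfer (V W : normedModType R) (f : V -> R) (g : W -> R)
  (a v : V) (b w : W) (d : R) :
  (forall h : R, f (h *: v + a) = g (h *: w + b)) ->
  is_derive a v f d -> is_derive b w g d.
Proof.
move=> fg [df <-].
have fab : f a = g b by have := fg 0; rewrite !scale0r !add0r.
have E : (fun h : R => h^-1 *: (f (h *: v + a) - f a)) =
         (fun h : R => h^-1 *: (g (h *: w + b) - g b)).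
  by apply/funext => h; rewrite fg fab.
by apply: DeriveDef; rewrite /derivable /derive /= -E.
Qed.

(** Restricting [f] to the line through [x] reduces this to the chain rule on the real line; a
    directional derivative of [f] is enough. *)
Lemma is_derive_comp1 (V : normedModType R) (g : R -> R) (f : V -> R)
  (x v : V) (a b : R) :
  is_derive (f x) 1 g a -> is_derive x v f b ->
  is_derive x v (fun y => g (f y)) (a * b).
Proof.
move=> dg df.
have h1 : is_derive (0 : R) 1 (fun t : R => f (t *: v + x)) b.
  by apply: is_derive_transfer df => h; rewrite addr0 [h *: 1]mulr1.
have h2 := @is_derive1_comp R g (fun t : R => f (t *: v + x)) 0 a b.
rewrite scale0r add0r in h2; have {}h2 := h2 dg h1.
by apply: is_derive_transfer h2 => h; rewrite addr0 [h *: 1]mulr1.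
Qed.

Lemma derive_column (f : pt R -> R) x y z d :
  is_derive ((x, y, z) : pt R) (evec 2%:R) f d <->
  is_derive z 1 (fun t => f (x, y, t)) d.
Proof.
have E h : f (h *: evec 2%:R + (x, y, z)) = f (x, y, h *: 1 + z).
  by congr f; congr (_, _, _); rewrite /= ?scaler0 ?add0r.
by split; apply: is_derive_transfer => h; rewrite E.
Qed.

Lemma FTC (F f : R -> R) (a b : R) : a <= b ->
  (forall x, a <= x <= b -> is_derive x 1 F (f x)) ->
  (forall x, a <= x <= b -> {for x, continuous f}) ->
  \int[lebesgue_measure]_(x in `[a, b]) f x = F b - F a.
Proof.
rewrite le_eqVlt => /orP[/eqP <-|ab] dF cf.
  by rewrite set_itv1 Rintegral_set1 subrr.
rewrite /Rintegral (continuous_FTC2 (F := F) ab)//.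
- apply: continuous_in_subspaceT => x /set_mem /=; rewrite in_itv/=; exact: cf.
- have dc x : a <= x <= b -> {for x, continuous F}.
    move=> /dF dx; apply/differentiable_continuous/derivable1_diffP.
    by case: dx.
  split.
  + move=> x; rewrite in_itv/= => /andP[ax xb].
    by have [|] := dF x; rewrite ?ltW.
  + by apply: cvg_at_right_filter; apply: dc; rewrite lexx ltW.
  + by apply: cvg_at_left_filter; apply: dc; rewrite lexx ltW.
- move=> x; rewrite in_itv/= => /andP[ax xb].
  by rewrite derive1E; have [|_ ->] := dF x; rewrite ?ltW.
Qed.

Lemma FTC_compact (F f : R -> R) (r : R) :
  (forall x : R, is_derive x 1 F (f x)) -> continuous f ->
  (forall x, r <= `|x| -> F x = 0) -> (forall x, r <= `|x| -> f x = 0) ->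
  \int[lebesgue_measure]_x f x = 0.
Proof.
(* [r] may be negative, hence the maximum with 0. *)
move=> dF cf F0 f0; pose b := Num.max r 0.
have b0 : 0 <= b by rewrite le_max lexx orbT.
have rb : r <= b by rewrite le_max lexx.
have -> : f = f \_ `[- b, b].
  apply/funext => x; rewrite patchE; case: ifPn => // /negP xb.
  apply: f0; rewrite leNgt; apply/negP => xr; apply: xb.
  rewrite inE /= in_itv /= -ler_norml.
  by rewrite (le_trans (ltW xr)).
rewrite -Rintegral_mkcond (FTC F f (- b) b _ (fun t _ => dF t) (fun t _ => cf t)); last lra.
by rewrite !F0 ?normrN ?(ger0_norm b0)// subrr.
Qed.

Lemma Rintegral_cst_itv (c a b : R) : a <= b ->
  \int[lebesgue_measure]_(z in `[a, b]) cst c z = c * (b - a).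
Proof.
move=> ab; have <- : fine ((@lebesgue_measure R) `[a, b]) = b - a.
  rewrite lebesgue_measure_itv/= lte_fin; case: ltP => // ba.
  by apply/esym/eqP; rewrite subr_eq0 eq_le ab ba.
exact: Rintegral_cst.
Qed.

(* Bounding by the total variation: the basis of Gagliardo's inequality. *)
Lemma le_int_derive (F f : R -> R) (r x : R) :
  (forall x : R, is_derive x 1 F (f x)) -> continuous f ->
  (forall x, r <= `|x| -> F x = 0) -> (forall x, r <= `|x| -> f x = 0) ->
  `|F x| <= \int[lebesgue_measure]_t `|f t|.
Proof.
move=> dF cf F0 f0; pose b := Num.max r `|x|.
have rb : r <= b by rewrite le_max lexx.
have xb : `|x| <= b by rewrite le_max lexx orbT.
have b0 : 0 <= b by rewrite (le_trans _ xb).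
have /andP[bx xb'] : - b <= x <= b by rewrite -ler_norml.
have cfn : continuous (fun t => `|f t|) by move=> t; apply: cvg_norm; exact: cf.
have int A g : compact A -> continuous g ->
    lebesgue_measure.-integrable A (EFin \o (g : R -> R)).
  move=> cA cg; apply: continuous_compact_integrable => //.
  exact: continuous_subspaceT.
have mi a c : measurable (`[a, c] : set (measurableTypeR R)).
  exact: measurable_itv.
have -> : (fun t => `|f t|) = (fun t => `|f t|) \_ `[- b, b].
  apply/funext => t; rewrite patchE; case: ifPn => // /negP tb.
  rewrite f0 ?normr0// leNgt; apply/negP => tr; apply: tb.
  by rewrite inE /= in_itv /= -ler_norml (le_trans (ltW tr)).
rewrite -Rintegral_mkcond.
have -> : F x = \int[lebesgue_measure]_(t in `[- b, x]) f t.
  rewrite (FTC F f (- b) x bx (fun t _ => dF t) (fun t _ => cf t)).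
  by rewrite (F0 (- b)) ?subr0// normrN ger0_norm.
apply: (@le_trans _ _ (\int[lebesgue_measure]_(t in `[- b, x]) `|f t|)).
  by apply: le_normr_Rintegral => //; apply: int => //; exact: segment_compact.
rewrite Rintegral_mkcond [leRHS]Rintegral_mkcond.
apply: le_Rintegral => //.
- by rewrite -restrict_EFin; apply/integrable_restrict => //=; rewrite setTI;
    apply: int => //; exact: segment_compact.
- by rewrite -restrict_EFin; apply/integrable_restrict => //=; rewrite setTI;
    apply: int => //; exact: segment_compact.
- move=> t _; rewrite !patchE.
  have [h|_] := boolP (t \in `[- b, x]%classic); last by case: ifP => _; rewrite ?normr_ge0.
  rewrite ifT//; move: h; rewrite !inE/= !in_itv/= => /andP[-> tx].
  exact: le_trans tx xb'.
Qed.

End Lines.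

(** * Algebra of functions regular up to the boundary *)

Section RegularFunctions.
#[local] Set Implicit Arguments.
#[local] Unset Strict Implicit.
Context (R : realType) (V : normedModType R) (I : Type) (dir : I -> V).
Variables (E : set V) (S : set (set V)).
Implicit Types (f g : V -> R) (df dg : I -> V -> R).

(* Regularity up to the boundary without mentioning the boundary: f is
   continuous in E and bounded on the part of E in each set of S.  For Omega,
   which is unbounded, S consists of the slabs |z| <= N. *)
Definition reg0 f : Prop :=
  (forall x, E x -> {for x, continuous f}) /\
  (forall B, S B -> exists C, forall x, E x -> B x -> `|f x| <= C).

(** The derivatives are carried as explicit functions: products and quotients then produce formulas,
    and regularity of order two is [reg1] for each [df i]. *)
Definition reg1 f df : Prop :=
  [/\ reg0 f, forall i, reg0 (df i) &
      forall x i, E x -> is_derive x (dir i) f (df i x)].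

Lemma reg0_cst c : reg0 (fun=> c).
Proof. by split=> [x _|B _]; [exact: cvg_cst|exists `|c|]. Qed.

Lemma reg0D f g : reg0 f -> reg0 g -> reg0 (fun x => f x + g x).
Proof.
move=> [cf bf] [cg bg]; split=> [x Ex|B SB].
  exact: continuousD (cf _ Ex) (cg _ Ex).
have [[C fC] [K gK]] := (bf _ SB, bg _ SB).
by exists (C + K) => x Ex Bx; rewrite (le_trans (ler_normD _ _))// lerD ?fC ?gK.
Qed.

Lemma reg0M f g : reg0 f -> reg0 g -> reg0 (fun x => f x * g x).
Proof.
move=> [cf bf] [cg bg]; split=> [x Ex|B SB].
  exact: continuousM (cf _ Ex) (cg _ Ex).
have [[C fC] [K gK]] := (bf _ SB, bg _ SB).
by exists (C * K) => x Ex Bx; rewrite normrM ler_pM ?fC ?gK.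
Qed.

Lemma reg0N f : reg0 f -> reg0 (fun x => - f x).
Proof.
move=> [cf bf]; split=> [x Ex|B SB]; first exact: continuousN (cf _ Ex).
by have [C fC] := bf _ SB; exists C => x Ex Bx; rewrite normrN fC.
Qed.

Lemma reg0B f g : reg0 f -> reg0 g -> reg0 (fun x => f x - g x).
Proof. by move=> rf rg; apply: reg0D => //; exact: reg0N. Qed.

Lemma reg0X f n : reg0 f -> reg0 (fun x => f x ^+ n).
Proof.
move=> rf; elim: n => [|n IH]; first exact: reg0_cst.
by under eq_fun do rewrite exprS; exact: reg0M.
Qed.

Lemma reg0_norm f : reg0 f -> reg0 (fun x => `|f x|).
Proof.
move=> [cf bf]; split=> [x Ex|B SB]; first by apply: cvg_norm; exact: cf.
by have [C fC] := bf _ SB; exists C => x Ex Bx; rewrite normr_id fC.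
Qed.

Lemma reg0V f c : 0 < c -> (forall x, E x -> c <= f x) ->
  reg0 f -> reg0 (fun x => (f x)^-1).
Proof.
move=> c0 cf [ctf bf]; split=> [x Ex|B SB].
  by apply: cvgV; [rewrite gt_eqF// (lt_le_trans c0)// cf|exact: ctf].
exists c^-1 => x Ex _; have fx : 0 < f x by rewrite (lt_le_trans c0)// cf.
have fi : 0 <= (f x)^-1 by rewrite invr_ge0 ltW.
by rewrite ger0_norm// lef_pV2// cf.
Qed.

Lemma reg0_sum (J : Type) (r : seq J) (f : J -> V -> R) :
  (forall j, reg0 (f j)) -> reg0 (fun x => \sum_(j <- r) f j x).
Proof.
move=> rf; elim: r => [|j r IH].
  by rewrite (_ : (fun _ => _) = fun=> 0); [exact: reg0_cst|apply/funext => x; rewrite big_nil].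
rewrite (_ : (fun _ => _) = fun x => f j x + \sum_(j <- r) f j x); first exact: reg0D.
by apply/funext => x; rewrite big_cons.
Qed.

Lemma reg0_eq f g : open E -> (forall x, E x -> f x = g x) -> reg0 f -> reg0 g.
Proof.
move=> oE fg [cf bf]; split=> [x Ex|B SB]; last first.
  by have [C fC] := bf _ SB; exists C => x Ex Bx; rewrite -fg// fC.
have := cf _ Ex; rewrite /prop_for /continuous_at fg//; apply: cvg_trans.
apply: near_eq_cvg; near=> y; apply/fg; near: y.
by move: oE; rewrite openE; exact.
Unshelve. all: by end_near. Qed.

Lemma reg1_cst c : reg1 (fun=> c) (fun _ _ => 0).
Proof.
split; [exact: reg0_cst|by move=> i; exact: reg0_cst|].
by move=> x i _; exact: is_derive_cst.
Qed.

Lemma reg1D f df g dg : reg1 f df -> reg1 g dg ->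
  reg1 (fun x => f x + g x) (fun i x => df i x + dg i x).
Proof.
move=> [rf rdf Df] [rg rdg Dg]; split; [exact: reg0D|by move=> i; exact: reg0D|].
by move=> x i Ex; exact: is_deriveD (Df _ _ Ex) (Dg _ _ Ex).
Qed.

Lemma reg1N f df : reg1 f df -> reg1 (fun x => - f x) (fun i x => - df i x).
Proof.
move=> [rf rdf Df]; split; [exact: reg0N|by move=> i; exact: reg0N|].
by move=> x i Ex; exact: is_deriveN (Df _ _ Ex).
Qed.

Lemma reg1B f df g dg : reg1 f df -> reg1 g dg ->
  reg1 (fun x => f x - g x) (fun i x => df i x - dg i x).
Proof. by move=> rf rg; apply: reg1D => //; exact: reg1N. Qed.

Lemma reg1M f df g dg : reg1 f df -> reg1 g dg ->
  reg1 (fun x => f x * g x) (fun i x => df i x * g x + f x * dg i x).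
Proof.
move=> [rf rdf Df] [rg rdg Dg]; split; first exact: reg0M.
  by move=> i; apply: reg0D; exact: reg0M.
move=> x i Ex; apply: is_derive_eq (is_deriveM (Df _ i Ex) (Dg _ i Ex)) _.
by rewrite /GRing.scale/= addrC mulrC.
Qed.

Lemma reg1V f df c : 0 < c -> (forall x, E x -> c <= f x) -> reg1 f df ->
  reg1 (fun x => (f x)^-1) (fun i x => - df i x * (f x)^-1 ^+ 2).
Proof.
move=> c0 cf [rf rdf Df]; split; first exact: reg0V cf rf.
  move=> i; apply: reg0M; first exact: reg0N.
  by apply: reg0X; exact: reg0V cf rf.
move=> x i Ex; have fx : f x != 0 by rewrite gt_eqF// (lt_le_trans c0)// cf.
have h := @is_deriveV R id (f x) 1 1 fx (is_derive_id _ _).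
apply: is_derive_eq (is_derive_comp1 _ _ _ _ _ _ _ h (Df _ i Ex)) _.
by rewrite /GRing.scale/= mulr1 mulNr mulNr mulrC exprVn.
Qed.

(** Replaces the derivative assembled by the preceding lemmas by a closed form that [ring] or
    [field] can check. *)
Lemma reg1_eq f df g dg : open E -> (forall x, E x -> f x = g x) ->
  (forall x i, E x -> df i x = dg i x) -> reg1 f df -> reg1 g dg.
Proof.
move=> oE fg dfg [rf rdf Df]; split; first exact: reg0_eq fg rf.
  by move=> i; apply: reg0_eq (rdf i) => // x Ex; rewrite dfg.
move=> x i Ex; rewrite -dfg//; apply: near_eq_is_derive (Df _ _ Ex).
by near=> y; apply: fg; near: y; move: oE; rewrite openE; exact.
Unshelve. all: by end_near. Qed.

Lemma reg1_sum (J : Type) (r : seq J) (f : J -> V -> R) (df : J -> I -> V -> R) :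
  (forall j, reg1 (f j) (df j)) ->
  reg1 (fun x => \sum_(j <- r) f j x) (fun i x => \sum_(j <- r) df j i x).
Proof.
move=> rf; elim: r => [|j r IH].
  have -> : (fun x => \sum_(j <- [::]) f j x) = (fun=> 0).
    by apply/funext => x; rewrite big_nil.
  have -> : (fun i x => \sum_(j <- [::]) df j i x) = (fun _ _ => 0).
    by apply/funext => i; apply/funext => x; rewrite big_nil.
  exact: reg1_cst.
have -> : (fun x => \sum_(j <- j :: r) f j x) =
    (fun x => f j x + \sum_(j <- r) f j x).
  by apply/funext => x; rewrite big_cons.
have -> : (fun i x => \sum_(j <- j :: r) df j i x) =
    (fun i x => df j i x + \sum_(j <- r) df j i x).
  by apply/funext => i; apply/funext => x; rewrite big_cons.
exact: reg1D.
Qed.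

Lemma reg1_zero f df : open E -> reg1 f df -> (forall x, E x -> f x = 0) ->
  forall i x, E x -> df i x = 0.
Proof.
move=> oE [_ _ Df] f0 i x Ex; have [_ <-] := Df x i Ex.
transitivity ('D_(dir i) (cst 0 : V -> R) x); last exact: derive_cst.
apply: near_eq_derive.
by near=> y; apply: f0; near: y; apply: open_nbhs_nbhs; split.
Unshelve. all: by end_near. Qed.

End RegularFunctions.

(** * Compact supports and sigma-finiteness in the plane *)

Section Prelim.
Context {R : realType}.
Local Notation mR := (measurableTypeR R).

Lemma int_compact_support (f : R -> R) (r : R) : continuous f ->
  (forall x, r <= `|x| -> f x = 0) ->
  (@lebesgue_measure R).-integrable setT (EFin \o f).
Proof.
move=> cf f0; have -> : f = f \_ `[- r, r].
  apply/funext => x; rewrite patchE; case: ifPn => // /negP xb.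
  apply: f0; rewrite leNgt; apply/negP => xr; apply: xb.
  by rewrite inE /= in_itv /= -ler_norml ltW.
have mi : measurable (`[- r, r] : set mR) by exact: measurable_itv.
rewrite -restrict_EFin; apply/integrable_restrict => //=.
rewrite setTI; apply: continuous_compact_integrable.
  exact: segment_compact.
exact: continuous_subspaceT.
Qed.

Lemma leb2_box (a b c d : R) :
  (leb2 (`[a, b] `*` `[c, d] : set (mR * mR)) < +oo)%E.
Proof.
rewrite /leb2 /= product_measure1E; [|exact: measurable_itv|exact: measurable_itv].
have L (u w : R) : (@lebesgue_measure R `[u, w] < +oo)%E.
  by rewrite lebesgue_measure_itv/=; case: ifP; rewrite ?ltry// -EFinD ltry.
by apply: lte_mul_pinfty; rewrite ?ge0_fin_numE//; exact: L.
Qed.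

Lemma leb2_sigma_finite : sigma_finite setT (@leb2 R).
Proof.
exists (fun n => `[- n%:R, n%:R] `*` `[- n%:R, n%:R]).
  apply/seteqP; split => // p _.
  pose n := (Num.truncn (`|p.1| + `|p.2|)).+1.
  have h : `|p.1| + `|p.2| < n%:R by exact: truncnS_gt.
  exists n => //; split; rewrite /= in_itv/= -ler_norml.
    by rewrite (le_trans _ (ltW h))// lerDl.
  by rewrite (le_trans _ (ltW h))// lerDr.
move=> n; split; first by apply: measurableX; exact: measurable_itv.
exact: leb2_box.
Qed.
(** [leb3] is the product of [leb2] with a line, and Fubini requires the first factor as a
    sigma-finite measure. *)
Definition leb2s : {sigma_finite_measure set (mR * mR)%type -> \bar R} :=
  HB.pack ((@lebesgue_measure R) \x (@lebesgue_measure R))%E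
    (Measure_isSigmaFinite.Build _ _ _
      ((@lebesgue_measure R) \x (@lebesgue_measure R))%E leb2_sigma_finite).

Lemma pair_continuous (U V W : topologicalType) (f : U -> V) (g : U -> W)
  (x : U) : {for x, continuous f} -> {for x, continuous g} ->
  {for x, continuous (fun y => (f y, g y))}.
Proof. by move=> cf cg; exact: cvg_pair. Qed.

End Prelim.

(** * The horizontal section and its boundary weight *)

Section Annulus.
#[local] Set Implicit Arguments.
#[local] Unset Strict Implicit.
Context {R : realType}.
Local Notation mR := (measurableTypeR R).
Variables R1 R2 : R.

(** Written so that [annulus R1 R2 p] is convertible to [Omega R1 R2 (p, z)]; membership passes from
    one to the other silently. *)
Definition annulus : set (R * R) :=
  [set p | R1 ^+ 2 < p.1 ^+ 2 + p.2 ^+ 2 < R2 ^+ 2].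

(* The boolean selects a coordinate of the plane: false for x, true for y. *)
Definition dir2 (b : bool) : R * R := if b then (0, 1) else (1, 0).

Definition rsq (p : R * R) : R := p.1 ^+ 2 + p.2 ^+ 2.

(* Vanishes exactly on the two boundary circles. *)
Definition annulus_weight (p : R * R) : R := (R2 ^+ 2 - rsq p) * (rsq p - R1 ^+ 2).

Definition coord2 (b : bool) (p : R * R) : R := if b then p.2 else p.1.

Definition dannulus_weight (b : bool) (p : R * R) : R :=
  2 * coord2 b p * (R1 ^+ 2 + R2 ^+ 2 - 2 * rsq p).

(** [E] and [S] are left generic: on the annulus the bounds hold globally, and with [S] empty they
    are vacuous, which gives plain differentiability on the whole plane. *)
Lemma coord2_reg1 (E : set (R * R)) S c :
  (forall B, S B -> exists C, forall p, E p -> B p -> `|coord2 c p| <= C) ->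
  reg1 dir2 E S (coord2 c) (fun b _ => (b == c)%:R).
Proof.
move=> h; split; last 1 first.
- move=> p b _; case: c {h}.
  + apply: (@is_derive_transfer R R (R * R)%type id _ p.2 (dir2 b).2) => //.
    by case: b; exact: is_derive_id.
  + apply: (@is_derive_transfer R R (R * R)%type id _ p.1 (dir2 b).1) => //.
    by case: b; exact: is_derive_id.
- split => // p _; case: c {h}; [exact: cvg_snd|exact: cvg_fst].
- by move=> b; exact: reg0_cst.
Qed.

Lemma rsq_reg1 (E : set (R * R)) S : open E ->
  (forall c B, S B -> exists C, forall p, E p -> B p -> `|coord2 c p| <= C) ->
  reg1 dir2 E S rsq (fun b p => 2 * coord2 b p).
Proof.
move=> oE h; have h1 := coord2_reg1 (h false); have h2 := coord2_reg1 (h true).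
apply: reg1_eq (reg1D (reg1M h1 h1) (reg1M h2 h2)) => //.
by move=> p b _; case: b; rewrite /=; ring.
Qed.

Lemma annulus_weight_reg1 (E : set (R * R)) S : open E ->
  (forall c B, S B -> exists C, forall p, E p -> B p -> `|coord2 c p| <= C) ->
  reg1 dir2 E S annulus_weight dannulus_weight.
Proof.
move=> oE h; have hr := rsq_reg1 oE h.
apply: reg1_eq (reg1M (reg1B (reg1_cst _ _ _ (R2 ^+ 2)) hr)
  (reg1B hr (reg1_cst _ _ _ (R1 ^+ 2)))) => //.
by move=> p b _; rewrite /dannulus_weight; ring.
Qed.

Lemma rsq_continuous : continuous rsq.
Proof.
by have [[h _] _ _] := @rsq_reg1 setT set0 openT (fun _ _ => False_ind _);
  move=> p; exact: h.
Qed.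

Lemma annulus_open : open annulus.
Proof.
have -> : annulus = rsq @^-1` `]R1 ^+ 2, R2 ^+ 2[.
  by apply/seteqP; split => p /=; rewrite in_itv.
by apply: open_comp; [move=> p _; exact: rsq_continuous|exact: itv_open].
Qed.

Lemma annulus_measurable : measurable (annulus : set (mR * mR)).
Proof. exact: open_measurable2 annulus_open. Qed.

Hypotheses (R1_gt0 : 0 < R1) (R1_lt_R2 : R1 < R2).

Let R2_gt0 : 0 < R2. Proof. exact: lt_trans R1_lt_R2. Qed.
Let R12 : R1 ^+ 2 < R2 ^+ 2.
Proof. by rewrite ltr_pXn2r// nnegrE ltW. Qed.

Lemma annulus_coord c p : annulus p -> `|coord2 c p| <= R2.
Proof.
move=> /andP[_ h]; have R20 := ltW R2_gt0.
rewrite -(@ler_pXn2r _ 2) ?nnegrE// real_normK ?num_real//.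
by case: c => /=; have a := sqr_ge0 p.1; have b := sqr_ge0 p.2; lra.
Qed.

Lemma annulus_finite : (leb2 annulus < +oo)%E.
Proof.
apply: le_lt_trans (leb2_box (- R2) R2 (- R2) R2).
apply: le_measure; rewrite ?inE.
- exact: annulus_measurable.
- by apply: measurableX; exact: measurable_itv.
- move=> p pA; split => /=; rewrite in_itv/= -ler_norml.
    exact: (annulus_coord false pA).
  exact: (annulus_coord true pA).
Qed.

(** The two factors have the positive sum R2^2 - R1^2, so they cannot both be negative. *)
Lemma annulus_weight_gt0 p : (0 < annulus_weight p) <-> annulus p.
Proof.
rewrite /annulus_weight /annulus /= -/(rsq p); have R12' := R12.
split => [h|/andP[h1 h2]]; last by rewrite mulr_gt0//; lra.
by apply/andP; split; nra.
Qed.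

(** This is the hypothesis [sU] of the extension by zero: where the weight is negative, it stays so
    nearby by continuity. *)
Lemma annulus_weight_out p : ~ annulus p -> annulus_weight p = 0 \/ \forall q \near p, ~ annulus q.
Proof.
move=> /annulus_weight_gt0/negP; rewrite -leNgt le_eqVlt => /orP[/eqP ->|s0]; [by left|].
right; have cs : {for p, continuous annulus_weight}.
  have [[h _] _ _] := @annulus_weight_reg1 setT set0 openT (fun _ _ => False_ind _).
  exact: h.
near=> q => /annulus_weight_gt0; apply/negP; rewrite -leNgt ltW//.
by near: q; exact: (cvgr_lt _ cs).
Unshelve. all: by end_near. Qed.

(** A section is bounded, so the single test set [setT] asks for a global bound. *)
Local Notation reg0A := (reg0 annulus [set setT]).
Local Notation reg1A := (reg1 dir2 annulus [set setT]).

Lemma annulus_bd c B : [set setT] B ->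
  exists C, forall p, annulus p -> B p -> `|coord2 c p| <= C.
Proof. by exists R2 => p /annulus_coord. Qed.

Lemma reg0A_bdd_measurable f : reg0A f -> bdd_measurable (annulus : set (mR * mR)) f.
Proof.
move=> [cf bf]; split.
  by apply: continuous_measurable2; [exact: annulus_open|exact: cf].
by have [C fC] := bf setT erefl; exists C => x Ax; exact: fC.
Qed.

Lemma reg0A_int f : reg0A f -> leb2.-integrable annulus (EFin \o f).
Proof.
move=> /reg0A_bdd_measurable rf; apply: bdd_measurable_integrable rf; [exact: annulus_measurable|].
exact: annulus_finite.
Qed.

End Annulus.

(** * Integration by parts and Gagliardo's inequality under the cutoff *)

Section SliceDivergence.
#[local] Set Implicit Arguments.
#[local] Unset Strict Implicit.
Context {R : realType}.
Local Notation mR := (measurableTypeR R).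
Variables R1 R2 : R.
Hypotheses (R1_gt0 : 0 < R1) (R1_lt_R2 : R1 < R2).
Let R2_gt0 : 0 < R2. Proof. exact: lt_trans R1_lt_R2. Qed.

Local Notation A := (annulus R1 R2).
Local Notation s := (annulus_weight R1 R2).
Local Notation ds := (dannulus_weight R1 R2).
Local Notation reg0A := (reg0 A [set setT]).
Local Notation reg1A := (reg1 dir2 A [set setT]).

Let sreg : reg1 dir2 setT set0 s ds.
Proof. by apply: annulus_weight_reg1; [exact: openT|move=> c B []]. Qed.

Definition cutoff2 (m : R * R -> R) : R * R -> R :=
  (fun p => s p ^+ 2 * m p) \_ A.
Definition dcutoff2 (m : R * R -> R) (dm : bool -> R * R -> R) b : R * R -> R :=
  (fun p => 2 * s p * ds b p * m p + s p ^+ 2 * dm b p) \_ A.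

Section Cutoff.
Variables (m : R * R -> R) (dm : bool -> R * R -> R).
Hypothesis rm : reg1A m dm.

Let ext : exists C, (forall p, A p -> `|m p| <= C) /\
  (forall b p, A p -> `|dm b p| <= C).
Proof.
have [[_ /(_ setT erefl) [C mC]] h _] := rm.
have [[_ /(_ setT erefl) [C0 hC0]] [_ /(_ setT erefl) [C1 hC1]]] := (h false, h true).
exists (Num.max C (Num.max C0 C1)); split => [p Ap|b p Ap].
  by rewrite le_max mC.
by case: b; rewrite !le_max ?hC0 ?hC1// !orbT.
Qed.

Lemma dcutoff2_continuous b : continuous (dcutoff2 m dm b).
Proof.
have [C [mC dmC]] := ext; have [[sc _] dsc sD] := sreg.
have [[mc _] dmc mD] := rm.
apply: (@ext_derive_continuous _ _ _ _ _ m (dm b) C) => //.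
- exact: annulus_open.
- by move=> p; exact: sc.
- by move=> p; have [h _] := dsc b; exact: h.
- by have [h _] := dmc b.
- by move=> p Ap; exact: dmC.
- by move=> p Ap; apply: annulus_weight_out.
Qed.

Lemma cutoff2_derive b p : is_derive p (dir2 b) (cutoff2 m) (dcutoff2 m dm b p).
Proof.
have [C [mC dmC]] := ext; have [[sc _] dsc sD] := sreg.
have [[mc _] dmc mD] := rm.
apply: (@ext_derive _ _ (dir2 b) A s (ds b) m (dm b) C) => //.
- exact: annulus_open.
- by move=> q; exact: sc.
- by move=> q; exact: sD.
- by move=> q Ap; apply: annulus_weight_out.
Qed.

Lemma annulus_out x y : R2 <= `|x| -> ~ A (x, y) /\ ~ A (y, x).
Proof.
have P : R2 <= `|x| -> R2 ^+ 2 <= x ^+ 2.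
  by move=> h; rewrite -[leRHS]real_normK ?num_real// ler_pXn2r// nnegrE ltW.
by move=> /P h; split; rewrite /annulus/= => /andP[_]; apply/negP;
  rewrite -leNgt; have := sqr_ge0 y; lra.
Qed.

(** Reduction to one variable: [b = true] moves the second coordinate, [b = false] the first. A line
    leaves the annulus once the moving coordinate reaches [R2] in absolute value. *)
Lemma cutoff2_line b t : exists F f : R -> R,
  [/\ forall x, F x = cutoff2 m (if b then (t, x) else (x, t)),
      forall x, f x = dcutoff2 m dm b (if b then (t, x) else (x, t)) &
   [/\ forall x : R, is_derive x 1 F (f x), continuous f,
      forall x, R2 <= `|x| -> F x = 0 & forall x, R2 <= `|x| -> f x = 0]].
Proof.
exists (fun x => cutoff2 m (if b then (t, x) else (x, t))),
  (fun x => dcutoff2 m dm b (if b then (t, x) else (x, t))); split=> //.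
split=> [x|x|x|x].
- have := cutoff2_derive b (if b then (t, x) else (x, t)).
  by apply: is_derive_transfer => h; case: b; congr cutoff2; congr (_, _);
    rewrite /= ?scaler0 ?add0r.
- apply: (@continuous_comp R (R * R)%type R (fun x => if b then (t, x) else (x, t))).
    by case: b; apply: pair_continuous; try exact: cvg_cst; exact: cvg_id.
  exact: dcutoff2_continuous.
- move=> /annulus_out => /(_ t)[h1 h2].
  by rewrite /cutoff2 patchE memNset//; case: b.
- move=> /annulus_out => /(_ t)[h1 h2].
  by rewrite /dcutoff2 patchE memNset//; case: b.
Qed.

Lemma dcutoff2_reg b :
  reg0A (fun p => 2 * s p * ds b p * m p + s p ^+ 2 * dm b p).
Proof.
have [rs rds _] : reg1A s ds by apply: annulus_weight_reg1; [exact: annulus_open|exact: annulus_bd].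
have [rm0 rdm _] := rm.
apply: reg0D; apply: reg0M => //; last exact: reg0X.
by apply: reg0M => //; apply: reg0M => //; exact: reg0_cst.
Qed.

Lemma dcutoff2_int b : (leb2 : {measure set (mR * mR) -> \bar R}).-integrable setT
  (EFin \o dcutoff2 m dm b).
Proof.
rewrite /dcutoff2 -restrict_EFin; apply/integrable_restrict => //.
  exact: annulus_measurable.
by rewrite setTI; apply: reg0A_int => //; exact: dcutoff2_reg.
Qed.

(** The integrand, extended by zero, is the derivative of a compactly supported function on each
    line in the direction [b]; Fubini takes these lines as inner integrals. *)
Lemma slice_ibp b :
  \int[leb2]_(p in A) (2 * s p * ds b p * m p + s p ^+ 2 * dm b p) = 0.
Proof.
rewrite Rintegral_mkcond -/(dcutoff2 m dm b) /leb2.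
have ii := dcutoff2_int b.
have z t : \int[lebesgue_measure]_x dcutoff2 m dm b (if b then (t, x) else (x, t)) = 0.
  have [F [f [_ fE [D cf F0 f0]]]] := cutoff2_line b t.
  by rewrite -[RHS](FTC_compact F f R2 D cf F0 f0); apply: Rintegral_ext => x _.
have sec t : (@lebesgue_measure R).-integrable setT
    (EFin \o (fun x => dcutoff2 m dm b (if b then (t, x) else (x, t)))).
  have [F [f [_ fE [D cf F0 f0]]]] := cutoff2_line b t.
  by rewrite (_ : (fun x => _) = f) ?(@int_compact_support _ f R2)//;
    apply/funext => x; rewrite fE.
case: b z sec ii => z sec ii.
- rewrite Rintegral_fubini12//; under eq_Rintegral do rewrite z.
  by rewrite Rintegral_cst// mul0r.
- rewrite Rintegral_fubini21//; under eq_Rintegral do rewrite z.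
  by rewrite Rintegral_cst// mul0r.
Qed.

Lemma cutoff2_sqr_reg : reg0A (fun p => (s p ^+ 2 * m p) ^+ 2).
Proof.
have [rs rds _] : reg1A s ds by apply: annulus_weight_reg1; [exact: annulus_open|exact: annulus_bd].
by have [rm0 rdm _] := rm; apply: reg0X; apply: reg0M => //; exact: reg0X.
Qed.

(** Let H be the function cut off. On lines of the two directions |H(x, y)| is at most a(y), the
    integral of |dH/dx|, and at most b(x), the integral of |dH/dy|. So H^2 <= a(y) b(x), whose
    integral factors. *)
Lemma slice_gagliardo :
  \int[leb2]_(p in A) ((s p ^+ 2 * m p) ^+ 2) <=
  (\int[leb2]_(p in A) `|2 * s p * ds false p * m p + s p ^+ 2 * dm false p|) *
  (\int[leb2]_(p in A) `|2 * s p * ds true p * m p + s p ^+ 2 * dm true p|).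
Proof.
pose mu := @lebesgue_measure R; pose K := dcutoff2 m dm.
have iK b := integrable_norm (dcutoff2_int b).
have KE b : \int[leb2]_(p in A) `|2 * s p * ds b p * m p + s p ^+ 2 * dm b p| =
    \int[leb2]_p `|K b p|.
  rewrite Rintegral_mkcond; apply: Rintegral_ext => p _; rewrite /K/dcutoff2 !patchE.
  by case: ifP => // _; rewrite normr0.
have HE : \int[leb2]_(p in A) ((s p ^+ 2 * m p) ^+ 2) = \int[leb2]_p (cutoff2 m p ^+ 2).
  rewrite Rintegral_mkcond; apply: Rintegral_ext => p _; rewrite /cutoff2 !patchE.
  by case: ifP => // _; rewrite expr0n.
have iH : leb2.-integrable setT (EFin \o (fun p => cutoff2 m p ^+ 2)).
  have -> : (fun p => cutoff2 m p ^+ 2) = (fun p => (s p ^+ 2 * m p) ^+ 2) \_ A.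
    apply/funext => p; rewrite /cutoff2 !patchE.
    by case: ifP => // _; rewrite expr0n.
  rewrite -restrict_EFin; apply/integrable_restrict => //.
    exact: annulus_measurable.
  by rewrite setTI; apply: reg0A_int => //; exact: cutoff2_sqr_reg.
have secK b t : mu.-integrable setT
    (EFin \o (fun x => `|K b (if b then (t, x) else (x, t))|)).
  have [F [f [_ fE [D cf F0 f0]]]] := cutoff2_line b t.
  apply: integrable_norm; rewrite /K (_ : (fun x => _) = f) ?(@int_compact_support _ f R2)//.
  by apply/funext => x; rewrite fE.
have secH t : mu.-integrable setT (EFin \o (fun x => cutoff2 m (t, x) ^+ 2)).
  have [F [f [FE _ [D cf F0 f0]]]] := cutoff2_line true t.
  rewrite (_ : (fun x => _) = (fun x => F x ^+ 2)); last first.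
    by apply/funext => x; rewrite FE.
  apply: (@int_compact_support _ _ R2) => x; last by move/F0 => ->; rewrite expr0n.
  have cF : {for x, continuous F}.
    by apply/differentiable_continuous/derivable1_diffP; case: (D x).
  exact: (continuousM cF cF).
pose a y := \int[mu]_x `|K false (x, y)|; pose b x := \int[mu]_y `|K true (x, y)|.
have Hb x y : `|cutoff2 m (x, y)| <= b x.
  have [F [f [FE fE [D cf F0 f0]]]] := cutoff2_line true x.
  rewrite -(FE y) (le_trans (le_int_derive F f R2 y D cf F0 f0))//.
  by rewrite le_eqVlt; apply/orP; left; apply/eqP/Rintegral_ext => t _; rewrite fE.
have Ha x y : `|cutoff2 m (x, y)| <= a y.
  have [F [f [FE fE [D cf F0 f0]]]] := cutoff2_line false y.
  rewrite -(FE x) (le_trans (le_int_derive F f R2 x D cf F0 f0))//.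
  by rewrite le_eqVlt; apply/orP; left; apply/eqP/Rintegral_ext => t _; rewrite fE.
have ia : mu.-integrable setT (EFin \o a).
  exact: (integrable_fubini21 (iK false) (secK false)).
have ib : mu.-integrable setT (EFin \o b).
  exact: (integrable_fubini12 (iK true) (secK true)).
rewrite HE !KE /leb2 (Rintegral_fubini12 iH secH) (Rintegral_fubini21 (iK false) (secK false)).
rewrite (Rintegral_fubini12 (iK true) (secK true)) -/a -/b.
rewrite -RintegralZl//; apply: le_Rintegral => //.
- exact: (integrable_fubini12 iH secH).
- exact: (integrableZl measurableT _ ib).
move=> x _; rewrite mulrC -RintegralZl//; apply: le_Rintegral => //.
- exact: (integrableZl measurableT (b x) ia).
- move=> y _; rewrite -real_normK ?num_real// expr2.
  by apply: ler_pM => //.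
Qed.

End Cutoff.
End SliceDivergence.

(** * Removal of the cutoff *)

Section SliceLimits.
#[local] Set Implicit Arguments.
#[local] Unset Strict Implicit.
Context {R : realType}.
Local Notation mR := (measurableTypeR R).
Variables R1 R2 : R.
Hypotheses (R1_gt0 : 0 < R1) (R1_lt_R2 : R1 < R2).
Let R2_gt0 : 0 < R2. Proof. exact: lt_trans R1_lt_R2. Qed.

Local Notation A := (annulus R1 R2).
Local Notation s := (annulus_weight R1 R2).
Local Notation ds := (dannulus_weight R1 R2).
Local Notation reg0A := (reg0 A [set setT]).
Local Notation reg1A := (reg1 dir2 A [set setT]).

Let rs : reg1A s ds.
Proof. by apply: annulus_weight_reg1; [exact: annulus_open|exact: annulus_bd]. Qed.
Let oA : open A. Proof. exact: annulus_open. Qed.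
Let mA : measurable (A : set (mR * mR)). Proof. exact: annulus_measurable. Qed.

(** A regular substitute for 1/s^2: multiplied by the factor s^2 of [cutoff2], it gives a cutoff
    that tends to 1 in the annulus. *)
Definition reginv (n : nat) (p : R * R) : R := (s p ^+ 2 + n.+1%:R^-1)^-1.

Let en_gt0 n : 0 < n.+1%:R^-1 :> R. Proof. by rewrite invr_gt0. Qed.

Lemma reginv_reg1 n :
  reg1A (reginv n) (fun b p => - (2 * s p * ds b p) * reginv n p ^+ 2).
Proof.
have h := reg1D (reg1M rs rs) (reg1_cst _ _ _ (n.+1%:R^-1)).
have c p : A p -> n.+1%:R^-1 <= s p * s p + n.+1%:R^-1.
  by move=> _; rewrite lerDr -expr2 sqr_ge0.
apply: reg1_eq (reg1V (en_gt0 n) c h) => // p b _ /=.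
by rewrite /reginv expr2; congr (- _ * _); ring.
Qed.

(* [apx n X Y] is the derivative of a field multiplied by the cutoff
   s^2 / (s^2 + 1/(n+1)), where X is the derivative of the field and Y = s' times
   the field; it converges to X, boundedly as soon as Y = O(s). *)
Definition apx n (X Y : R * R -> R) (p : R * R) : R :=
  s p ^+ 2 * reginv n p * X p +
  2 * s p * reginv n p ^+ 2 * n.+1%:R^-1 * Y p.

(* The derivative of [s^2 / (s^2 + e)] is [2 s s' e / (s^2 + e)^2]. *)
Lemma dcutoff_reginv n (F : R * R -> R) (dF : bool -> R * R -> R) b p :
  2 * s p * ds b p * (F p * reginv n p) + s p ^+ 2 *
    (dF b p * reginv n p + F p * (- (2 * s p * ds b p) * reginv n p ^+ 2)) =
  apx n (dF b) (fun q => ds b q * F q) p.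
Proof.
rewrite /apx /reginv; have := en_gt0 n; set e := n.+1%:R^-1 => e0.
have : s p ^+ 2 + e != 0 by rewrite gt_eqF// ltr_wpDl// sqr_ge0.
by move=> h; field.
Qed.

(** With w = [reginv n p] and e = 1/(n+1), both s^2 w and w e are at most 1. The factor s in the
    bound on [Y] completes 2 s w^2 e to 2 (s^2 w) (w e). *)
Lemma apx_bound n X Y C K p : A p -> `|X p| <= C -> `|Y p| <= K * s p ->
  `|apx n X Y p| <= C + 2 * K.
Proof.
move=> Ap XC YK; have s0 : 0 < s p by apply/annulus_weight_gt0.
have C0 := le_trans (normr_ge0 _) XC.
have K0 : 0 <= K.
  by have := le_trans (normr_ge0 _) YK; rewrite pmulr_lge0.
rewrite /apx /reginv; have := en_gt0 n; set e := n.+1%:R^-1 => e0.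
have d0 : 0 < s p ^+ 2 + e by rewrite ltr_wpDl// sqr_ge0.
set w := (_ + e)^-1; have w0 : 0 < w by rewrite invr_gt0.
have a1 : s p ^+ 2 * w <= 1 by rewrite ler_pdivrMr// mul1r lerDl ltW.
have a2 : w * e <= 1 by rewrite mulrC ler_pdivrMr// mul1r lerDr sqr_ge0.
have a0 : 0 <= s p ^+ 2 * w by rewrite mulr_ge0 ?sqr_ge0// ltW.
have b0 : 0 <= w * e by rewrite mulr_ge0// ltW.
apply: le_trans (ler_normD _ _) _; apply: lerD.
  by rewrite normrM (ger0_norm a0) -[leRHS]mul1r ler_pM.
have c0 : 0 <= 2 * s p * w ^+ 2 * e.
  apply: mulr_ge0; last exact: ltW.
  by apply: mulr_ge0; [apply: mulr_ge0 => //; exact: ltW|exact: sqr_ge0].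
rewrite normrM (ger0_norm c0).
apply: (@le_trans _ _ (2 * s p * w ^+ 2 * e * (K * s p))).
  by rewrite ler_wpM2l.
rewrite (_ : _ * _ = 2 * K * ((s p ^+ 2 * w) * (w * e))); last by ring.
rewrite -[leRHS]mulr1 ler_wpM2l// ?mulr_ge0//.
by rewrite -[leRHS]mulr1 ler_pM.
Qed.

Lemma apx_cvg X Y p : A p -> apx n X Y p @[n --> \oo] --> X p.
Proof.
move=> Ap; have s0 : 0 < s p by apply/annulus_weight_gt0.
have s2 : s p ^+ 2 != 0 by rewrite gt_eqF// exprn_gt0.
have ce : n.+1%:R^-1 @[n --> \oo] --> (0 : R) by exact: cvg_harmonic.
have cw : reginv n p @[n --> \oo] --> (s p ^+ 2)^-1.
  apply: cvgV => //; rewrite -[X in _ --> X]addr0.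
  by apply: cvgD => //; exact: cvg_cst.
rewrite [X in _ --> X](_ : _ = s p ^+ 2 * (s p ^+ 2)^-1 * X p +
  2 * s p * ((s p ^+ 2)^-1 * (s p ^+ 2)^-1) * 0 * Y p); last first.
  by rewrite mulfV// mulr0 mul0r addr0 mul1r.
rewrite /apx; apply: cvgD.
  by apply: cvgM; [apply: cvgM => //; exact: cvg_cst|exact: cvg_cst].
apply: cvgM; last exact: cvg_cst; apply: cvgM => //; apply: cvgM.
  exact: cvg_cst.
by under eq_fun do rewrite expr2; exact: cvgM.
Qed.

Lemma apx_reg0 n X Y : reg0A X -> reg0A Y -> reg0A (apx n X Y).
Proof.
move=> rX rY; have [rs0 _ _] := rs; have [rw _ _] := reginv_reg1 n.
apply: reg0D; apply: reg0M => //.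
  by apply: reg0M => //; exact: reg0X.
apply: reg0M; last exact: reg0_cst; apply: reg0M; last exact: reg0X.
by apply: reg0M => //; exact: reg0_cst.
Qed.

Lemma ds_bound b p : A p -> `|ds b p| <= 4 * R2 ^+ 3.
Proof.
move=> Ap; rewrite /dannulus_weight !normrM (ger0_norm (ler0n R 2)).
have h1 := annulus_coord R1_gt0 R1_lt_R2 b Ap.
have h2 : `|R1 ^+ 2 + R2 ^+ 2 - 2 * rsq p| <= 2 * R2 ^+ 2.
  move: Ap => /andP[]; rewrite -/(rsq p) => u v.
  have := sqr_ge0 R1; have := sqr_ge0 R2.
  by rewrite ler_norml => u1 u2; apply/andP; split; lra.
rewrite (_ : 4 * R2 ^+ 3 = 2 * R2 * (2 * R2 ^+ 2)); last by ring.
by rewrite ler_pM// ?mulr_ge0// ler_pM2l.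
Qed.

(* Divergence theorem: the flux through the boundary is zero because the
   normal component of the field is O(s). *)
Lemma slice_div (F G : R * R -> R) (dF dG : bool -> R * R -> R) :
  reg1A F dF -> reg1A G dG ->
  (exists C, forall p, A p -> `|p.1 * F p + p.2 * G p| <= C * s p) ->
  \int[leb2]_(p in A) (dF false p + dG true p) = 0.
Proof.
move=> rF rG [C hC]; have [rF0 rdF _] := rF; have [rG0 rdG _] := rG.
have [_ rds _] := rs.
pose X p := dF false p + dG true p.
pose Y p := ds false p * F p + ds true p * G p.
have rX : reg0A X by exact: reg0D.
have rY : reg0A Y by apply: reg0D; exact: reg0M.
have [_ /(_ setT erefl) [K hK]] := rX.
(* The gradient of [s] is radial, so [Y] is a bounded multiple of the normal component of the
   field. *)
have YC p : A p -> `|Y p| <= (4 * R2 ^+ 2 * C) * s p.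
  move=> Ap; rewrite (_ : Y p = 2 * (R1 ^+ 2 + R2 ^+ 2 - 2 * rsq p) *
    (p.1 * F p + p.2 * G p)); last by rewrite /Y /dannulus_weight /=; ring.
  rewrite normrM -mulrA ler_pM ?hC//.
  move: Ap => /andP[]; rewrite -/(rsq p) => u v.
  have := sqr_ge0 R1; have := sqr_ge0 R2.
  by rewrite ler_norml => u1 u2; apply/andP; split; lra.
(* [slice_ibp] is applied to F and G times [reginv n]; the sum of the two integrands is
   [apx n X Y]. *)
have I0 n : \int[leb2]_(p in A) apx n X Y p = 0.
  have e1 := slice_ibp R1_gt0 R1_lt_R2 (reg1M rF (reginv_reg1 n)) false.
  have e2 := slice_ibp R1_gt0 R1_lt_R2 (reg1M rG (reginv_reg1 n)) true.
  rewrite -[RHS]addr0 -{1}e1 -e2 -RintegralD //; last 2 first.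
  - by apply: reg0A_int => //; exact: (dcutoff2_reg R1_gt0 R1_lt_R2 (reg1M rF (reginv_reg1 n))).
  - by apply: reg0A_int => //; exact: (dcutoff2_reg R1_gt0 R1_lt_R2 (reg1M rG (reginv_reg1 n))).
  apply: Rintegral_ext => p _; rewrite !dcutoff_reginv /apx /X /Y; ring.
have lim : \int[leb2]_(p in A) apx n X Y p @[n --> \oo] -->
    \int[leb2]_(p in A) X p.
  apply: (bounded_cvg (C := K + 2 * (4 * R2 ^+ 2 * C))) => //.
  - exact: annulus_finite.
  - by move=> n; have [] := reg0A_bdd_measurable (apx_reg0 n rX rY).
  - by have [] := reg0A_bdd_measurable rX.
  - by move=> n p Ap; apply: apx_bound => //; [exact: hK|exact: YC].
  - by move=> p Ap; exact: apx_cvg.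
have : \int[leb2]_(p in A) apx n X Y p @[n --> \oo] --> (0 : R).
  by under eq_fun do rewrite I0; exact: cvg_cst.
by move=> lim0; exact: (cvg_unique _ lim lim0).
Qed.

(** Apply [slice_gagliardo] to w times [reginv n] and let n tend to infinity; the bound of [w] by
    [s] dominates the derivatives of the cutoff. *)
Lemma slice_gagliardo_limit (w : R * R -> R) (dw : bool -> R * R -> R) :
  reg1A w dw -> (exists C, forall p, A p -> `|w p| <= C * s p) ->
  \int[leb2]_(p in A) (w p ^+ 2) <=
  (\int[leb2]_(p in A) `|dw false p|) * (\int[leb2]_(p in A) `|dw true p|).
Proof.
move=> rw [C hC]; have [rw0 rdw _] := rw.
have [_ rds _] := rs.
have ri n := reg1M rw (reginv_reg1 n).
have G n := slice_gagliardo R1_gt0 R1_lt_R2 (ri n).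
pose Y b p := ds b p * w p.
have YC b p : A p -> `|Y b p| <= (4 * R2 ^+ 3 * C) * s p.
  by move=> Ap; rewrite normrM -mulrA ler_pM ?hC// ds_bound.
have limd b : \int[leb2]_(p in A) `|apx n (dw b) (Y b) p| @[n --> \oo] -->
    \int[leb2]_(p in A) `|dw b p|.
  have [_ /(_ setT erefl) [K hK]] := rdw b.
  have rY : reg0A (Y b) by exact: reg0M.
  apply: (bounded_cvg (C := K + 2 * (4 * R2 ^+ 3 * C))) => //.
  - exact: annulus_finite.
  - by move=> n; have [] := reg0A_bdd_measurable (reg0_norm (apx_reg0 n (rdw b) rY)).
  - by have [] := reg0A_bdd_measurable (reg0_norm (rdw b)).
  - move=> n p Ap; rewrite normr_id; apply: apx_bound => //.
      exact: hK.
    exact: YC.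
  - by move=> p Ap; apply: cvg_norm; exact: apx_cvg.
(* With [Y = 0], [apx n w] is the function w under the cutoff, without derivative. *)
have lim2 : \int[leb2]_(p in A) ((apx n w (cst 0) p) ^+ 2) @[n --> \oo] -->
    \int[leb2]_(p in A) (w p ^+ 2).
  have [_ /(_ setT erefl) [K hK]] := rw0.
  have r0 : reg0A (cst 0) by exact: reg0_cst.
  apply: (bounded_cvg (C := (K + 2 * 0) ^+ 2)) => //.
  - exact: annulus_finite.
  - by move=> n; have [] := reg0A_bdd_measurable (reg0X 2 (apx_reg0 n rw0 r0)).
  - by have [] := reg0A_bdd_measurable (reg0X 2 rw0).
  - move=> n p Ap; have K0 : 0 <= K + 2 * 0.
      by have := le_trans (normr_ge0 _) (hK _ Ap I); rewrite mulr0 addr0.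
    rewrite normrX ler_pXn2r ?nnegrE//.
    by apply: apx_bound; rewrite // ?hK// normr0 mul0r.
  - by move=> p Ap; under eq_fun do rewrite expr2; apply: cvgM; exact: apx_cvg.
apply: (ler_cvg_to lim2 (cvgM (limd false) (limd true))).
apply: nearW => n.
have e0 : \int[leb2]_(p in A) (apx n w (cst 0) p) ^+ 2 =
    \int[leb2]_(p in A) ((s p ^+ 2 * (w p * reginv n p)) ^+ 2).
  by apply: Rintegral_ext => p _; rewrite /apx /= mulr0 addr0; congr (_ ^+ 2); ring.
have eb b : \int[leb2]_(p in A) `|apx n (dw b) (Y b) p| =
    \int[leb2]_(p in A) `|2 * s p * ds b p * (w p * reginv n p) + s p ^+ 2 *
    (dw b p * reginv n p + w p * (- (2 * s p * ds b p) * reginv n p ^+ 2))|.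
  by apply: Rintegral_ext => p _; rewrite dcutoff_reginv.
by have := G n; rewrite -e0 -!eb.
Qed.

End SliceLimits.

(** * The cubic integral over a section *)

Section CubicBound.
#[local] Set Implicit Arguments.
#[local] Unset Strict Implicit.
Context {R : realType}.
Local Notation mR := (measurableTypeR R).
Variables R1 R2 : R.
Hypotheses (R1_gt0 : 0 < R1) (R1_lt_R2 : R1 < R2).
Let R2_gt0 : 0 < R2. Proof. exact: lt_trans R1_lt_R2. Qed.

Local Notation A := (annulus R1 R2).
Local Notation s := (annulus_weight R1 R2).
Local Notation reg0A := (reg0 A [set setT]).
Local Notation reg1A := (reg1 dir2 A [set setT]).

Let oA : open A. Proof. exact: annulus_open. Qed.
Let mA : measurable (A : set (mR * mR)). Proof. exact: annulus_measurable. Qed.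

Let iA f : reg0A f -> leb2.-integrable A (EFin \o f).
Proof. exact: reg0A_int. Qed.

Let sigma (p : R * R) := R2 ^+ 2 - rsq p.

Let rrsq : reg1A (@rsq R) (fun b p => 2 * coord2 b p).
Proof. by apply: rsq_reg1 => //; exact: annulus_bd. Qed.

Let sigma_reg1 : reg1A sigma (fun b p => - (2 * coord2 b p)).
Proof.
apply: reg1_eq (reg1B (reg1_cst _ _ _ (R2 ^+ 2)) rrsq) => // p b _.
by rewrite sub0r.
Qed.

Let sigma_bd p : A p -> 0 <= sigma p <= R2 ^+ 2.
Proof.
move=> /andP[]; rewrite -/(rsq p) /sigma => h1 h2.
by have := sqr_ge0 R1; move=> h3; apply/andP; split; lra.
Qed.

(** The solution of 2 c + rho c' = 1, which says that c (x, y) has divergence 1, with c = 0 at rho =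
    R2. *)
Let c (p : R * R) := (1 - R2 ^+ 2 * (rsq p)^-1) / 2.

Let c_reg1 : reg1A c (fun b p => R2 ^+ 2 * coord2 b p * (rsq p)^-1 ^+ 2).
Proof.
have r1 : 0 < R1 ^+ 2 by rewrite exprn_gt0.
have lb p : A p -> R1 ^+ 2 <= rsq p by move=> /andP[/ltW].
apply: reg1_eq (reg1M (reg1B (reg1_cst _ _ _ 1)
  (reg1M (reg1_cst _ _ _ (R2 ^+ 2)) (reg1V r1 lb rrsq))) (reg1_cst _ _ _ 2^-1)) => //.
move=> p b Ap; field; rewrite gt_eqF// (lt_le_trans r1)// lb//.
Qed.

Definition energy2 (f : R * R -> R) (df : bool -> R * R -> R) (p : R * R) : R :=
  f p ^+ 2 + df false p ^+ 2 + df true p ^+ 2.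

Lemma energy2_reg0 f df : reg1A f df -> reg0A (energy2 f df).
Proof.
by move=> [rf rdf _]; apply: reg0D; [apply: reg0D|]; exact: reg0X.
Qed.

(* Gagliardo's inequality for [sigma * f ^+ 2], which vanishes on the whole
   boundary even though f vanishes only on the inner circle. *)
Lemma slice_quartic (f : R * R -> R) (df : bool -> R * R -> R) : reg1A f df ->
  (exists C, forall p, A p -> `|f p| <= C * (rsq p - R1 ^+ 2)) ->
  \int[leb2]_(p in A) ((sigma p * f p ^+ 2) ^+ 2) <=
  (2 * R2 + R2 ^+ 2) ^+ 2 * (\int[leb2]_(p in A) energy2 f df p) ^+ 2.
Proof.
move=> rf [C hC]; have [rf0 rdf _] := rf.
have rh := energy2_reg0 rf.
have rw := reg1M sigma_reg1 (reg1M rf rf).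
have [_ rdw _] := rw.
have [_ /(_ setT erefl) [K hK]] := rf0.
(* [sigma] is the outer factor of [s], and one of the two factors [f] supplies the inner one. *)
have wC : exists C, forall p, A p -> `|sigma p * (f p * f p)| <= C * s p.
  exists (C * K) => p Ap; have /andP[s0 s1] := sigma_bd Ap.
  rewrite !normrM (ger0_norm s0) /annulus_weight -/(sigma p).
  rewrite (_ : C * K * _ = sigma p * ((C * (rsq p - R1 ^+ 2)) * K)); last by ring.
  by rewrite ler_wpM2l// ler_pM// ?hC// hK.
set h := \int[leb2]_(p in A) energy2 f df p; pose K2 := 2 * R2 + R2 ^+ 2.
have K20 : 0 <= K2 by rewrite addr_ge0// ?sqr_ge0// mulr_ge0// ltW.
have := slice_gagliardo_limit R1_gt0 R1_lt_R2 rw wC.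
(* The derivative consists of 2 x_b f^2, up to sign, and 2 sigma f df. The constant comes from |x_b|
   <= R2, sigma <= R2^2 and 2 |f df| <= f^2 + df^2. *)
have P b : 0 <= \int[leb2]_(p in A) `|- (2 * coord2 b p) * (f p * f p) +
    sigma p * (df b p * f p + f p * df b p)| <= K2 * h.
  apply/andP; split; first exact: Rintegral_ge0.
  rewrite /h -RintegralZl; [|by []|exact: iA].
  apply: le_Rintegral => //.
  - by apply: iA => //; apply: reg0_norm; exact: rdw.
  - by apply: iA => //; apply: reg0M => //; exact: reg0_cst.
  move=> p Ap; have /andP[s0 s1] := sigma_bd Ap.
  apply: le_trans (ler_normD _ _) _; rewrite /K2 !normrM normrN.
  have c1 := annulus_coord R1_gt0 R1_lt_R2 b Ap.
  have E : f p ^+ 2 + df b p ^+ 2 <= energy2 f df p.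
    have u := sqr_ge0 (df true p); have w := sqr_ge0 (df false p).
    by rewrite /energy2; case: (b); lra.
  apply: (@le_trans _ _ ((2 * R2 + R2 ^+ 2) * (f p ^+ 2 + df b p ^+ 2))); last first.
    by rewrite ler_wpM2l.
  rewrite [leRHS]mulrDl; apply: lerD.
    rewrite normrM (ger0_norm (ler0n R 2)) -(normrM (f p)) -expr2.
    rewrite (ger0_norm (sqr_ge0 _)).
    apply: ler_pM; rewrite ?sqr_ge0 ?mulr_ge0//; first by rewrite ler_pM2l.
    by rewrite lerDl sqr_ge0.
  rewrite (ger0_norm s0); apply: ler_pM => //.
  rewrite (mulrC (f p)) -mulr2n -mulr_natl normrM (ger0_norm (ler0n R 2)) normrM.
  rewrite -(real_normK (num_real (f p))) -(real_normK (num_real (df b p))).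
  by have := sqr_ge0 (`|f p| - `|df b p|); nra.
have /andP[a1 a2] := P false; have /andP[b1 b2] := P true.
move=> G; apply: (@le_trans _ _ ((K2 * h) * (K2 * h))); last first.
  by rewrite le_eqVlt; apply/orP; left; apply/eqP; rewrite /K2; ring.
by apply: le_trans G _; apply: ler_pM.
Qed.

(* Integrating g f^2 by parts against c * (x, y), a field of divergence 1 that
   vanishes on the outer circle, brings in the weight sigma = R2^2 - rho^2 that
   slice_quartic needs. *)
Lemma slice_cubic : exists2 K, 0 <= K &
  forall (f g : R * R -> R) (df dg : bool -> R * R -> R), reg1A f df -> reg1A g dg ->
  (exists C, forall p, A p -> `|f p| <= C * (rsq p - R1 ^+ 2)) ->
  (exists C, forall p, A p -> `|g p| <= C * (rsq p - R1 ^+ 2)) ->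
  forall h, \int[leb2]_(p in A) energy2 f df p <= h ->
    \int[leb2]_(p in A) energy2 g dg p <= h ->
  `|\int[leb2]_(p in A) (g p * f p ^+ 2)| <= K * (h + h ^+ 2).
Proof.
(* [K1] combines |c| <= sigma / (2 R1^2) with the bound [R2] on the coordinates; [K2] is the
   constant of [slice_quartic]. *)
pose K1 := R2 / R1 ^+ 2; pose K2 := 2 * R2 + R2 ^+ 2.
have R10 : 0 < R1 ^+ 2 by rewrite exprn_gt0.
have K10 : 0 <= K1 by rewrite divr_ge0// ltW.
have K20 : 0 <= K2 by rewrite addr_ge0// ?sqr_ge0// mulr_ge0// ltW.
exists (K1 * (2 + 2 * K2 ^+ 2)); first by rewrite mulr_ge0// addr_ge0// mulr_ge0// sqr_ge0.
move=> f g df dg rf rg hf hg h hh1 hh2.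
have [rf0 rdf _] := rf; have [rg0 rdg _] := rg.
have rP := reg1M rg (reg1M rf rf).
pose P p := g p * (f p * f p).
pose dP b p := dg b p * (f p * f p) + g p * (df b p * f p + f p * df b p).
have rx b := coord2_reg1 (annulus_bd R1_gt0 R1_lt_R2 b).
have rF b := reg1M (rx b) (reg1M c_reg1 rP).
have [rc0 rdc _] := c_reg1; have [rP0 rdP _] := rP.
have div0 := slice_div R1_gt0 R1_lt_R2 (rF false) (rF true).
have {div0} : \int[leb2]_(p in A) (P p + c p * (p.1 * dP false p + p.2 * dP true p)) = 0.
  rewrite -[RHS]div0; last first.
    have [Cg hCg] := hg; have [_ /(_ setT erefl) [K hK]] := rf0.
    exists (Cg * (K * K)) => p Ap /=; have /andP[s0 s1] := sigma_bd Ap.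
    have rp : 0 < rsq p by move: Ap => /andP[h1 _]; exact: lt_trans h1.
    (* The radial component of c P (x, y): [sigma] vanishes on the outer circle, and the factor [g]
       of [P] on the inner one. *)
    rewrite (_ : _ + _ = - (sigma p / 2) * P p); last first.
      by rewrite /P /c /sigma /rsq; field; move: rp; rewrite /rsq => /gt_eqF ->.
    have s3 : 0 <= sigma p / 2 by exact: divr_ge0.
    rewrite /P !normrM normrN (ger0_norm s3) /annulus_weight -/(sigma p).
    rewrite [leRHS](_ : _ = sigma p * ((Cg * (rsq p - R1 ^+ 2)) * (K * K))); last by ring.
    have s2 : sigma p / 2 <= sigma p by rewrite ler_pdivrMr// ler_peMr// ler1n.
    apply: (ler_pM _ _ s2); first exact: divr_ge0.
      by rewrite !mulr_ge0.
    apply: ler_pM; rewrite ?mulr_ge0//; first exact: hCg.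
    by apply: ler_pM => //; exact: hK.
  apply: Rintegral_ext => p Ap /=.
  have rp : 0 < rsq p by move: Ap => /andP[h1 _]; exact: lt_trans h1.
  rewrite /P /dP /c /rsq /coord2 /=.
  by field; move: rp; rewrite /rsq => /gt_eqF ->.
have rD : reg0A (fun p => c p * (p.1 * dP false p + p.2 * dP true p)).
  have [rx0 _ _] := rx false; have [rx1 _ _] := rx true.
  apply: reg0M => //; apply: reg0D; apply: reg0M.
  - exact: rx0.
  - exact: (rdP false).
  - exact: rx1.
  - exact: (rdP true).
rewrite RintegralD //; [|exact: iA|exact: iA].
set I1 := \int[leb2]_(p in A) P p.
set I2 := \int[leb2]_(p in A) (c p * _) => /eqP.
rewrite addr_eq0 => /eqP I12.
rewrite I12 normrN /I2.
have q1 := slice_quartic rf hf; have q2 := slice_quartic rg hg.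
have rq (u : R * R -> R) : reg0A u -> reg0A (fun p => (sigma p * u p ^+ 2) ^+ 2).
  move=> ru; have [rs0 _ _] := sigma_reg1.
  by apply: reg0X; apply: reg0M => //; exact: reg0X.
have ie u du : reg1A u du -> leb2.-integrable A (EFin \o energy2 u du).
  by move=> ru; apply: iA => //; exact: energy2_reg0.
have h0 u du : 0 <= \int[leb2]_(p in A) energy2 u du p.
  by apply: Rintegral_ge0 => p _; rewrite !addr_ge0 ?sqr_ge0.
apply: le_trans (le_normr_Rintegral _ _) _ => //; first exact: iA.
apply: (@le_trans _ _ (\int[leb2]_(p in A) (K1 * ((sigma p * f p ^+ 2) ^+ 2 +
   (sigma p * g p ^+ 2) ^+ 2 + (energy2 f df p + energy2 g dg p))))).
  apply: le_Rintegral => //.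
  - by apply: iA => //; exact: reg0_norm.
  - apply: iA => //; apply: reg0M; first exact: reg0_cst.
    by apply: reg0D; apply: reg0D; try exact: rq; exact: energy2_reg0.
  move=> p Ap; have /andP[s0 s1] := sigma_bd Ap.
  have rp : R1 ^+ 2 < rsq p by move: Ap => /andP[h1 _].
  have cE : `|c p| <= sigma p / (2 * R1 ^+ 2).
    rewrite (_ : c p = - (sigma p / (2 * rsq p))); last first.
      by rewrite /c /sigma; field; rewrite gt_eqF// (lt_trans R10).
    rewrite normrN ger0_norm; last by rewrite divr_ge0// mulr_ge0// ltW// (lt_trans R10).
    rewrite ler_wpM2l// lef_pV2 ?posrE ?mulr_gt0// ?(lt_trans R10)//.
    by rewrite ler_pM2l// ltW.
  have c0 := annulus_coord R1_gt0 R1_lt_R2 false Ap.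
  have c1 := annulus_coord R1_gt0 R1_lt_R2 true Ap.
  rewrite normrM.
  apply: (@le_trans _ _ (sigma p / (2 * R1 ^+ 2) *
      (R2 * `|dP false p| + R2 * `|dP true p|))).
    apply: ler_pM => //; apply: le_trans (ler_normD _ _) _.
    by rewrite !normrM lerD// ler_wpM2r.
  (* With a = sigma f^2 and z = sigma g^2, the product y = sigma g f satisfies y^2 = a z. Young's
     inequality then leaves a^2 and z^2, which [slice_quartic] controls, and squares of
     derivatives. *)
  have Q b : sigma p * `|dP b p| <= 2^-1 * ((sigma p * f p ^+ 2) ^+ 2 + dg b p ^+ 2) +
      2^-1 * ((sigma p * f p ^+ 2) ^+ 2 + (sigma p * g p ^+ 2) ^+ 2) + df b p ^+ 2.
    rewrite -{1}(ger0_norm s0) -normrM.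
    rewrite (_ : sigma p * dP b p = (sigma p * f p ^+ 2) * dg b p +
      2 * (sigma p * g p * f p) * df b p); last by rewrite /dP; ring.
    set a := sigma p * f p ^+ 2; set d := dg b p; set e := df b p.
    set y := sigma p * g p * f p; set z := sigma p * g p ^+ 2.
    have yaz : y ^+ 2 = a * z by rewrite /y /a /z; ring.
    rewrite ler_norml; apply/andP; split.
      by have := sqr_ge0 (a + d); have := sqr_ge0 (y + e);
        have := sqr_ge0 (a - z); nra.
    by have := sqr_ge0 (a - d); have := sqr_ge0 (y - e);
      have := sqr_ge0 (a - z); nra.
  rewrite (_ : _ * _ =
    K1 * (2^-1 * (sigma p * `|dP false p| + sigma p * `|dP true p|))); last first.
    by rewrite /K1; field; rewrite gt_eqF.
  rewrite ler_wpM2l//; have := Q false; have := Q true; rewrite /energy2.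
  have := sqr_ge0 (f p); have := sqr_ge0 (g p).
  have := sqr_ge0 (df true p); have := sqr_ge0 (dg true p).
  have := sqr_ge0 (df false p); have := sqr_ge0 (dg false p).
  have := sqr_ge0 (sigma p * f p ^+ 2); have := sqr_ge0 (sigma p * g p ^+ 2).
  lra.
rewrite RintegralZl//; last first.
  apply: iA => //.
  by apply: reg0D; apply: reg0D; try exact: rq; exact: energy2_reg0.
rewrite -[leRHS]mulrA ler_wpM2l// RintegralD//; last 2 first.
- by apply: iA => //; apply: reg0D; exact: rq.
- by apply: iA => //; apply: reg0D; exact: energy2_reg0.
rewrite (RintegralD mA (iA (rq _ rf0)) (iA (rq _ rg0))).
rewrite (RintegralD mA (ie _ _ rf) (ie _ _ rg)).
have e1 := h0 f df; have e2 := h0 g dg.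
have hh : 0 <= h by exact: le_trans hh1.
have sq u : 0 <= u <= h -> K2 ^+ 2 * u ^+ 2 <= K2 ^+ 2 * h ^+ 2.
  by move=> /andP[u0 uh]; rewrite ler_wpM2l ?sqr_ge0// ler_pXn2r ?nnegrE.
have t1 := le_trans q1 (sq _ (introT andP (conj e1 hh1))).
have t2 := le_trans q2 (sq _ (introT andP (conj e2 hh2))).
have := sqr_ge0 h; have : 0 <= K2 ^+ 2 * h by rewrite mulr_ge0 ?sqr_ge0.
by move: t1 t2; rewrite -/K2; nra.
Qed.

End CubicBound.

(** * Symmetry of second derivatives *)

Section Schwarz.
Context {R : realType} {V : normedModType R}.

Lemma line_derive (f fv : V -> R) (v x : V) (s : R) :
  is_derive (s *: v + x) v f (fv (s *: v + x)) ->
  is_derive s 1 (fun t : R => f (t *: v + x)) (fv (s *: v + x)).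
Proof.
apply: is_derive_transfer => h.
by rewrite [h *: 1]mulr1 scalerDl addrA.
Qed.

Lemma derive_segment_continuous (g dg : R -> R) (a b : R) :
  (forall t : R, a <= t <= b -> is_derive t 1 g (dg t)) ->
  {within `[a, b], continuous g}.
Proof.
move=> D; apply: continuous_in_subspaceT => x /set_mem /=; rewrite in_itv/= => xab.
by apply/differentiable_continuous/derivable1_diffP; case: (D x xab).
Qed.

(** The mean value theorem in the direction [v], applied to the increment in the direction [w], and
    then once more in the direction [w]. *)
Lemma mixed_difference (f fv fvw : V -> R) (v w x : V) (h : R) : 0 < h ->
  (forall s t, 0 <= s <= h -> 0 <= t <= h ->
    is_derive (s *: v + (t *: w + x)) v f (fv (s *: v + (t *: w + x)))) ->
  (forall s t, 0 <= s <= h -> 0 <= t <= h ->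
    is_derive (t *: w + (s *: v + x)) w fv (fvw (t *: w + (s *: v + x)))) ->
  exists s t, [/\ 0 <= s <= h, 0 <= t <= h &
    f (h *: v + (h *: w + x)) - f (h *: v + x) - f (h *: w + x) + f x =
    fvw (t *: w + (s *: v + x)) * (h * h)].
Proof.
move=> h0 Df Dfv.
pose g s := f (s *: v + (h *: w + x)) - f (s *: v + x).
pose dg s := fv (s *: v + (h *: w + x)) - fv (s *: v + x).
have Dg s : 0 <= s <= h -> is_derive s 1 g (dg s).
  move=> sh; apply: is_deriveB; apply: line_derive.
    by apply: Df => //; rewrite lexx ltW.
  by have := Df s 0 sh; rewrite scale0r add0r lexx (ltW h0); exact.
have Dg' s : s \in `]0, h[%R -> is_derive s 1 g (dg s).
  by rewrite in_itv/= => /andP[a b]; apply: Dg; rewrite !ltW.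
have [s sh E1] := MVT h0 Dg' (derive_segment_continuous g dg 0 h Dg).
have {}sh : 0 <= s <= h by move: sh; rewrite in_itv/= => /andP[a b]; rewrite !ltW.
have Dk t : 0 <= t <= h -> is_derive t 1 (fun t : R => fv (t *: w + (s *: v + x)))
    (fvw (t *: w + (s *: v + x))).
  by move=> th; apply: line_derive; exact: Dfv.
have Dk' t : t \in `]0, h[%R -> is_derive t 1 (fun t : R => fv (t *: w + (s *: v + x)))
    (fvw (t *: w + (s *: v + x))).
  by rewrite in_itv/= => /andP[a b]; apply: Dk; rewrite !ltW.
have [t th E2] := MVT h0 Dk' (derive_segment_continuous _ _ 0 h Dk).
have {}th : 0 <= t <= h by move: th; rewrite in_itv/= => /andP[a b]; rewrite !ltW.
exists s, t; split => //.
have {}E2 : fv (h *: w + (s *: v + x)) - fv (s *: v + x) =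
    fvw (t *: w + (s *: v + x)) * h by move: E2; rewrite scale0r add0r subr0.
have {}E1 : f (h *: v + (h *: w + x)) - f (h *: v + x) - (f (h *: w + x) - f x) =
    (fv (h *: w + (s *: v + x)) - fv (s *: v + x)) * h.
  by move: E1; rewrite /g /dg scale0r !add0r subr0 (addrCA (s *: v)).
by rewrite mulrA -E2 -E1; ring.
Qed.

(** The second difference over a small parallelogram is h^2 times either mixed derivative at some
    point of it, and both are continuous at [x]. This serves to turn the Laplacian into a curl of a
    curl. *)
Lemma schwarz (O : set V) (f fv fw fvw fwv : V -> R) (v w x : V) : open O -> O x ->
  (forall y, O y -> is_derive y v f (fv y)) ->
  (forall y, O y -> is_derive y w f (fw y)) ->
  (forall y, O y -> is_derive y w fv (fvw y)) ->
  (forall y, O y -> is_derive y v fw (fwv y)) ->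
  {for x, continuous fvw} -> {for x, continuous fwv} -> fvw x = fwv x.
Proof.
move=> oO Ox D1 D2 D3 D4 c1 c2; apply/eqP; rewrite -subr_eq0 -normr_le0.
apply/ler_addgt0Pl => e e0; rewrite addr0.
have e2 : 0 < e / 2 by rewrite divr_gt0.
have N : \forall y \near x, [/\ O y, `|fvw x - fvw y| < e / 2 &
    `|fwv x - fwv y| < e / 2].
  near=> y; split; near: y.
  - by move: oO; rewrite openE; exact.
  - by move/cvgrPdist_lt : c1; apply.
  - by move/cvgrPdist_lt : c2; apply.
have L : (p.1 *: v + (p.2 *: w + x)) @[p --> ((0 : R), (0 : R))] --> x.
  rewrite -[X in _ --> X]add0r -(scale0r v) -[X in _ *: v + X]add0r -(scale0r w).
  apply: cvgD; first by apply: cvgZr_tmp; exact: cvg_fst.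
  by apply: cvgD; [apply: cvgZr_tmp; exact: cvg_snd|exact: cvg_cst].
have /nbhs_ballP[d /= d0 dN] := L _ N.
have {}dN s t : 0 <= s <= d / 2 -> 0 <= t <= d / 2 ->
    [/\ O (s *: v + (t *: w + x)), `|fvw x - fvw (s *: v + (t *: w + x))| < e / 2 &
    `|fwv x - fwv (s *: v + (t *: w + x))| < e / 2].
  move=> /andP[s0 sd] /andP[t0 td]; apply: (dN (s, t)).
  by split; rewrite /ball/= sub0r normrN ger0_norm//; lra.
have d2 : 0 < d / 2 by rewrite divr_gt0.
have [|s t|s [t [sh th E1]]] := mixed_difference f fv fvw v w x (d / 2) d2.
- by move=> s t sd td; apply: D1; have [] := dN s t sd td.
- by move=> sd td; apply: D3; rewrite addrCA; have [] := dN s t sd td.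
have [|s' t'|s' [t' [sh' th' E2]]] := mixed_difference f fw fwv w v x (d / 2) d2.
- by move=> s' t' sd td; apply: D2; rewrite addrCA; have [] := dN t' s' td sd.
- by move=> sd td; apply: D4; have [] := dN t' s' td sd.
have E : fvw (t *: w + (s *: v + x)) = fwv (t' *: v + (s' *: w + x)).
  have dd : d / 2 * (d / 2) != 0 by rewrite gt_eqF// mulr_gt0.
  apply: (mulIf dd); rewrite -E1 -E2 (addrCA (d / 2 *: w)); ring.
have [_ + _] := dN s t sh th; rewrite addrCA E => n1.
have [_ _ n2] := dN t' s' th' sh'.
rewrite (_ : fvw x - fwv x = (fvw x - fwv (t' *: v + (s' *: w + x))) -
  (fwv x - fwv (t' *: v + (s' *: w + x)))); last by ring.
by rewrite (le_trans (ler_normB _ _))//; lra.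
Unshelve. all: by end_near. Qed.

End Schwarz.

(** * Geometry of the domain and of its closure *)

Section OmegaGeometry.
#[local] Set Implicit Arguments.
#[local] Unset Strict Implicit.
Context {R : realType}.
Local Notation mR := (measurableTypeR R).
Variables R1 R2 : R.
Local Notation D := (Omega R1 R2).
Local Notation A := (annulus R1 R2).

Definition slabs : set (set (pt R)) :=
  [set B | exists N : R, B = [set x : pt R | `|x.2| <= N]].

Lemma fst_continuous (U V : topologicalType) : continuous (@fst U V).
Proof. by move=> p; exact: cvg_fst. Qed.

Lemma snd_continuous (U V : topologicalType) : continuous (@snd U V).
Proof. by move=> p; exact: cvg_snd. Qed.

Lemma rsq3_continuous : continuous (fun x : pt R => rsq x.1).
Proof.
move=> x; apply: (continuous_comp (g := @rsq R)); first exact: fst_continuous.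
exact: rsq_continuous.
Qed.

Lemma Omega_open : open D.
Proof.
by apply: (open_comp (f := fst) (D := A)); [move=> x _; exact: fst_continuous|exact: annulus_open].
Qed.

Lemma Omega_measurable : measurable (D : set (mR * mR * mR)).
Proof. exact: open_measurable3 Omega_open. Qed.

Hypotheses (R1_gt0 : 0 < R1) (R1_lt_R2 : R1 < R2).
Let R2_gt0 : 0 < R2. Proof. exact: lt_trans R1_lt_R2. Qed.
Let R12 : R1 ^+ 2 < R2 ^+ 2.
Proof. by rewrite ltr_pXn2r// nnegrE ltW. Qed.

Definition cOmega : set (pt R) := [set x | R1 ^+ 2 <= rsq x.1 <= R2 ^+ 2].

Lemma cOmega_closed : closed cOmega.
Proof.
have -> : cOmega = (fun x : pt R => rsq x.1) @^-1` `[R1 ^+ 2, R2 ^+ 2].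
  by apply/seteqP; split => x /=; rewrite in_itv.
by apply: closed_comp; [move=> x _; exact: rsq3_continuous|exact: itv_closed].
Qed.

Lemma Omega_sub : D `<=` cOmega.
Proof. by move=> x /andP[/ltW a /ltW b]; apply/andP. Qed.

Lemma closure_Omega : closure D = cOmega.
Proof.
apply/seteqP; split.
  have := closure_subset Omega_sub.
  by have /closure_id <- := cOmega_closed.
move=> x /andP[x1 x2] B Bx; pose r := Num.sqrt (rsq x.1).
have q0 : 0 < rsq x.1 by rewrite (lt_le_trans _ x1)// exprn_gt0.
have r0 : 0 < r by rewrite sqrtr_gt0.
have r2 : r ^+ 2 = rsq x.1 by rewrite sqr_sqrtr// ltW.
have r1 : R1 <= r by rewrite -(@ler_pXn2r _ 2) ?nnegrE ?(ltW R1_gt0) ?(ltW R2_gt0) ?(ltW r0)// r2.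
have r3 : r <= R2 by rewrite -(@ler_pXn2r _ 2) ?nnegrE ?(ltW R1_gt0) ?(ltW R2_gt0) ?(ltW r0)// r2.
(* [y t] moves [x] along its radius towards the circle of radius [m]; for 0 < t < 1 it lies in the
   open domain, even when [x] is on the boundary. *)
pose m := (R1 + R2) / 2.
pose lam (t : R) := 1 + t * (m / r - 1).
pose y (t : R) : pt R := ((lam t * x.1.1, lam t * x.1.2), x.2).
have cl : continuous lam.
  move=> t; apply: cvgD; first exact: cvg_cst.
  by apply: cvgM; [exact: cvg_id|exact: cvg_cst].
have cy : {for 0, continuous y}.
  apply: pair_continuous; last exact: cvg_cst.
  by apply: pair_continuous; apply: cvgM => //; try exact: cl; exact: cvg_cst.
have y0 : y 0 = x.
  by rewrite /y /lam mul0r addr0 !mul1r -!surjective_pairing.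
have BB : \forall t \near (0 : R)^'+, B (y t).
  by have := cvg_at_right_filter cy; rewrite y0; apply.
near ((0 : R)^'+) => t.
exists (y t); split; last by near: t.
have t0 : 0 < t by near: t; exact: nbhs_right_gt.
have t1 : t < 1 by near: t; exact: nbhs_right_lt.
have E : (lam t * x.1.1) ^+ 2 + (lam t * x.1.2) ^+ 2 = (r + t * (m - r)) ^+ 2.
  transitivity (lam t ^+ 2 * rsq x.1); first by rewrite /rsq; ring.
  by rewrite -r2 /lam; field; rewrite gt_eqF.
have h1 := R1_gt0; have h2 := R1_lt_R2.
have a1 : R1 < r + t * (m - r) by rewrite /m; nra.
have a2 : r + t * (m - r) < R2 by rewrite /m; nra.
rewrite /Omega/= E; apply/andP; split.
  by rewrite ltr_pXn2r ?nnegrE//; lra.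
by rewrite ltr_pXn2r ?nnegrE//; lra.
Unshelve. all: by end_near. Qed.

Lemma Gamma_closure r x : r = R1 \/ r = R2 -> Gamma r x -> closure D x.
Proof.
rewrite closure_Omega /cOmega /Gamma /= -/(rsq x.1) => h ->.
by case: h => ->; rewrite lexx ltW.
Qed.

Lemma cOmega_compact N : compact (cOmega `&` [set x : pt R | `|x.2| <= N]).
Proof.
apply: (@subclosed_compact _ _ ((`[- R2, R2] `*` `[- R2, R2]) `*` `[- N, N])).
- apply: closedI; first exact: cOmega_closed.
  have -> : [set x : pt R | `|x.2| <= N] = snd @^-1` `[- N, N].
    by apply/seteqP; split => x /=; rewrite in_itv/= -ler_norml.
  by apply: closed_comp; [move=> x _; exact: snd_continuous|exact: itv_closed].
- by apply: compact_setX; [apply: compact_setX|]; exact: segment_compact.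
- move=> [[a b] c] [/andP[_ h] /= cN].
  have aux u w : u ^+ 2 + w ^+ 2 <= R2 ^+ 2 -> `|u| <= R2.
    move=> uw; rewrite -(@ler_pXn2r _ 2) ?nnegrE ?(ltW R2_gt0)// real_normK ?num_real//.
    by have := sqr_ge0 w; lra.
  split; last by rewrite /= in_itv/= -ler_norml.
  by split; rewrite /= in_itv/= -ler_norml; [exact: (aux a b)|apply: (aux b a); rewrite addrC].
Qed.

(** Boundedness on a slab holds because its intersection with the closed domain is compact. *)
Lemma within_closure_reg0 (f : pt R -> R) :
  {within closure D, continuous f} -> reg0 D slabs f.
Proof.
move=> cf; split.
  have oD := Omega_open.
  have : {within D, continuous f}.
    by apply: continuous_subspaceW cf; exact: subset_closure.
  by rewrite (continuous_open_subspace f oD) => h x Dx; apply: h; rewrite inE.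
move=> B [N ->]; have K := @cOmega_compact N.
have cK : {within cOmega `&` [set x : pt R | `|x.2| <= N], continuous f}.
  by apply: continuous_subspaceW cf; rewrite closure_Omega; exact: subIsetl.
have [M [_ hM]] := compact_bounded (continuous_compact cK K).
exists (M + 1) => x Dx xN; apply: (hM (M + 1)); first lra.
by exists x => //; split => //; exact: Omega_sub.
Qed.

End OmegaGeometry.

(** * Restriction to sections and estimates near the boundary *)

Section Slices.
#[local] Set Implicit Arguments.
#[local] Unset Strict Implicit.
Context {R : realType}.
Local Notation mR := (measurableTypeR R).
Variables R1 R2 : R.
Local Notation D := (Omega R1 R2).
Local Notation A := (annulus R1 R2).
Local Notation reg0D := (reg0 D (@slabs R)).
Local Notation reg1D := (reg1 evec D (@slabs R)).

Lemma slice_reg0 f z : reg0D f -> reg0 A [set setT] (fun p => f (p, z)).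
Proof.
move=> [cf bf]; split=> [p Ap|B ->].
  apply: (@continuous_comp _ _ _ (fun p => (p, z)) f).
    by apply: pair_continuous; [exact: cvg_id|exact: cvg_cst].
  exact: cf.
have [|C hC] := bf [set x | `|x.2| <= `|z|]; first by exists `|z|.
by exists C => p Ap _; exact: (hC (p, z) Ap (lexx _)).
Qed.

Definition idx2 (b : bool) : 'I_3 := if b then 1 else 0.

Lemma slice_reg1 f df z : reg1D f df ->
  reg1 dir2 A [set setT] (fun p => f (p, z)) (fun b p => df (idx2 b) (p, z)).
Proof.
move=> [rf rdf Df]; split; first exact: slice_reg0.
  by move=> b; exact: slice_reg0.
move=> p b Ap; have := Df (p, z) (idx2 b) Ap.
apply: is_derive_transfer => h; congr f.
by case: b; case: p Ap => x y _; congr (_, _, _); rewrite /= ?scaler0 ?add0r.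
Qed.

Lemma lipschitz_segment (g dg : R -> R) (a b L : R) : a <= b ->
  {within `[a, b], continuous g} ->
  (forall t : R, a < t < b -> is_derive t 1 g (dg t)) ->
  (forall t, a < t < b -> `|dg t| <= L) -> `|g b - g a| <= L * (b - a).
Proof.
rewrite le_eqVlt => /orP[/eqP -> _ _ _|ab cg Dg hL]; first by rewrite !subrr normr0 mulr0.
have Dg' t : t \in `]a, b[%R -> is_derive t 1 g (dg t).
  by rewrite in_itv/=; exact: Dg.
have [t tab ->] := MVT ab Dg' cg.
have ba : 0 <= b - a by rewrite subr_ge0 ltW.
by rewrite normrM (ger0_norm ba) ler_wpM2r// hL//; move: tab; rewrite in_itv.
Qed.

Hypotheses (R1_gt0 : 0 < R1) (R1_lt_R2 : R1 < R2).
Let R2_gt0 : 0 < R2. Proof. exact: lt_trans R1_lt_R2. Qed.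
Let R12 : R1 ^+ 2 < R2 ^+ 2.
Proof. by rewrite ltr_pXn2r// nnegrE ltW. Qed.

Definition line2 (b : bool) (w t : R) : R * R := if b then (w, t) else (t, w).

Lemma rsq_line2 b w t : rsq (line2 b w t) = t ^+ 2 + w ^+ 2.
Proof. by case: b; rewrite /rsq/= 1?addrC. Qed.

Lemma line2_continuous b w z : continuous (fun t => (line2 b w t, z) : pt R).
Proof.
move=> t; apply: pair_continuous; last exact: cvg_cst.
by case: b; apply: pair_continuous; try exact: cvg_id; exact: cvg_cst.
Qed.

(* Only the coordinate directions are available, so that the boundary is
   reached from (t, w) along a coordinate line with |t| >= |w|. *)
Lemma boundary_line (f : pt R -> R) df z rho L b w u :
  {within closure D, continuous f} -> reg1D f df ->
  (rho = R1 \/ rho = R2) -> (forall x, Gamma rho x -> f x = 0) ->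
  (forall p, A p -> `|df (idx2 b) (p, z)| <= L) ->
  A (line2 b w u) -> w ^+ 2 <= rho ^+ 2 -> u != 0 ->
  `|f (line2 b w u, z)| <= L * (`|u ^+ 2 + w ^+ 2 - rho ^+ 2| / `|u|).
Proof.
move=> cf [_ _ Df] hrho f0 hL Au wrho u0.
have h1 := R1_gt0; have h2 := R1_lt_R2; have h3 := R12.
(* [t0] is where the line meets the circle of radius [rho] on the side of [u]; the factor [sg] makes
   the parameter nonnegative. *)
pose sg := Num.sg u; pose t0 := Num.sqrt (rho ^+ 2 - w ^+ 2).
have sg1 : sg ^+ 2 = 1 by rewrite /sg sqr_sg u0.
have sgn : `|sg| = 1 by rewrite normr_sg u0.
have us : u = sg * `|u| by rewrite -numEsg.
have t02 : t0 ^+ 2 = rho ^+ 2 - w ^+ 2 by rewrite sqr_sqrtr// subr_ge0.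
have t00 : 0 <= t0 by exact: sqrtr_ge0.
have ua : 0 < `|u| by rewrite normr_gt0.
have u2 : `|u| ^+ 2 = u ^+ 2 by rewrite real_normK// num_real.
have /andP[A1 A2] : R1 ^+ 2 < u ^+ 2 + w ^+ 2 < R2 ^+ 2.
  by rewrite -(rsq_line2 b).
have rho1 : R1 ^+ 2 <= rho ^+ 2 <= R2 ^+ 2.
  by case: hrho => ->; rewrite lexx ltW.
have /andP[ra rb] := rho1.
pose g t := f (line2 b w (sg * t), z).
pose dg t := df (idx2 b) (line2 b w (sg * t), z) * sg.
have rl t : rsq (line2 b w (sg * t)) = t ^+ 2 + w ^+ 2.
  by rewrite rsq_line2 exprMn sg1 mul1r.
have gu : g `|u| = f (line2 b w u, z) by rewrite /g -us.
have gt0 : g t0 = 0.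
  by apply: f0; rewrite /Gamma/= -/(rsq _) rl t02 subrK.
pose lo := Num.min `|u| t0; pose hi := Num.max `|u| t0.
have lohi : lo <= hi by rewrite /lo /hi; case: (leP `|u| t0) => // /ltW.
have lo0 : 0 <= lo by rewrite le_min ltW.
have inA t : lo < t < hi -> A (line2 b w (sg * t)).
  move=> /andP[l1 l2]; rewrite /annulus/= -/(rsq _) rl.
  have tpos : 0 < t by exact: le_lt_trans l1.
  have B1 : lo ^+ 2 < t ^+ 2 by rewrite ltr_pXn2r ?nnegrE// ltW.
  have B2 : t ^+ 2 < hi ^+ 2 by rewrite ltr_pXn2r ?nnegrE ?(ltW tpos)// (le_trans lo0).
  by move: B1 B2; rewrite /lo /hi; case: (leP `|u| t0) => _;
    rewrite u2 t02 => B1 B2; apply/andP; split; lra.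
have inC t : lo <= t <= hi -> closure D (line2 b w (sg * t), z).
  move=> /andP[l1 l2]; rewrite closure_Omega// /cOmega/= rl.
  have tpos : 0 <= t by exact: le_trans l1.
  have B1 : lo ^+ 2 <= t ^+ 2 by rewrite ler_pXn2r ?nnegrE.
  have B2 : t ^+ 2 <= hi ^+ 2 by rewrite ler_pXn2r ?nnegrE// (le_trans lo0).
  by move: B1 B2; rewrite /lo /hi; case: (leP `|u| t0) => _;
    rewrite u2 t02 => B1 B2; apply/andP; split; lra.
have cg : {within `[lo, hi], continuous g}.
  apply/subspace_continuousP => t tlh.
  have cl : {for t, continuous (fun t => (line2 b w (sg * t), z) : pt R)}.
    apply: (@continuous_comp _ _ _ (fun t => sg * t) (fun t => (line2 b w t, z))).
      by apply: cvgM; [exact: cvg_cst|exact: cvg_id].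
    exact: line2_continuous.
  have inC' s : `[lo, hi]%classic s -> closure D (line2 b w (sg * s), z).
    by rewrite /= in_itv/=; exact: inC.
  have := (iffLR (subspace_continuousP _ _)) cf _ (inC' _ tlh).
  apply: cvg_trans => P /= hP.
  have hP2 : \forall r \near t, closure D (line2 b w (sg * r), z) ->
      P (f (line2 b w (sg * r), z)) by exact: (cl _ hP).
  change (\forall r \near t, `[lo, hi]%classic r -> P (g r)).
  by apply: filterS hP2 => r hr rlh; exact: hr (inC' _ rlh).
have Dg (t : R) : lo < t < hi -> is_derive t 1 g (dg t).
  move=> tlh; pose k r := f (line2 b w r, z).
  have Dk : is_derive (sg * t) 1 k (df (idx2 b) (line2 b w (sg * t), z)).
    have := Df (line2 b w (sg * t), z) (idx2 b) (inA _ tlh).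
    apply: is_derive_transfer => h; rewrite /k; congr f.
    by rewrite /line2; case: (b); congr (_, _, _); rewrite /= ?scaler0 ?add0r.
  have Ds : is_derive t 1 (fun r : R => sg * r) sg.
    have h := @is_deriveZ R R R id sg t 1 1 (is_derive_id _ _).
    by apply: is_derive_eq h _; rewrite [_ *: _]mulr1.
  exact: (@is_derive1_comp R k (fun r => sg * r) t _ _ Dk Ds).
have dgL t : lo < t < hi -> `|dg t| <= L.
  by move=> tlh; rewrite /dg normrM sgn mulr1; apply: hL; exact: inA.
have G := lipschitz_segment lohi cg Dg dgL.
have L0 : 0 <= L by exact: le_trans (normr_ge0 _) (hL _ Au).
have gE : `|f (line2 b w u, z)| = `|g hi - g lo|.
  by rewrite -gu /hi /lo; case: (leP `|u| t0) => _; rewrite gt0 ?subr0 ?sub0r ?normrN.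
rewrite gE; apply: le_trans G _; rewrite ler_wpM2l// ler_pdivlMr//.
(* The length of the segment is |u^2 - t0^2| / (|u| + t0), at most |u^2 - t0^2| / |u|. *)
rewrite (_ : u ^+ 2 + w ^+ 2 - rho ^+ 2 = `|u| ^+ 2 - t0 ^+ 2); last first.
  by rewrite u2 t02; ring.
have up : 0 <= `|u| + t0 by rewrite addr_ge0.
rewrite subr_sqr normrM (ger0_norm up).
rewrite (_ : hi - lo = `| `|u| - t0 |); last first.
  rewrite /hi /lo; case: (leP `|u| t0) => h.
    have h' : `|u| - t0 <= 0 by rewrite subr_le0.
    by rewrite (ler0_norm h') opprB.
  have h' : 0 < `|u| - t0 by rewrite subr_gt0.
  by rewrite (gtr0_norm h').
by rewrite ler_wpM2l// lerDl.
Qed.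

(** The moving coordinate u is the larger one, so |u| > R1 / 2 and the division in [boundary_line]
    is harmless. If the other coordinate exceeds [rho], the line misses the circle, but then rsq -
    rho^2 is at least R1^2 and a bound on [f] is enough. *)
Lemma boundary_estimate (f : pt R -> R) df z rho :
  {within closure D, continuous f} -> reg1D f df ->
  (rho = R1 \/ rho = R2) -> (forall x, Gamma rho x -> f x = 0) ->
  exists C, forall p, A p -> `|f (p, z)| <= C * `|rsq p - rho ^+ 2|.
Proof.
move=> cf rf hrho f0; have [rf0 rdf _] := rf.
have [_ /(_ setT erefl) [K hK]] := slice_reg0 z rf0.
have [_ /(_ setT erefl) [L0 hL0]] := slice_reg0 z (rdf (idx2 false)).
have [_ /(_ setT erefl) [L1 hL1]] := slice_reg0 z (rdf (idx2 true)).
pose L := Num.max L0 L1.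
have hL b p : A p -> `|df (idx2 b) (p, z)| <= L.
  by move=> Ap; case: b; rewrite le_max ?hL0 ?hL1// orbT.
have R10 : 0 < R1 ^+ 2 by rewrite exprn_gt0.
have rho1 : R1 ^+ 2 <= rho ^+ 2 by case: hrho => ->//; exact: ltW.
exists (L * (2 / R1) + K / R1 ^+ 2) => p Ap.
have LL : 0 <= L by exact: le_trans (normr_ge0 _) (hL true _ Ap).
have K0 : 0 <= K by exact: le_trans (normr_ge0 _) (hK _ Ap I).
have [b [w [u [pE uw]]]] : exists b w u, p = line2 b w u /\ w ^+ 2 <= u ^+ 2.
  case: (leP (p.1 ^+ 2) (p.2 ^+ 2)) => h.
    by exists true, p.1, p.2; split => //; case: (p).
  by exists false, p.2, p.1; split; [case: (p)|exact: ltW].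
have Au : A (line2 b w u) by rewrite -pE.
have rE : rsq p = u ^+ 2 + w ^+ 2 by rewrite pE rsq_line2.
have r1 : R1 ^+ 2 < rsq p by move: Ap => /andP[].
case: (leP (w ^+ 2) (rho ^+ 2)) => wr.
  have u1 : R1 / 2 < `|u|.
    rewrite -(@ltr_pXn2r _ 2) ?nnegrE ?divr_ge0// ?(ltW R1_gt0)//.
    rewrite real_normK ?num_real// expr_div_n; move: r1; rewrite rE; lra.
  have u0 : u != 0.
    by rewrite -normr_gt0 (lt_trans _ u1)// divr_gt0.
  rewrite [in `|f _|]pE; apply: le_trans (boundary_line cf rf hrho f0 (hL b) Au wr u0) _.
  rewrite -rE mulrDl -[leLHS]addr0 lerD//; last by rewrite mulr_ge0// divr_ge0// ltW.
  rewrite -mulrA ler_wpM2l// mulrC ler_wpM2r//.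
  rewrite -[leRHS]invrK lef_pV2 ?posrE ?invf_div ?divr_gt0//; first exact: ltW.
  by rewrite normr_gt0.
have rr : R1 ^+ 2 <= `|rsq p - rho ^+ 2|.
  by rewrite ger0_norm; rewrite rE; lra.
apply: le_trans (hK _ Ap I) _; rewrite mulrDl -[leLHS]add0r lerD//.
  by rewrite !mulr_ge0// ?invr_ge0 ltW.
rewrite -mulrA ler_peMr// ler_pdivlMl// mulr1//.
Qed.

End Slices.

Lemma ord3 (P : 'I_3 -> Prop) : P 0 -> P 1 -> P 2%:R -> forall i, P i.
Proof.
move=> p0 p1 p2 [[|[|[|//]]] h].
- by rewrite (_ : Ordinal h = 0)//; exact: val_inj.
- by rewrite (_ : Ordinal h = 1)//; exact: val_inj.
- by rewrite (_ : Ordinal h = 2%:R)//; exact: val_inj.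
Qed.

(** * The base flow in Cartesian coordinates *)

Section BaseFlow.
#[local] Set Implicit Arguments.
#[local] Unset Strict Implicit.
Context {R : realType}.
(** [E] is generic because the base flow is needed twice: in Omega with bounds on slabs, and with
    [S] empty on an open neighbourhood of the closure, for continuity up to the boundary. *)
Variables (E : set (pt R)) (S : set (set (pt R))) (c0 : R).
Hypotheses (oE : open E) (c0_gt0 : 0 < c0)
  (Ec0 : forall x, E x -> c0 <= rsq x.1)
  (bX : forall B, S B -> exists C, forall x, E x -> B x -> `|x.1.1| <= C)
  (bY : forall B, S B -> exists C, forall x, E x -> B x -> `|x.1.2| <= C)
  (bZ : forall B, S B -> exists C, forall x, E x -> B x -> `|x.2| <= C).
Variables (R1 k a1 a2 a3 p1 p2 p3 a4 : R).

Local Notation r1 := (reg1 evec E S).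

Definition kron (n : nat) (j : 'I_3) : R := (nat_of_ord j == n)%:R.

Lemma coordX_reg1 : r1 (fun x => x.1.1) (fun j _ => kron 0 j).
Proof.
split; last 1 first.
- move=> x j _; apply: (@is_derive_transfer R R (pt R) id _ x.1.1 (evec j).1.1) => //.
- split; last exact: bX.
  move=> x _; apply: (@continuous_comp _ _ _ fst fst); exact: fst_continuous.
- by move=> j; exact: reg0_cst.
Qed.

Lemma coordY_reg1 : r1 (fun x => x.1.2) (fun j _ => kron 1 j).
Proof.
split; last 1 first.
- move=> x j _; apply: (@is_derive_transfer R R (pt R) id _ x.1.2 (evec j).1.2) => //.
- split; last exact: bY.
  move=> x _; apply: (@continuous_comp _ _ _ fst snd);
    [exact: fst_continuous|exact: snd_continuous].
- by move=> j; exact: reg0_cst.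
Qed.

Lemma coordZ_reg1 : r1 (fun x => x.2) (fun j _ => kron 2 j).
Proof.
split; last 1 first.
- move=> x j _; apply: (@is_derive_transfer R R (pt R) id _ x.2 (evec j).2) => //.
- split; last exact: bZ.
  move=> x _; exact: snd_continuous.
- by move=> j; exact: reg0_cst.
Qed.

Definition xh (j : 'I_3) (x : pt R) : R := kron 0 j * x.1.1 + kron 1 j * x.1.2.
Definition dxh (j l : 'I_3) : R := kron 0 j * kron 0 l + kron 1 j * kron 1 l.
Definition iq (x : pt R) : R := (rsq x.1)^-1.

Let rX := coordX_reg1. Let rY := coordY_reg1. Let rZ := coordZ_reg1.
Let rC (c : R) : r1 (fun=> c) (fun _ _ => 0) := reg1_cst _ _ _ c.

Lemma xh_reg1 j : r1 (xh j) (fun l _ => dxh j l).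
Proof.
apply: reg1_eq (reg1D (reg1M (rC (kron 0 j)) rX) (reg1M (rC (kron 1 j)) rY)) => //.
by move=> x l _; rewrite /dxh; ring.
Qed.

Lemma q_reg1 : r1 (fun x => rsq x.1) (fun l x => 2 * xh l x).
Proof.
apply: reg1_eq (reg1D (reg1M rX rX) (reg1M rY rY)) => //.
by move=> x l _; rewrite /xh; ring.
Qed.

Let q_gt0 x : E x -> 0 < rsq x.1.
Proof. by move=> /Ec0; exact: lt_le_trans. Qed.

Lemma iq_reg1 : r1 iq (fun l x => - (2 * xh l x) * iq x ^+ 2).
Proof. exact: reg1V c0_gt0 Ec0 q_reg1. Qed.

Lemma lnq_reg1 : r1 (fun x => ln (rsq x.1)) (fun l x => 2 * xh l x * iq x).
Proof.
have [[cq bq] _ Dq] := q_reg1; have [[ci bi] _ _] := iq_reg1.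
split.
- split=> [x Ex|B SB].
    apply: (continuous_comp (g := @ln R)); first exact: cq.
    by apply: continuous_ln; exact: q_gt0.
  have [[C hC] [K hK]] := (bq _ SB, bi _ SB).
  exists (C + K) => x Ex Bx; have q0 := q_gt0 Ex.
  (* [ln] lies below the identity; used at rsq and at 1/rsq, this bounds the logarithm on both
     sides. *)
  have l1 := ln_sublinear q0.
  have iq0 : 0 < (rsq x.1)^-1 by rewrite invr_gt0.
  have l2 := ln_sublinear iq0; rewrite lnV ?posrE// in l2.
  have h1 := hC _ Ex Bx; rewrite (ger0_norm (ltW q0)) in h1.
  have h2 := hK _ Ex Bx; rewrite /iq (ger0_norm (ltW iq0)) in h2.
  by rewrite ler_norml; apply/andP; split; lra.
- move=> l; apply: reg0M; last by have [] := iq_reg1.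
  by apply: reg0M; [exact: reg0_cst|have [] := xh_reg1 l].
- move=> x l Ex; have h := is_derive1_ln (q_gt0 Ex).
  apply: is_derive_eq (is_derive_comp1 _ _ (fun y : pt R => rsq y.1) _ _ _ _ h (Dq _ l Ex)) _.
  by rewrite mulrC.
Qed.

Let rq := q_reg1. Let ri := iq_reg1. Let rl := lnq_reg1.

(* ub and pb are U_tilde and P_tilde in Cartesian coordinates, as functions of
   rsq = rho^2 with generic coefficients; xh is the horizontal part of the
   position vector and iq = rho^-2.  The prefixes d and dd stand for the first
   and second partial derivatives. *)
Definition uh (x : pt R) : R := k * (1 - R1 ^+ 2 * iq x).
Definition ub0 (x : pt R) : R := - (uh x * x.1.2).
Definition ub1 (x : pt R) : R := uh x * x.1.1.
Definition ub2 (x : pt R) : R := a1 * rsq x.1 + a2 * ln (rsq x.1) + a3.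
Definition pb (x : pt R) : R :=
  p1 * rsq x.1 + p2 * iq x + p3 * ln (rsq x.1) + a4 * x.2.

Definition g2 : R := 2 * k * R1 ^+ 2.

Definition dub0 (j : 'I_3) (x : pt R) : R :=
  - (g2 * iq x ^+ 2 * xh j x * x.1.2 + uh x * kron 1 j).
Definition dub1 (j : 'I_3) (x : pt R) : R :=
  g2 * iq x ^+ 2 * xh j x * x.1.1 + uh x * kron 0 j.
Definition dub2 (j : 'I_3) (x : pt R) : R := 2 * xh j x * (a1 + a2 * iq x).
Definition dpb (j : 'I_3) (x : pt R) : R :=
  2 * xh j x * (p1 - p2 * iq x ^+ 2 + p3 * iq x) + a4 * kron 2 j.

Definition ddub0 (j l : 'I_3) (x : pt R) : R :=
  - (g2 * (- 4 * xh l x * iq x ^+ 3 * xh j x * x.1.2 + iq x ^+ 2 * dxh j l * x.1.2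
           + iq x ^+ 2 * xh j x * kron 1 l) + g2 * iq x ^+ 2 * xh l x * kron 1 j).
Definition ddub1 (j l : 'I_3) (x : pt R) : R :=
  g2 * (- 4 * xh l x * iq x ^+ 3 * xh j x * x.1.1 + iq x ^+ 2 * dxh j l * x.1.1
           + iq x ^+ 2 * xh j x * kron 0 l) + g2 * iq x ^+ 2 * xh l x * kron 0 j.
Definition ddub2 (j l : 'I_3) (x : pt R) : R :=
  2 * dxh j l * (a1 + a2 * iq x) - 4 * xh j x * xh l x * a2 * iq x ^+ 2.

Lemma uh_reg1 : r1 uh (fun j x => g2 * iq x ^+ 2 * xh j x).
Proof.
apply: reg1_eq (reg1M (rC k) (reg1B (rC 1) (reg1M (rC (R1 ^+ 2)) ri))) => //.
by move=> x j _; rewrite /g2; ring.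
Qed.

Lemma ub0_reg1 : r1 ub0 dub0.
Proof.
by apply: reg1_eq (reg1N (reg1M uh_reg1 rY)) => // x j _; rewrite /dub0; ring.
Qed.

Lemma ub1_reg1 : r1 ub1 dub1.
Proof.
by apply: reg1_eq (reg1M uh_reg1 rX) => // x j _; rewrite /dub1; ring.
Qed.

Lemma ub2_reg1 : r1 ub2 dub2.
Proof.
apply: reg1_eq (reg1D (reg1D (reg1M (rC a1) rq) (reg1M (rC a2) rl)) (rC a3)) => //.
by move=> x j _; rewrite /dub2; ring.
Qed.

Lemma pb_reg1 : r1 pb dpb.
Proof.
apply: reg1_eq (reg1D (reg1D (reg1D (reg1M (rC p1) rq) (reg1M (rC p2) ri))
  (reg1M (rC p3) rl)) (reg1M (rC a4) rZ)) => //.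
by move=> x j _; rewrite /dpb; ring.
Qed.

Let ri2 := reg1M ri ri.

Lemma dub0_reg1 j : r1 (dub0 j) (ddub0 j).
Proof.
apply: reg1_eq (reg1N (reg1D (reg1M (reg1M (reg1M (rC g2) ri2) (xh_reg1 j)) rY)
  (reg1M uh_reg1 (rC (kron 1 j))))) => //.
by move=> x l _; rewrite /ddub0; ring.
Qed.

Lemma dub1_reg1 j : r1 (dub1 j) (ddub1 j).
Proof.
apply: reg1_eq (reg1D (reg1M (reg1M (reg1M (rC g2) ri2) (xh_reg1 j)) rX)
  (reg1M uh_reg1 (rC (kron 0 j)))) => //.
- by move=> x l _; rewrite /ddub1; ring.
Qed.

Lemma dub2_reg1 j : r1 (dub2 j) (ddub2 j).
Proof.
apply: reg1_eq (reg1M (reg1M (rC 2) (xh_reg1 j)) (reg1D (rC a1) (reg1M (rC a2) ri))) => //.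
- by move=> x l _; rewrite /ddub2; ring.
Qed.

(** The match on the underlying number reduces at a literal index, so simplification exposes the
    component. *)
Definition tri (T : Type) (a b c : T) (i : 'I_3) : T :=
  match nat_of_ord i with 0%N => a | 1%N => b | _ => c end.

Definition ub := tri ub0 ub1 ub2.
Definition dub := tri dub0 dub1 dub2.
Definition ddub := tri ddub0 ddub1 ddub2.

Lemma ub_reg1 i : r1 (ub i) (dub i).
Proof.
move: i; apply: ord3; [exact: ub0_reg1|exact: ub1_reg1|exact: ub2_reg1].
Qed.

Lemma dub_reg1 i j : r1 (dub i j) (ddub i j).
Proof.
move: i; apply: ord3; [exact: dub0_reg1|exact: dub1_reg1|exact: dub2_reg1].
Qed.

End BaseFlow.

Section BaseFlowEquation.
Context {R : realType}.
Variables (R1 k a1 a2 a3 a4 : R).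

Lemma sum3 (f : 'I_3 -> R) : \sum_(i < 3) f i = f 0 + f 1 + f 2%:R.
Proof.
rewrite !big_ord_recl big_ord0 addr0 addrA.
by congr (_ + _ + _); congr f; exact: val_inj.
Qed.

Let U := ub R1 k a1 a2 a3.
Let dU := dub R1 k a1 a2.
Let ddU := ddub R1 k a1 a2.
(** The first three coefficients integrate the centrifugal term u_theta^2 / rho, where u_theta = k
    (rho - R1^2 / rho). *)
Let dP := dpb (k ^+ 2 / 2) (- (k ^+ 2 * R1 ^+ 4 / 2)) (- (k ^+ 2 * R1 ^+ 2)) a4.

Lemma base_divergence x : \sum_j dU j j x = 0.
Proof.
rewrite sum3 /dU /dub /tri /= /dub0 /dub1 /dub2 /xh /kron /=; ring.
Qed.

(** Along the axis, a1 rho^2 has Laplacian 4 a1 and the logarithm is harmonic, so the axial pressure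
    gradient [a4] must equal 4 a1. *)
Lemma base_equation i x : 0 < rsq x.1 -> a4 = 4 * a1 ->
  - (\sum_j ddU i j j x) + \sum_j U j x * dU i j x + dP i x = 0.
Proof.
move=> q0 a4E; have q1 : rsq x.1 != 0 by rewrite gt_eqF.
move: i; apply: ord3; rewrite !sum3 /U /ub /dU /dub /ddU /ddub /dP /tri /=
  /dpb /ddub0 /ddub1 /ddub2 /dub0 /dub1 /dub2 /ub0 /ub1 /ub2 /g2 /uh /dxh /xh /kron /iq /=.
- by move: q1; rewrite /rsq => q1; field.
- by move: q1; rewrite /rsq => q1; field.
- rewrite a4E; move: q1; rewrite /rsq; set L := ln _ => q1; field.
  by [].
Qed.

End BaseFlowEquation.

(** * Pointwise energy identity *)

Section Flux.
#[local] Set Implicit Arguments.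
#[local] Unset Strict Implicit.
Context {R : realType}.
Variables (D : set (pt R)) (S : set (set (pt R))).
Local Notation regD0 := (reg0 D S).
Local Notation regD1 := (reg1 evec D S).
Variables (v U : 'I_3 -> pt R -> R) (dv dU : 'I_3 -> 'I_3 -> pt R -> R)
  (ddv : 'I_3 -> 'I_3 -> 'I_3 -> pt R -> R) (q : pt R -> R) (dq : 'I_3 -> pt R -> R).
Hypotheses (oD : open D)
  (rv : forall i, regD1 (v i) (dv i)) (rdv : forall i j, regD1 (dv i j) (ddv i j))
  (rU : forall i, regD1 (U i) (dU i)) (rq : regD1 q dq)
  (momentum : forall i x, D x -> - (\sum_j ddv i j j x) +
     \sum_j (U j x + v j x) * dv i j x + \sum_j v j x * dU i j x + dq i x = 0)
  (div_v : forall x, D x -> \sum_j dv j j x = 0)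
  (div_U : forall x, D x -> \sum_j dU j j x = 0).

Lemma second_symmetric i j l x : D x -> ddv i j l x = ddv i l j x.
Proof.
move=> Dx; have [_ _ Dv] := rv i.
have [_ /(_ l) [c1 _] D1] := rdv i j; have [_ /(_ j) [c2 _] D2] := rdv i l.
apply: (@schwarz R (pt R) D (v i) (dv i j) (dv i l) (ddv i j l) (ddv i l j)
  (evec j) (evec l)) => //.
- exact: c1.
- exact: c2.
Qed.

Lemma div_v_derive l x : D x -> \sum_j ddv j j l x = 0.
Proof.
move=> Dx; have [_ _ /(_ x l Dx) [_ E1]] := reg1_sum (index_enum 'I_3) (fun j => rdv j j).
have [_ E2] := is_derive_cst (0 : R) x (evec l).
transitivity ('D_(evec l) (fun x => \sum_j dv j j x) x); first by rewrite E1.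
transitivity ('D_(evec l) (cst (0 : R)) x); last by rewrite E2.
apply: near_eq_derive.
by near=> y; apply: div_v; near: y; move: oD; rewrite openE; exact.
Unshelve. all: by end_near. Qed.

Definition vort (i : 'I_3) (x : pt R) : R :=
  tri (dv 2%:R 1 x - dv 1 2%:R x) (dv 0 2%:R x - dv 2%:R 0 x) (dv 1 0 x - dv 0 1 x) i.

Definition dvort (i l : 'I_3) (x : pt R) : R :=
  tri (ddv 2%:R 1 l x - ddv 1 2%:R l x) (ddv 0 2%:R l x - ddv 2%:R 0 l x)
    (ddv 1 0 l x - ddv 0 1 l x) i.

Lemma vort_reg1 i : regD1 (vort i) (dvort i).
Proof. by move: i; apply: ord3; exact: reg1B. Qed.

(* The Bernoulli term |v|^2 / 2 and the Lamb vector (curl v) x v. *)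
Definition kin (x : pt R) : R :=
  (v 0 x * v 0 x + v 1 x * v 1 x + v 2%:R x * v 2%:R x) * 2^-1.

Definition lamb (i : 'I_3) (x : pt R) : R :=
  tri (vort 1 x * v 2%:R x - vort 2%:R x * v 1 x)
      (vort 2%:R x * v 0 x - vort 0 x * v 2%:R x)
      (vort 0 x * v 1 x - vort 1 x * v 0 x) i.

(** The Lamb term comes from v . curl w = |w|^2 + div (w x v) with w = curl v; the others are the
    transported kinetic energy and the work of the pressure. *)
Definition flux (i : 'I_3) (x : pt R) : R :=
  lamb i x + (U i x + v i x) * kin x + q x * v i x.

Definition dissipation (x : pt R) : R :=
  \sum_i vort i x ^+ 2 + \sum_i \sum_j v i x * v j x * dU i j x.

(* The momentum equation multiplied by v, with -laplacian v = curl (curl v). *)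
Lemma flux_identity : exists dF : 'I_3 -> 'I_3 -> pt R -> R,
  (forall i, regD1 (flux i) (dF i)) /\
  (forall x, D x -> dissipation x + \sum_i dF i i x = 0).
Proof.
have rk := reg1M (reg1D (reg1D (reg1M (rv 0) (rv 0)) (reg1M (rv 1) (rv 1)))
  (reg1M (rv 2%:R) (rv 2%:R))) (reg1_cst _ _ _ (2^-1 : R)).
have rl (i j : 'I_3) := reg1M (vort_reg1 i) (rv j).
have r0 := reg1D (reg1D (reg1B (rl 1 2%:R) (rl 2%:R 1))
  (reg1M (reg1D (rU 0) (rv 0)) rk)) (reg1M rq (rv 0)).
have r1 := reg1D (reg1D (reg1B (rl 2%:R 0) (rl 0 2%:R))
  (reg1M (reg1D (rU 1) (rv 1)) rk)) (reg1M rq (rv 1)).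
have r2 := reg1D (reg1D (reg1B (rl 0 1) (rl 1 0))
  (reg1M (reg1D (rU 2%:R) (rv 2%:R)) rk)) (reg1M rq (rv 2%:R)).
eexists (tri _ _ _); split.
  by apply: ord3; [exact: r0|exact: r1|exact: r2].
move=> x Dx.
have e0 := momentum 0 Dx; have e1 := momentum 1 Dx; have e2 := momentum 2%:R Dx.
have dV := div_v Dx; have dUU := div_U Dx.
have d0 := div_v_derive 0 Dx; have d1 := div_v_derive 1 Dx.
have d2 := div_v_derive 2%:R Dx.
rewrite /dissipation !sum3 /tri /=; rewrite !sum3 in e0 e1 e2 dV dUU d0 d1 d2.
rewrite /dvort /vort /kin /tri /=.
rewrite (second_symmetric 0 1 0 Dx) (second_symmetric 0 2%:R 0 Dx).
rewrite (second_symmetric 1 0 1 Dx) (second_symmetric 1 2%:R 1 Dx).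
rewrite (second_symmetric 2%:R 0 2%:R Dx) (second_symmetric 2%:R 1 2%:R Dx).
(* Besides v . momentum, the gradient of div v ([G0], [G1], [G2]) turns -laplacian into curl curl,
   and the multiples of div v and div U ([V], [W]) put transport and pressure in divergence form. *)
match type of e0 with ?E0 = _ => match type of e1 with ?E1 = _ =>
match type of e2 with ?E2 = _ => match type of d0 with ?G0 = _ =>
match type of d1 with ?G1 = _ => match type of d2 with ?G2 = _ =>
match type of dV with ?V = _ => match type of dUU with ?W = _ =>
  transitivity (v 0 x * E0 + v 1 x * E1 + v 2%:R x * E2 +
    (W + V) * kin x + q x * V + v 0 x * G0 + v 1 x * G1 + v 2%:R x * G2)
end end end end end end end end.
  by rewrite /kin; field.
by rewrite e0 e1 e2 dV dUU d0 d1 d2; ring.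
Qed.

End Flux.

(** * Integration over slabs *)

Section Slab.
#[local] Set Implicit Arguments.
#[local] Unset Strict Implicit.
Context {R : realType}.
Local Notation mR := (measurableTypeR R).
Variables R1 R2 : R.
Hypotheses (R1_gt0 : 0 < R1) (R1_lt_R2 : R1 < R2).
Local Notation D := (Omega R1 R2).
Local Notation A := (annulus R1 R2).
Local Notation regD0 := (reg0 D (@slabs R)).
Local Notation regD1 := (reg1 evec D (@slabs R)).
Local Notation mu := (@lebesgue_measure R).

Definition slab (a b : R) : set (pt R) := A `*` `[a, b].

Let mA : measurable (A : set (mR * mR)). Proof. exact: annulus_measurable. Qed.

Lemma slab_measurable a b : measurable (slab a b : set (mR * mR * mR)).
Proof. by apply: measurableX; [exact: mA|exact: measurable_itv]. Qed.

Lemma slab_sub a b : slab a b `<=` D.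
Proof. by move=> x []. Qed.

Lemma itv_finite a b : (mu `[a, b] < +oo)%E.
Proof. by rewrite lebesgue_measure_itv/=; case: ifP; rewrite ?ltry// -EFinD ltry. Qed.

Lemma slab_finite a b : (leb3 (slab a b) < +oo)%E.
Proof.
have := annulus_finite R1_gt0 R1_lt_R2; rewrite /leb3 /leb2 /= => h.
rewrite product_measure1E; [|exact: mA|exact: measurable_itv].
by apply: lte_mul_pinfty; rewrite ?ge0_fin_numE//; exact: itv_finite.
Qed.

Lemma regD0_measurable f : regD0 f -> measurable_fun (D : set (mR * mR * mR)) f.
Proof. by move=> [cf _]; apply: continuous_measurable3; [exact: Omega_open|]. Qed.

Lemma regD0_slab f a b : regD0 f -> bdd_measurable (slab a b : set (mR * mR * mR)) f.
Proof.
move=> rf; split.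
  apply: measurable_funS (regD0_measurable rf); last exact: slab_sub.
  exact: Omega_measurable.
have [_ bf] := rf; pose N := Num.max `|a| `|b|.
have [|C hC] := bf [set x | `|x.2| <= N]; first by exists N.
exists C => x [Ax /=]; rewrite in_itv/= => /andP[xa xb]; apply: hC => //=.
rewrite /N le_max; case: (leP 0 x.2) => x0.
  rewrite (ger0_norm x0); apply/orP; right; apply: (le_trans xb); exact: ler_norm.
rewrite (ltr0_norm x0); apply/orP; left; rewrite -normrN.
by apply: le_trans (ler_norm _); rewrite lerN2.
Qed.

Lemma regD0_slab_int f a b : regD0 f -> leb3.-integrable (slab a b) (EFin \o f).
Proof.
move=> rf; apply: bdd_measurable_integrable (regD0_slab a b rf); first exact: slab_measurable.
exact: slab_finite.
Qed.

Lemma restrict_setX (T1 T2 : Type) (X : set T1) (Y : set T2) (f : T1 * T2 -> R) x y :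
  (f \_ (X `*` Y)) (x, y) =
  if (x \in X) && (y \in Y) then f (x, y) else 0.
Proof. by rewrite patchE /= in_setX. Qed.

Lemma column_continuous f p : regD0 f -> A p -> continuous (fun z => f (p, z)).
Proof.
move=> [cf _] Ap z; apply: (@continuous_comp _ _ _ (fun z => (p, z)) f).
  by apply: pair_continuous; [exact: cvg_cst|exact: cvg_id].
exact: cf.
Qed.

Section Fubini.
Variables (f : pt R -> R) (a b : R).
Hypothesis rf : regD0 f.

Let F : mR * mR * mR -> R := f \_ (slab a b).

Let iF : leb3.-integrable setT (EFin \o F).
Proof.
rewrite /F -restrict_EFin; apply/integrable_restrict => //.
  exact: slab_measurable.
by rewrite setTI; exact: regD0_slab_int.
Qed.

Let secP z : leb2.-integrable setT (EFin \o (fun p => F (p, z))).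
Proof.
have [zab|zab] := boolP (z \in `[a, b]%classic); last first.
  have -> : (fun p => F (p, z)) = cst 0.
    by apply/funext => p; rewrite /F restrict_setX (negbTE zab) andbF.
  exact: integrable0.
have -> : (fun p => F (p, z)) = (fun p => f (p, z)) \_ A.
  by apply/funext => p; rewrite /F restrict_setX zab andbT patchE.
rewrite -restrict_EFin; apply/integrable_restrict => //.
by rewrite setTI; apply: reg0A_int => //; exact: slice_reg0.
Qed.

Let secZ p : mu.-integrable setT (EFin \o (fun z => F (p, z))).
Proof.
have [pA|pA] := boolP (p \in A); last first.
  have -> : (fun z => F (p, z)) = cst 0.
    by apply/funext => z; rewrite /F restrict_setX (negbTE pA).
  exact: integrable0.
have -> : (fun z => F (p, z)) = (fun z => f (p, z)) \_ `[a, b].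
  by apply/funext => z; rewrite /F restrict_setX pA patchE.
have mi : measurable (`[a, b] : set mR) by exact: measurable_itv.
rewrite -restrict_EFin; apply/integrable_restrict => //.
rewrite setTI; apply: continuous_compact_integrable; first exact: segment_compact.
by apply: continuous_subspaceT; apply: column_continuous => //; exact/set_mem.
Qed.

Lemma slab_fubini_slices : \int[leb3]_(x in slab a b) f x =
  \int[mu]_(z in `[a, b]) \int[leb2]_(p in A) f (p, z).
Proof.
have E1 : \int[leb3]_(x in slab a b) f x = \int[leb3]_x F x.
  by rewrite Rintegral_mkcond.
have E2 : \int[leb3]_x F x = \int[mu]_z \int[leb2]_p F (p, z).
  exact: (@Rintegral_fubini21 _ _ (mR * mR)%type mR R leb2s mu F iF secP).
rewrite E1 E2.
rewrite [RHS]Rintegral_mkcond; apply: Rintegral_ext => z _; rewrite patchE.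
case: ifPn => zab.
  rewrite [RHS]Rintegral_mkcond; apply: Rintegral_ext => p _.
  by rewrite /F restrict_setX zab andbT patchE.
(* [Rintegral_cst] yields the constant times a measure, so the 0 is first put in that form. *)
rewrite -[RHS](mul0r (fine ((@lebesgue_measure R \x @lebesgue_measure R)%E setT))).
rewrite -Rintegral_cst//; apply: Rintegral_ext => p _.
by rewrite /F restrict_setX (negbTE zab) andbF.
Qed.

Lemma slab_fubini_columns : \int[leb3]_(x in slab a b) f x =
  \int[leb2]_(p in A) \int[mu]_(z in `[a, b]) f (p, z).
Proof.
have E1 : \int[leb3]_(x in slab a b) f x = \int[leb3]_x F x.
  by rewrite Rintegral_mkcond.
have E2 : \int[leb3]_x F x = \int[leb2]_p \int[mu]_z F (p, z).
  exact: (@Rintegral_fubini12 _ _ (mR * mR)%type mR R leb2s mu F iF secZ).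
rewrite E1 E2.
rewrite [RHS]Rintegral_mkcond; apply: Rintegral_ext => p _; rewrite patchE.
case: ifPn => pA.
  rewrite [RHS]Rintegral_mkcond; apply: Rintegral_ext => z _.
  by rewrite /F restrict_setX pA patchE.
rewrite -[RHS](mul0r (fine (mu setT))).
rewrite -Rintegral_cst//; apply: Rintegral_ext => z _.
by rewrite /F restrict_setX (negbTE pA).
Qed.

Lemma slab_slices_int : mu.-integrable `[a, b]
  (EFin \o (fun z => \int[leb2]_(p in A) f (p, z))).
Proof.
have mi : measurable (`[a, b] : set mR) by exact: measurable_itv.
have h := @integrable_fubini21 _ _ (mR * mR)%type mR R leb2s mu F iF secP.
have := integrableS measurableT mi (@subsetT _ _) h; apply: eq_integrable => //.
move=> z /set_mem zab; congr EFin; rewrite [RHS]Rintegral_mkcond.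
by apply: Rintegral_ext => p _; rewrite /F restrict_setX (mem_set zab) andbT patchE.
Qed.

End Fubini.

Lemma slab_vertical f df a b : a <= b -> regD1 f df ->
  \int[leb3]_(x in slab a b) df 2%:R x =
  \int[leb2]_(p in A) f (p, b) - \int[leb2]_(p in A) f (p, a).
Proof.
move=> ab [rf rdf Df]; rewrite slab_fubini_columns//.
rewrite -RintegralB//; [|by apply: reg0A_int => //; exact: slice_reg0..].
apply: Rintegral_ext => p Ap.
have H1 z : a <= z <= b -> is_derive z 1 (fun z => f (p, z)) (df 2%:R (p, z)).
  by move=> _; case: p Ap => x y Ap; apply/derive_column; exact: Df.
apply: (FTC (fun z => f (p, z)) (fun z => df 2%:R (p, z)) a b ab H1) => z _.
by apply: column_continuous; [exact: (rdf 2%:R)|exact: Ap].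
Qed.

End Slab.

(** * Components of curl, cross product and partial derivatives *)

Section Components.
#[local] Set Implicit Arguments.
#[local] Unset Strict Implicit.
Context {R : realType}.

Lemma ord3_add : ((0 : 'I_3) + 1 = 1) * ((0 : 'I_3) + 2%:R = 2%:R) *
  ((1 : 'I_3) + 1 = 2%:R) * ((1 : 'I_3) + 2%:R = 0) *
  ((2%:R : 'I_3) + 1 = 0) * ((2%:R : 'I_3) + 2%:R = 1).
Proof. by do ! split; exact: val_inj. Qed.

Lemma curlE d (v : vector_field R) x i : curl d v x 0 i =
  tri (d 1 (component v 2%:R) x - d 2%:R (component v 1) x)
      (d 2%:R (component v 0) x - d 0 (component v 2%:R) x)
      (d 0 (component v 1) x - d 1 (component v 0) x) i.
Proof. by rewrite mxE; move: i; apply: ord3; rewrite !ord3_add. Qed.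

Lemma crossE (a b : 'rV[R]_3) i : cross a b 0 i =
  tri (a 0 1 * b 0 2%:R - a 0 2%:R * b 0 1)
      (a 0 2%:R * b 0 0 - a 0 0 * b 0 2%:R)
      (a 0 0 * b 0 1 - a 0 1 * b 0 0) i.
Proof. by rewrite mxE; move: i; apply: ord3; rewrite !ord3_add. Qed.

Lemma pd_reg1 (D : set (pt R)) S f df i x : reg1 evec D S f df -> D x -> pd i f x = df i x.
Proof. by move=> [_ _ Df] Dx; have [_ <-] := Df x i Dx. Qed.

Lemma pd_pd_reg1 (D : set (pt R)) S f df ddf i j x : open D -> reg1 evec D S f df ->
  reg1 evec D S (df j) ddf -> D x -> pd i (pd j f) x = ddf i x.
Proof.
move=> oD rf rdf Dx; rewrite -(pd_reg1 i rdf Dx); apply: near_eq_derive.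
by near=> y; apply: (pd_reg1 j rf); near: y; move: oD; rewrite openE; exact.
Unshelve. all: by end_near. Qed.

End Components.

(** * Coefficients of the base flow of the statement *)

Section BaseFlowComponents.
#[local] Set Implicit Arguments.
#[local] Unset Strict Implicit.
Context {R : realType}.
Variables (R1 R2 alpha beta gamma : R).
Hypotheses (R1_gt0 : 0 < R1) (R1_lt_R2 : R1 < R2).

(** These four coefficients are read off [U_tilde] after ln (rho / R1) = ln (rho^2) / 2 - ln R1, the
    source of the halving in [a2B] and of the logarithm in [a3B]. *)
Definition kB : R := alpha * (R2 / (R2 ^+ 2 - R1 ^+ 2)).
Definition a1B : R := gamma / 4.
Definition a2B : R := - (gamma / 4 * R2 ^+ 2 + beta * R2 * omega01 R1 R2 R2 / 2).
Definition a3B : R := - (gamma / 4 * R1 ^+ 2 + a2B * (2 * ln R1)).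

Let ln_radius (x : pt R) : 0 < rsq x.1 ->
  ln (Defs.radius x / R1) = ln (rsq x.1) / 2 - ln R1.
Proof.
move=> q0; rewrite ln_div ?posrE ?sqrtr_gt0//; congr (_ - _).
have r0 : 0 < Defs.radius x by rewrite sqrtr_gt0.
have -> : rsq x.1 = Defs.radius x ^+ 2 by rewrite sqr_sqrtr// ltW.
by rewrite lnXn// -mulr_natr; field.
Qed.

Lemma U_tildeE x i : 0 < rsq x.1 ->
  U_tilde R1 R2 alpha beta gamma x 0 i = ub R1 kB a1B a2B a3B i x.
Proof.
move=> q0; have r0 : 0 < Defs.radius x by rewrite sqrtr_gt0.
have r2 : rsq x.1 = Defs.radius x ^+ 2 by rewrite sqr_sqrtr// ltW.
have l := ln_radius q0; have h0 := R1_gt0.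
have h1 : R2 ^+ 2 - R1 ^+ 2 != 0.
  by rewrite gt_eqF// subr_gt0 ltr_pXn2r// nnegrE ltW// (lt_trans R1_gt0).
rewrite /U_tilde !mxE; move: i; apply: ord3 => /=.
- rewrite /ub /tri /= /ub0 /uh /iq r2 /U_C /kB; field.
  by rewrite h1 gt_eqF.
- rewrite /ub /tri /= /ub1 /uh /iq r2 /U_C /kB; field.
  by rewrite h1 gt_eqF.
- rewrite /ub /tri /= /ub2 l -r2 /a1B /a3B /a2B mulr0 add0r mulr1.
  by set w := omega01 _ _ _; set q := ln _; set q1 := ln _; field.
Qed.

Lemma P_tildeE x : 0 < rsq x.1 -> P_tilde R1 R2 alpha gamma x =
  pb (kB ^+ 2 / 2) (- (kB ^+ 2 * R1 ^+ 4 / 2)) (- (kB ^+ 2 * R1 ^+ 2)) gamma x.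
Proof.
move=> q0; have r0 : 0 < Defs.radius x by rewrite sqrtr_gt0.
have r2 : rsq x.1 = Defs.radius x ^+ 2 by rewrite sqr_sqrtr// ltW.
have h1 : R2 ^+ 2 - R1 ^+ 2 != 0.
  by rewrite gt_eqF// subr_gt0 ltr_pXn2r// nnegrE ltW// (lt_trans R1_gt0).
have l : ln (rsq x.1) = 2 * ln (Defs.radius x).
  by rewrite r2 lnXn// mulr_natl.
rewrite /P_tilde /pb /P_C l /iq r2 /kB; set L := ln _; field.
by rewrite h1 gt_eqF.
Qed.

(** The [gamma] part of the axial profile has radial derivative (gamma / 2) (rho - R2^2 / rho),
    which is zero at R2; this is why [omega_tilde] can do without [gamma]. *)
Lemma base_curl_boundary x i : Gamma R2 x ->
  cross (omega_tilde R1 R2 alpha beta x) (nu x) 0 i =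
  cross (\row_i tri (dub R1 kB a1B a2B 2%:R 1 x - dub R1 kB a1B a2B 1 2%:R x)
                    (dub R1 kB a1B a2B 0 2%:R x - dub R1 kB a1B a2B 2%:R 0 x)
                    (dub R1 kB a1B a2B 1 0 x - dub R1 kB a1B a2B 0 1 x) i) (nu x) 0 i.
Proof.
rewrite /Gamma/= -/(rsq x.1) => xG; have h0 := R1_gt0; have h2 := R1_lt_R2.
have R20 : 0 < R2 by exact: lt_trans R1_lt_R2.
have rR : Defs.radius x = R2 by rewrite /Defs.radius -/(rsq x.1) xG sqrtr_sqr gtr0_norm.
have h1 : R2 ^+ 2 - R1 ^+ 2 != 0.
  by rewrite gt_eqF// subr_gt0 ltr_pXn2r// nnegrE ltW.
have ln0 : ln (R2 / R1) != 0.
  by rewrite gt_eqF// ln_gt0// ltr_pdivlMr// mul1r.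
have y2 : x.1.2 ^+ 2 = R2 ^+ 2 - x.1.1 ^+ 2 by rewrite -xG /rsq; ring.
have R2n : R2 != 0 by rewrite gt_eqF.
rewrite !crossE /omega_tilde /nu; move: i; apply: ord3; rewrite /tri /= !mxE /= rR
  /dub /tri /= /dub0 /dub1 /dub2 /uh /g2 /xh /kron /iq /= xG /a1B /a2B /kB /omega01;
  set L := ln _ in ln0 *.
- field: y2. by rewrite R2n h1 ln0.
- field: y2. by rewrite R2n h1 ln0.
- field: y2. by rewrite R2n h1 ln0.
Qed.

End BaseFlowComponents.

(** * The problem satisfied by the perturbation *)

Section Perturbation.
#[local] Set Implicit Arguments.
#[local] Unset Strict Implicit.
Context {R : realType}.
Variables (R1 R2 alpha beta gamma : R).
Hypotheses (R1_gt0 : 0 < R1) (R1_lt_R2 : R1 < R2).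
Let R2_gt0 : 0 < R2. Proof. exact: lt_trans R1_lt_R2. Qed.
Local Notation D := (Omega R1 R2).
Local Notation regD0 := (reg0 D (@slabs R)).
Local Notation regD1 := (reg1 evec D (@slabs R)).

Definition Ub := ub R1 (kB R1 R2 alpha) (a1B gamma) (a2B R1 R2 beta gamma)
  (a3B R1 R2 beta gamma).
Definition dUb := dub R1 (kB R1 R2 alpha) (a1B gamma) (a2B R1 R2 beta gamma).
Definition ddUb := ddub R1 (kB R1 R2 alpha) (a1B gamma) (a2B R1 R2 beta gamma).
Definition Pb := pb ((kB R1 R2 alpha) ^+ 2 / 2)
  (- ((kB R1 R2 alpha) ^+ 2 * R1 ^+ 4 / 2)) (- ((kB R1 R2 alpha) ^+ 2 * R1 ^+ 2)) gamma.
Definition dPb := dpb ((kB R1 R2 alpha) ^+ 2 / 2)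
  (- ((kB R1 R2 alpha) ^+ 2 * R1 ^+ 4 / 2)) (- ((kB R1 R2 alpha) ^+ 2 * R1 ^+ 2)) gamma.

Let R12_gt0 : 0 < R1 ^+ 2. Proof. by rewrite exprn_gt0. Qed.

Let lb x : D x -> R1 ^+ 2 <= rsq x.1.
Proof. by move=> /andP[/ltW]. Qed.
Let bX B : @slabs R B -> exists C, forall x : pt R, D x -> B x -> `|x.1.1| <= C.
Proof. by exists R2 => x Dx _; exact: (annulus_coord R1_gt0 R1_lt_R2 false Dx). Qed.
Let bY B : @slabs R B -> exists C, forall x : pt R, D x -> B x -> `|x.1.2| <= C.
Proof. by exists R2 => x Dx _; exact: (annulus_coord R1_gt0 R1_lt_R2 true Dx). Qed.
Let bZ B : @slabs R B -> exists C, forall x : pt R, D x -> B x -> `|x.2| <= C.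
Proof. by move=> [N ->]; exists N. Qed.

Let oD : open D. Proof. exact: Omega_open. Qed.

Lemma Ub_reg i : regD1 (Ub i) (dUb i).
Proof. exact: (ub_reg1 oD R12_gt0 lb bX bY). Qed.
Lemma dUb_reg i j : regD1 (dUb i j) (ddUb i j).
Proof. exact: (dub_reg1 oD R12_gt0 lb bX bY). Qed.
Lemma Pb_reg : regD1 Pb dPb.
Proof. exact: (pb_reg1 oD R12_gt0 lb bX bY bZ). Qed.

(** An open neighbourhood of the closure that avoids the axis: the base flow is smooth there, hence
    continuous within the closure. *)
Let O : set (pt R) := [set x | R1 ^+ 2 / 2 < rsq x.1].

Let oO : open O.
Proof.
apply: (open_comp (f := fun x : pt R => rsq x.1) (D := [set y | R1 ^+ 2 / 2 < y])).
  by move=> x _; exact: rsq3_continuous.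
exact: open_gt.
Qed.

Let clO : closure D `<=` O.
Proof.
rewrite closure_Omega// => x /andP[h _]; apply: lt_le_trans h.
by rewrite ltr_pdivrMr// ltr_pMr// ltr1n.
Qed.

Let nb (f : pt R -> R) (B : set (pt R)) : set0 B ->
  exists C, forall x, O x -> B x -> `|f x| <= C.
Proof. by []. Qed.

Let cO f : reg0 O set0 f -> {within closure D, continuous f}.
Proof.
move=> [cf _]; apply: continuous_in_subspaceT => x /set_mem /clO; exact: cf.
Qed.

Let O_gt0 : 0 < R1 ^+ 2 / 2. Proof. by rewrite divr_gt0. Qed.
Let lbO x : O x -> R1 ^+ 2 / 2 <= rsq x.1. Proof. exact: ltW. Qed.

Lemma Ub_within i : {within closure D, continuous (Ub i)}.
Proof.
apply: cO.
by have [] := @ub_reg1 _ O set0 _ oO O_gt0 lbO (@nb _) (@nb _) R1 (kB R1 R2 alpha)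
  (a1B gamma) (a2B R1 R2 beta gamma) (a3B R1 R2 beta gamma) i.
Qed.

Lemma dUb_within i j : {within closure D, continuous (dUb i j)}.
Proof.
apply: cO.
by have [] := @dub_reg1 _ O set0 _ oO O_gt0 lbO (@nb _) (@nb _) R1 (kB R1 R2 alpha)
  (a1B gamma) (a2B R1 R2 beta gamma) i j.
Qed.

Lemma coord_within c : {within closure D, continuous (fun x : pt R => coord2 c x.1)}.
Proof.
apply: continuous_subspaceT => x.
apply: (@continuous_comp _ _ _ fst (coord2 c)); first exact: fst_continuous.
by case: c; [exact: snd_continuous|exact: fst_continuous].
Qed.

Lemma withinM (E : set (pt R)) (f g : pt R -> R) : {within E, continuous f} ->
  {within E, continuous g} -> {within E, continuous (fun x => f x * g x)}.
Proof. by move=> cf cg x; apply: continuousM; [exact: cf|exact: cg]. Qed.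

Lemma withinB (E : set (pt R)) (f g : pt R -> R) : {within E, continuous f} ->
  {within E, continuous g} -> {within E, continuous (fun x => f x - g x)}.
Proof. by move=> cf cg x; apply: continuousB; [exact: cf|exact: cg]. Qed.

Lemma withinD (E : set (pt R)) (f g : pt R -> R) : {within E, continuous f} ->
  {within E, continuous g} -> {within E, continuous (fun x => f x + g x)}.
Proof. by move=> cf cg x; apply: continuousD; [exact: cf|exact: cg]. Qed.

Variables (v : vector_field R) (q : scalar_field R).
Hypothesis sol : classical_solution R1 R2 alpha beta
           (fun x => U_tilde R1 R2 alpha beta gamma x + v x)
           (fun x => P_tilde R1 R2 alpha gamma x + q x).

Let vc := component v.

Let clq x : closure D x -> 0 < rsq x.1.
Proof. by move=> /clO; exact: lt_trans. Qed.

(** The base flow satisfies the same equations and boundary data, so subtracting it leaves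
    homogeneous conditions. The three vorticity equations are the components of (curl v) x nu = 0 up
    to sign and the factor R2. *)
Lemma perturbation_facts : exists dv ddv dq,
  [/\ forall i, regD1 (vc i) (dv i), forall i j, regD1 (dv i j) (ddv i j),
     regD1 q dq, forall i, {within closure D, continuous (vc i)} &
     forall i j, {within closure D, continuous (dv i j)}] /\
  [/\ forall i x, D x -> - (\sum_j ddv i j j x) +
     \sum_j (Ub j x + vc j x) * dv i j x + \sum_j vc j x * dUb i j x + dq i x = 0,
    forall x, D x -> \sum_j dv j j x = 0,
    forall i x, Gamma R1 x -> vc i x = 0,
    forall x, Gamma R2 x -> x.1.1 * vc 0 x + x.1.2 * vc 1 x = 0 &
    forall x, Gamma R2 x ->
      [/\ vort dv 2%:R x * x.1.1 = 0, vort dv 2%:R x * x.1.2 = 0 &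
        vort dv 0 x * x.1.2 - vort dv 1 x * x.1.1 = 0]].
Proof.
have [hs [[G [G0 Gc GD]] [hNS [hdiv [hG1 [hG2 hcurl]]]]]] := sol.
set u := (fun x => U_tilde R1 R2 alpha beta gamma x + v x) in hs hNS hdiv hG1 hG2 hcurl.
set p := (fun x => P_tilde R1 R2 alpha gamma x + q x) in hNS G0.
have hs' i : exists Fi : seq 'I_3 -> pt R -> R,
    [/\ forall x, closure D x -> Fi [::] x = component u i x,
        forall s, {within closure D, continuous (Fi s)} &
        forall s j x, D x -> is_derive x (evec j) (Fi s) (Fi (j :: s) x)].
  exact: (hs i).
have [F hF] := choice hs'.
have Fc i s : {within closure D, continuous (F i s)} by have [_ h _] := hF i.
have rF i s : regD1 (F i s) (fun j => F i (j :: s)).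
  have [_ cF DF] := hF i; split; [|move=> j|by move=> x j; exact: DF];
    exact: within_closure_reg0.
have rG s : regD1 (G s) (fun j => G (j :: s)).
  split; [|move=> j|by move=> x j; exact: GD]; exact: within_closure_reg0.
have Fu i x : closure D x -> F i [::] x = Ub i x + vc i x.
  have [h _ _] := hF i => cx; rewrite h// /component /u mxE U_tildeE//; exact: clq.
have uc j x : closure D x -> u x 0 j = Ub j x + vc j x.
  by move=> cx; rewrite /u mxE (U_tildeE _ _ _ R1_gt0 R1_lt_R2 j (clq cx)).
have Gp x : closure D x -> G [::] x = Pb x + q x.
  by move=> cx; rewrite G0// /p P_tildeE// clq.
have clD x : D x -> closure D x by exact: subset_closure.
(* Taken from the continuous extensions of the derivatives of [u], so that [dv] has the right values
   on the boundary too. *)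
pose dv i j x := F i [:: j] x - dUb i j x.
pose ddv i j l x := F i [:: l; j] x - ddUb i j l x.
pose dq j x := G [:: j] x - dPb j x.
exists dv, ddv, dq.
have cw i : {within closure D, continuous (vc i)}.
  have h := withinB (Fc i [::]) (@Ub_within i).
  apply: subspace_eq_continuous h => x /set_mem cx.
  by rewrite /from_subspace (Fu _ _ cx) [X in X - _]addrC addrK.
have cdw i j : {within closure D, continuous (dv i j)}.
  exact: withinB (Fc i _) (@dUb_within i j).
have ru i : regD1 (component u i) (fun j => F i [:: j]).
  have [h _ _] := hF i.
  by apply: reg1_eq (rF i [::]) => // x Dx; rewrite h//; exact: clD.
have rp : regD1 p (fun j => G [:: j]).
  by apply: reg1_eq (rG [::]) => // x Dx; rewrite G0//; exact: clD.
split; first split => //.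
- move=> i; apply: reg1_eq (reg1B (rF i [::]) (Ub_reg i)) => // x Dx.
  by rewrite (Fu _ _ (clD _ Dx)) [X in X - _]addrC addrK.
- by move=> i j; exact: reg1B (rF i [:: j]) (dUb_reg i j).
- apply: reg1_eq (reg1B (rG [::]) Pb_reg) => // x Dx.
  by rewrite (Gp _ (clD _ Dx)) [X in X - _]addrC addrK.
split.
- move=> i x Dx; have q0 := clq (clD _ Dx).
  have E1 := hNS x i Dx; have E2 := @base_equation R R1 (kB R1 R2 alpha) (a1B gamma)
    (a2B R1 R2 beta gamma) (a3B R1 R2 beta gamma) gamma i x q0.
  have {}E2 := E2 ltac:(by rewrite /a1B; field).
  rewrite /laplacian !sum3 in E1; rewrite !sum3 in E2.
  rewrite !(pd_pd_reg1 _ oD (ru i) (rF i [:: _]) Dx) in E1.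
  rewrite !(pd_reg1 _ (ru i) Dx) (pd_reg1 _ rp Dx) in E1.
  have uE j : component u j x = Ub j x + vc j x.
    have [h _ _] := hF j.
    by rewrite -Fu ?h//; exact: clD.
  rewrite !uE in E1; rewrite !sum3 /ddv /dv /dq.
  move: E1 E2; rewrite -/Ub -/dUb -/ddUb -/dPb.
  (* [A0] and [B0] are the left-hand sides of the equations of [u] and of the base flow; their
     difference is the one of [v]. *)
  set A0 := (X in X = 0 -> _); move=> A00; set B0 := (X in X = 0 -> _) => B00.
  transitivity (A0 - B0); last by rewrite A00 B00 subr0.
  by rewrite /A0 /B0; ring.
- move=> x Dx; have := hdiv x Dx; rewrite /divergence !sum3 => E1.
  rewrite !(pd_reg1 _ (ru _) Dx) in E1.
  have := base_divergence R1 (kB R1 R2 alpha) (a1B gamma) (a2B R1 R2 beta gamma) x.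
  rewrite sum3 -/dUb => E2; rewrite /dv.
  transitivity ((F 0 [:: 0] x + F 1 [:: 1] x + F 2%:R [:: 2%:R] x) -
    (dUb 0 0 x + dUb 1 1 x + dUb 2%:R 2%:R x)); first by ring.
  by rewrite E1 E2 subr0.
- move=> i x Gx; have := hG1 x Gx => /(congr1 (fun w : 'rV[R]_3 => w 0 i)).
  have cx : closure D x by apply: (Gamma_closure R1_gt0 R1_lt_R2 (or_introl erefl)).
  rewrite (uc _ _ cx) [RHS]mxE => E.
  suff U0 : Ub i x = 0 by move: E; rewrite U0 add0r.
  have iqE : R1 ^+ 2 * iq x = 1.
    by move: Gx; rewrite /Gamma/= -/(rsq x.1) /iq => ->; rewrite mulfV// gt_eqF.
  have lnE : ln (rsq x.1) = 2 * ln R1.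
    by move: Gx; rewrite /Gamma/= -/(rsq x.1) => ->; rewrite lnXn// mulr_natl.
  move: i {E}; apply: ord3; rewrite /Ub /ub /tri /=.
  + by rewrite /ub0 /uh iqE; ring.
  + by rewrite /ub1 /uh iqE; ring.
  + rewrite /ub2 lnE; move: Gx; rewrite /Gamma/= -/(rsq x.1) => ->.
    by rewrite /a3B /a1B; ring.
- move=> x Gx; have := hG2 x Gx.
  have cx : closure D x by apply: (Gamma_closure R1_gt0 R1_lt_R2 (or_intror erefl)).
  have R20 := R2_gt0.
  have rR : Defs.radius x = R2.
    by move: Gx; rewrite /Gamma/= /Defs.radius => ->; rewrite sqrtr_sqr gtr0_norm.
  rewrite /dot sum3 !(uc _ _ cx) /nu !mxE /=.
  rewrite rR {1 2}/Ub /ub /tri /= /ub0 /ub1 mulr0 addr0 => E.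
  rewrite -[RHS](mulr0 R2) -E; field; rewrite gt_eqF//.
- move=> x Gx.
  have cx : closure D x by apply: (Gamma_closure R1_gt0 R1_lt_R2 (or_intror erefl)).
  have R20 := R2_gt0.
  have rR : Defs.radius x = R2.
    by move: Gx; rewrite /Gamma/= /Defs.radius => ->; rewrite sqrtr_sqr gtr0_norm.
  (* [cF] is curl u extended to the closure. Its value at [x] is the limit from inside, which the
     hypothesis prescribes after crossing with the normal; uniqueness of limits compares the two. *)
  pose cF i y := tri (F 2%:R [:: 1] y - F 1 [:: 2%:R] y)
    (F 0 [:: 2%:R] y - F 2%:R [:: 0] y) (F 1 [:: 0] y - F 0 [:: 1] y) i.
  have ccF i : {within closure D, continuous (cF i)}.
    by move: i; apply: ord3; rewrite /cF /tri /=; apply: withinB; exact: Fc.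
  have PF : ProperFilter (within D (nbhs x)) by exact: within_nbhs_proper.
  have lim i : cF i y @[y --> within D (nbhs x)] --> cF i x.
    have := (iffLR (subspace_continuousP _ _)) (ccF i) x cx.
    apply: cvg_trans => P hP.
    have hP2 : \forall y \near x, closure D y -> P (cF i y) by exact: hP.
    change (\forall y \near x, D y -> P (cF i y)).
    by apply: filterS hP2 => y hy Dy; apply: hy; exact: clD.
  have E i : cross (\row_i cF i x) (nu x) 0 i =
      cross (omega_tilde R1 R2 alpha beta x) (nu x) 0 i.
    pose cr (w : 'I_3 -> R) : R := tri
      (w 1 * nu x 0 2%:R - w 2%:R * nu x 0 1)
      (w 2%:R * nu x 0 0 - w 0 * nu x 0 2%:R)
      (w 0 * nu x 0 1 - w 1 * nu x 0 0) i.
    have l1 : cr (cF ^~ y) @[y --> within D (nbhs x)] --> cr (cF ^~ x).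
      rewrite /cr; move: i @cr; apply: ord3; rewrite /tri /=; apply: cvgB;
        apply: cvgM; try exact: lim; exact: cvg_cst.
    have l2 : cr (cF ^~ y) @[y --> within D (nbhs x)] -->
        cross (omega_tilde R1 R2 alpha beta x) (nu x) 0 i.
      have h : (cross (curl pd u y) (nu x)) 0 i @[y --> within D (nbhs x)] -->
          cross (omega_tilde R1 R2 alpha beta x) (nu x) 0 i.
        have cc : {for cross (omega_tilde R1 R2 alpha beta x) (nu x),
            continuous (fun M : 'rV[R]_3 => M 0 i)} by exact: coord_continuous.
        exact: (continuous_cvg _ cc (hcurl x Gx)).
      have e : {near within D (nbhs x), (fun y => cross (curl pd u y) (nu x) 0 i) =1
          (fun y => cr (cF ^~ y))}; last exact: cvg_trans (near_eq_cvg e) h.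
      near=> y; have Dy : D y by near: y; exact: withinT.
      rewrite crossE !curlE /cr /cF /tri /=.
      by rewrite !(pd_reg1 _ (ru _) Dy).
    rewrite crossE -(cvg_unique (@Rhausdorff R) l1 l2) /cr /tri.
    by case: (nat_of_ord i) => [|[|?]]; rewrite !mxE.
  have E' j : cross (\row_i cF i x) (nu x) 0 j -
      cross (\row_i tri (dUb 2%:R 1 x - dUb 1 2%:R x) (dUb 0 2%:R x - dUb 2%:R 0 x)
         (dUb 1 0 x - dUb 0 1 x) i) (nu x) 0 j = 0.
    by rewrite E (base_curl_boundary _ _ gamma R1_gt0 R1_lt_R2 j Gx) subrr.
  have E0 := E' 0; have E1 := E' 1; have E2 := E' 2%:R.
  rewrite !crossE /tri /= !mxE /= rR in E0 E1 E2.
  rewrite /vort /tri /= /dv; split.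
  + rewrite -[RHS](mulr0 R2) -E1 /cF /tri /=; field; rewrite gt_eqF//.
  + rewrite -[RHS](mulr0 (- R2)) -E0 /cF /tri /=; field; rewrite gt_eqF//.
  + rewrite -[RHS](mulr0 R2) -E2 /cF /tri /=; field; rewrite gt_eqF//.
Unshelve. all: by end_near. Qed.

End Perturbation.

(** * Weak derivatives agree with the classical ones *)

Section WeakDerivative.
#[local] Set Implicit Arguments.
#[local] Unset Strict Implicit.
Context {R : realType}.
Local Notation mR := (measurableTypeR R).
Variables (R1 R2 : R).
Hypotheses (R1_gt0 : 0 < R1) (R1_lt_R2 : R1 < R2).
Let R2_gt0 : 0 < R2. Proof. exact: lt_trans R1_lt_R2. Qed.
Local Notation D := (Omega R1 R2).
Local Notation A := (annulus R1 R2).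
Local Notation regD0 := (reg0 D (@slabs R)).
Local Notation regD1 := (reg1 evec D (@slabs R)).
Local Notation s := (annulus_weight R1 R2).

Let oD : open D. Proof. exact: Omega_open. Qed.
Let bX B : @slabs R B -> exists C, forall x : pt R, D x -> B x -> `|x.1.1| <= C.
Proof. by exists R2 => x Dx _; exact: (annulus_coord R1_gt0 R1_lt_R2 false Dx). Qed.
Let bY B : @slabs R B -> exists C, forall x : pt R, D x -> B x -> `|x.1.2| <= C.
Proof. by exists R2 => x Dx _; exact: (annulus_coord R1_gt0 R1_lt_R2 true Dx). Qed.
Let bZ B : @slabs R B -> exists C, forall x : pt R, D x -> B x -> `|x.2| <= C.
Proof. by move=> [N ->]; exists N. Qed.

Section IBP.
Variable N : R.
Hypothesis N0 : 0 <= N.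

Definition zcut (x : pt R) : R := N ^+ 2 - x.2 ^+ 2.
(** A polynomial that vanishes to second order on the lateral and horizontal boundary of the slab
    |z| <= N; it takes the place of a compactly supported test function. *)
Definition weight (x : pt R) : R := (zcut x * s x.1) ^+ 2.
Definition ds3 (i : 'I_3) (x : pt R) : R :=
  2 * xh i x * (R1 ^+ 2 + R2 ^+ 2 - 2 * rsq x.1).
Definition dweight (i : 'I_3) (x : pt R) : R :=
  2 * zcut x ^+ 2 * s x.1 * ds3 i x - 4 * x.2 * kron 2 i * zcut x * s x.1 ^+ 2.

Lemma weight_reg1 : regD1 weight dweight.
Proof.
have rZ := coordZ_reg1 bZ; have rq := q_reg1 oD bX bY.
have rc (c : R) : regD1 (fun=> c) (fun _ _ => 0) := reg1_cst _ _ _ c.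
have rz := reg1B (rc (N ^+ 2)) (reg1M rZ rZ).
have rs := reg1M (reg1B (rc (R2 ^+ 2)) rq) (reg1B rq (rc (R1 ^+ 2))).
have rw := reg1M rz rs.
apply: reg1_eq (reg1M rw rw) => //.
by move=> x i _; rewrite /dweight /zcut /annulus_weight /ds3; ring.
Qed.

(** In a horizontal direction every section integrates to zero by [slice_ibp]; in the vertical one
    the weight vanishes at both ends. *)
Lemma weight_ibp m dm i : regD1 m dm ->
  \int[leb3]_(x in slab R1 R2 (- N) N) (dweight i x * m x + weight x * dm i x) = 0.
Proof.
move=> rm; have rM := reg1M weight_reg1 rm.
have [_ rdM _] := rM.
have mi : measurable (`[- N, N] : set mR) by exact: measurable_itv.
move: i; apply: ord3.
- rewrite (slab_fubini_slices R1_gt0 R1_lt_R2 _ _ (rdM 0)).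
  rewrite (@Rintegral_ext _ _ _ _ _ _ (cst 0)) ?Rintegral_cst ?mul0r// => z _ /=.
  have E := slice_ibp R1_gt0 R1_lt_R2 (slice_reg1 z rm) false.
  transitivity (\int[leb2]_(p in A) ((N ^+ 2 - z ^+ 2) ^+ 2 *
    (2 * s p * dannulus_weight R1 R2 false p * m (p, z) + s p ^+ 2 * dm 0 (p, z)))).
    apply: Rintegral_ext => p _.
    by rewrite /dweight /weight /zcut /ds3 /dannulus_weight /xh /kron /=; ring.
  rewrite RintegralZl ?E ?mulr0//; first exact: annulus_measurable.
  apply: reg0A_int => //.
  exact: (dcutoff2_reg R1_gt0 R1_lt_R2 (slice_reg1 z rm) false).
- rewrite (slab_fubini_slices R1_gt0 R1_lt_R2 _ _ (rdM 1)).
  rewrite (@Rintegral_ext _ _ _ _ _ _ (cst 0)) ?Rintegral_cst ?mul0r// => z _ /=.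
  have E := slice_ibp R1_gt0 R1_lt_R2 (slice_reg1 z rm) true.
  transitivity (\int[leb2]_(p in A) ((N ^+ 2 - z ^+ 2) ^+ 2 *
    (2 * s p * dannulus_weight R1 R2 true p * m (p, z) + s p ^+ 2 * dm 1 (p, z)))).
    apply: Rintegral_ext => p _.
    by rewrite /dweight /weight /zcut /ds3 /dannulus_weight /xh /kron /=; ring.
  rewrite RintegralZl ?E ?mulr0//; first exact: annulus_measurable.
  apply: reg0A_int => //.
  exact: (dcutoff2_reg R1_gt0 R1_lt_R2 (slice_reg1 z rm) true).
- have NN : - N <= N by rewrite lerNl (le_trans _ N0)// oppr_le0.
  rewrite (slab_vertical R1_gt0 R1_lt_R2 NN rM).
  have Z e : e ^+ 2 = N ^+ 2 -> \int[leb2]_(p in A) (weight (p, e) * m (p, e)) = 0.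
    move=> eN; transitivity (\int[leb2]_(p in A) (cst (0 : R) p)).
      by apply: Rintegral_ext => p _; rewrite /weight /zcut /= eN; ring.
    by rewrite Rintegral_cst ?mul0r//; exact: annulus_measurable.
  by rewrite !Z ?subrr// sqrrN.
Qed.

End IBP.

Lemma sqnorm_slab_cvg (h : nat -> pt R -> R) a b :
  (forall n, measurable_fun (D : set (mR * mR * mR)) (h n)) ->
  sqnorm leb3 D (h n) @[n --> \oo] --> 0%E ->
  \int[leb3]_(x in slab R1 R2 a b) (h n x ^+ 2) @[n --> \oo] --> (0 : R).
Proof.
move=> mh h0.
have le0 n : (0 <= \int[leb3]_(x in slab R1 R2 a b) ((h n x) ^+ 2)%:E <=
    sqnorm leb3 D (h n))%E.
  apply/andP; split; first by apply: integral_ge0 => x _; rewrite lee_fin sqr_ge0.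
  apply: ge0_subset_integral => //.
  - exact: slab_measurable.
  - exact: Omega_measurable.
  - by apply/measurable_EFinP; apply: measurable_funX; exact: mh.
  - by move=> x _; rewrite lee_fin sqr_ge0.
  - exact: slab_sub.
apply: fine_cvg; apply: (squeeze_cvge _ (cvg_cst 0%E) h0).
by apply: nearW => n; exact: le0.
Qed.

Lemma L2_pairing_cvg (B : set (pt R)) (c : pt R -> R) (h : nat -> pt R -> R) :
  measurable (B : set (mR * mR * mR)) ->
  measurable_fun (B : set (mR * mR * mR)) c ->
  (forall n, measurable_fun (B : set (mR * mR * mR)) (h n)) ->
  leb3.-integrable B (EFin \o (fun x => c x ^+ 2)) ->
  (forall n, leb3.-integrable B (EFin \o (fun x => h n x ^+ 2))) ->
  \int[leb3]_(x in B) (h n x ^+ 2) @[n --> \oo] --> (0 : R) ->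
  \int[leb3]_(x in B) (c x * h n x) @[n --> \oo] --> (0 : R).
Proof.
move=> mB mc mh ic ih h0; pose K := \int[leb3]_(x in B) (c x ^+ 2).
have K0 : Num.sqrt (K * \int[leb3]_(x in B) (h n x ^+ 2)) @[n --> \oo] --> (0 : R).
  have l : K * \int[leb3]_(x in B) (h n x ^+ 2) @[n --> \oo] --> (0 : R).
    by rewrite -[X in _ --> X](mulr0 K); apply: cvgM => //; exact: cvg_cst.
  have sc : {for 0, continuous (@Num.sqrt R)} by exact: sqrt_continuous.
  rewrite -[X in _ --> X](@sqrtr0 R); exact: (continuous_cvg _ sc l).
apply/norm_cvg0P; apply: (squeeze_cvgr _ (cvg_cst 0) K0).
apply: nearW => n; rewrite normr_ge0 /= -sqrtr_sqr ler_wsqrtr//.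
exact: cauchy_schwarz.
Qed.

Lemma test_reg (phi : pt R -> R) : test_function setT phi -> exists dphi ddphi,
  [/\ regD1 phi dphi, forall i, regD1 (dphi i) (ddphi i) & forall i x, pd i phi x = dphi i x].
Proof.
move=> [[F [F0 cF DF]] _].
have cT : closure (@setT (pt R)) = setT by apply/seteqP; split => // x _; exact: subset_closure.
have FE : F [::] = phi by apply/funext => x; apply: F0; rewrite cT.
have cF' w : {within closure D, continuous (F w)}.
  apply: continuous_subspaceW (cF w); rewrite cT; exact: subsetT.
exists (fun i => F [:: i]), (fun i j => F [:: j; i]); split.
- rewrite -FE; split; [|move=> j|by move=> x j _; exact: DF];
  by apply: within_closure_reg0.
- move=> i; split; [|move=> j|by move=> x j _; exact: DF];
  by apply: within_closure_reg0.
- by move=> i x; rewrite -FE; have [_ <-] := DF [::] i x I.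
Qed.

(* The trace hypothesis provides smooth approximations of f in H1, hence
   integration by parts against weight * k for every k smooth up to the
   boundary.  So w - df is orthogonal to weight * k; taking for k the derivatives
   of the approximations minus df, which tend to w - df, gives w = df. *)
Lemma wpd_ae (f : pt R -> R) df ddf r g i : H1 D f -> is_trace D r f g ->
  regD1 f df -> (forall j, regD1 (df j) (ddf j)) ->
  {ae leb3, forall x, D x -> wpd D i f x = df i x}.
Proof.
move=> [[mf f2] Hf] [_ [phi [tphi cphi cdphi _]]] rf rdf.
have [[mg g2] _] : weak_partial D i f (wpd D i f).
  by have := getPex (Hf i).
set w := wpd D i f in mg g2 *.
have mD : measurable (D : set (mR * mR * mR)) by exact: Omega_measurable.
pose dphi n := projT1 (cid (test_reg (tphi n))).
pose ddphi n := projT1 (cid (projT2 (cid (test_reg (tphi n))))).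
have Pphi n : [/\ regD1 (phi n) (dphi n), forall i, regD1 (dphi n i) (ddphi n i) &
    forall i x, pd i (phi n) x = dphi n i x].
  exact: (projT2 (cid (projT2 (cid (test_reg (tphi n)))))).
have [rf0 rdf0 _] := rf.
have mreg k : regD0 k -> measurable_fun (D : set (mR * mR * mR)) k.
  by move=> rk; apply: regD0_measurable.
have rdphi0 n : regD0 (dphi n i) by have [[_ h _] _ _] := Pphi n.
have cd : sqnorm leb3 D (fun x => dphi n i x - w x) @[n --> \oo] --> 0%E.
  have := cdphi i; apply: cvg_trans; apply: near_eq_cvg; apply: nearW => n.
  rewrite /sqnorm; apply: eq_integral => x _.
  by have [_ _ <-] := Pphi n.
(* The weight is positive inside the slab, so equality is proved on each slab and then collected
   over countably many. *)
have main (N : nat) : {ae leb3, forall x, D x /\ `|x.2| < N%:R -> w x = df i x}.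
  pose B := slab R1 R2 (- N%:R) N%:R.
  have N0 : 0 <= N%:R :> R by [].
  have mB : measurable (B : set (mR * mR * mR)) by exact: slab_measurable.
  have sB : B `<=` D by exact: slab_sub.
  have BS k : measurable_fun (D : set (mR * mR * mR)) k ->
      measurable_fun (B : set (mR * mR * mR)) k.
    exact: measurable_funS.
  have ireg k : regD0 k -> leb3.-integrable B (EFin \o k).
    by move=> rk; apply: regD0_slab_int.
  have iw2 : leb3.-integrable B (EFin \o (fun x => w x ^+ 2)).
    apply: (integrableS mD mB sB); apply/integrableP; split.
      by apply/measurable_EFinP; apply: measurable_funX.
    rewrite (le_lt_trans _ g2)// /sqnorm le_eqVlt; apply/orP; left; apply/eqP.
    by apply: eq_integral => x _ /=; rewrite ger0_norm// sqr_ge0.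
  have isub k : regD0 k -> leb3.-integrable B (EFin \o (fun x => (k x - w x) ^+ 2)).
    move=> rk; apply: (@le_integrable _ _ _ _ _ mB _
      (EFin \o (fun x => 2 * (k x ^+ 2 + w x ^+ 2)))).
    - apply/measurable_EFinP; apply: measurable_funX; apply: measurable_funB.
        by apply: BS; exact: mreg.
      exact: BS.
    - move=> x _ /=; rewrite lee_fin !ger0_norm ?sqr_ge0//.
        by have := sqr_ge0 (k x + w x); nra.
      by rewrite mulr_ge0// addr_ge0 ?sqr_ge0.
    - apply: (integrableZl mB 2 (f := EFin \o (fun x => k x ^+ 2 + w x ^+ 2))).
      apply: (integrableD mB (f := EFin \o (fun x => k x ^+ 2))
        (g := EFin \o (fun x => w x ^+ 2))) => //.
      by apply: ireg; exact: reg0X.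
  have [rT rdT _] := weight_reg1 N%:R.
  pose T := weight N%:R.
  have cdB : \int[leb3]_(x in B) ((dphi n i x - w x) ^+ 2) @[n --> \oo] --> (0 : R).
    apply: sqnorm_slab_cvg => // n; apply: measurable_funB => //.
    exact: mreg.
  (* Integration by parts moves the derivative from phi n - f onto [T * k]. As phi n tends to f and
     its derivative to [w], both in L2, the limit gives the orthogonality. *)
  have orth k dk : regD1 k dk ->
      \int[leb3]_(x in B) (T x * k x * (w x - df i x)) = 0.
    move=> rk; have [rk0 rdk _] := rk.
    have ibp n : \int[leb3]_(x in B) (T x * k x * (dphi n i x - df i x)) =
       - \int[leb3]_(x in B) ((dweight N%:R i x * k x + T x * dk i x) * (phi n x - f x)).
      have [rp _ _] := Pphi n; have [rp0 rdp _] := rp.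
      have := weight_ibp N0 i (reg1M rk (reg1B rp rf)).
      rewrite -/B => E; apply/eqP; rewrite -addr_eq0; apply/eqP; rewrite -[RHS]E.
      rewrite -RintegralD//; last 2 first.
      + apply: ireg; apply: reg0M; first exact: reg0M.
        exact: reg0B.
      + apply: ireg; apply: reg0M; last exact: reg0B.
        by apply: reg0D; apply: reg0M.
      by apply: Rintegral_ext => x _; rewrite /T; ring.
    have lim1 : \int[leb3]_(x in B) (T x * k x * (dphi n i x - df i x)) @[n --> \oo] --> (0 : R).
      under eq_fun do rewrite ibp.
      rewrite -oppr0; apply: cvgN.
      have rc : regD0 (fun x => dweight N%:R i x * k x + T x * dk i x).
        by apply: reg0D; apply: reg0M.
      have rpf n : regD0 (fun x => phi n x - f x).
        by apply: reg0B => //; have [[]] := Pphi n.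
      apply: L2_pairing_cvg => //.
      + by apply: BS; exact: mreg.
      + by move=> n; apply: BS; exact: mreg.
      + by apply: ireg; exact: reg0X.
      + by move=> n; apply: ireg; exact: reg0X.
      + by apply: sqnorm_slab_cvg => // n; exact: mreg.
    have rTk : regD0 (fun x => T x * k x) by exact: reg0M.
    have lim2 : \int[leb3]_(x in B) (T x * k x * (dphi n i x - w x)) @[n --> \oo] --> (0 : R).
      apply: L2_pairing_cvg => //.
      + by apply: BS; exact: mreg.
      + by move=> n; apply: BS; apply: measurable_funB => //; exact: mreg.
      + by apply: ireg; exact: reg0X.
      + by move=> n; exact: isub.
    have lim3 := cvgB lim1 lim2; rewrite subrr in lim3.
    have E n : \int[leb3]_(x in B) (T x * k x * (dphi n i x - df i x)) -
        \int[leb3]_(x in B) (T x * k x * (dphi n i x - w x)) =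
        \int[leb3]_(x in B) (T x * k x * (w x - df i x)).
      rewrite -RintegralB//; first by apply: Rintegral_ext => x _; ring.
      + by apply: ireg; apply: reg0M => //; exact: reg0B.
      + apply: sqr_int_measurable => //.
        * by apply: BS; exact: mreg.
        * by apply: BS; apply: measurable_funB => //; exact: mreg.
        * by apply: ireg; exact: reg0X.
        * exact: isub.
    pose J := \int[leb3]_(x in B) (T x * k x * (w x - df i x)).
    have lim4 : cst J n @[n --> \oo] --> (0 : R).
      have -> : cst J = (fun n => \int[leb3]_(x in B) (T x * k x * (dphi n i x - df i x)) -
          \int[leb3]_(x in B) (T x * k x * (dphi n i x - w x))).
        by apply/funext => n; rewrite E.
      exact: lim3.
    have lim5 : cst J n @[n --> \oo] --> J by exact: cvg_cst.
    exact: (cvg_unique (@Rhausdorff R) lim5 lim4).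
  have rTd : measurable_fun (B : set (mR * mR * mR)) (fun x => T x * (w x - df i x)).
    apply: BS; apply: measurable_funM; first exact: mreg.
    by apply: measurable_funB => //; exact: mreg.
  have [C0 hC0] : exists C, forall x, B x -> `|T x| <= C.
    by have [_ h] := regD0_slab (- N%:R) N%:R rT.
  have iTd : leb3.-integrable B (EFin \o (fun x => (T x * (w x - df i x)) ^+ 2)).
    apply: (@le_integrable _ _ _ _ _ mB _
      (EFin \o (fun x => C0 ^+ 2 * (df i x - w x) ^+ 2))).
    - by apply/measurable_EFinP; exact: measurable_funX.
    - move=> x Bx /=; rewrite lee_fin (ger0_norm (sqr_ge0 _)).
      rewrite [leRHS]ger0_norm; last by apply: mulr_ge0; exact: sqr_ge0.
      rewrite exprMn -[(w x - _) ^+ 2]sqrrN opprB ler_wpM2r ?sqr_ge0//.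
      have := hC0 x Bx => h; rewrite -[leLHS]real_normK ?num_real//.
      by rewrite ler_pXn2r// nnegrE (le_trans _ h).
    - have ii := isub _ (rdf0 i).
      exact: (integrableZl mB (C0 ^+ 2) ii).
  have lim5 : \int[leb3]_(x in B) (T x * (w x - df i x) * (dphi n i x - w x))
      @[n --> \oo] --> (0 : R).
    apply: L2_pairing_cvg => //.
    + by move=> n; apply: BS; apply: measurable_funB => //; exact: mreg.
    + by move=> n; exact: isub.
  (* By [orth] with k = dphi n i - df i, the integral that tends to 0 does not depend on n. *)
  have E n : \int[leb3]_(x in B) (T x * (w x - df i x) * (dphi n i x - w x)) =
      - \int[leb3]_(x in B) (T x * (w x - df i x) * (w x - df i x)).
    have [_ rd _] := Pphi n; have O := orth _ _ (reg1B (rd i) (rdf i)).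
    have i1 : leb3.-integrable B (EFin \o (fun x => T x * (w x - df i x) * (dphi n i x - w x))).
      apply: sqr_int_measurable => //.
      * by apply: BS; apply: measurable_funB => //; exact: mreg.
      * exact: isub.
    have i2 : leb3.-integrable B (EFin \o (fun x => T x * (w x - df i x) * (w x - df i x))).
      apply: sqr_int_measurable => //.
      * by apply: BS; apply: measurable_funB => //; exact: mreg.
      * under eq_fun do rewrite -sqrrN opprB.
        exact: isub.
    apply/eqP; rewrite -addr_eq0 -RintegralD//; apply/eqP; rewrite -[RHS]O.
    by apply: Rintegral_ext => x _; ring.
  have Z : \int[leb3]_(x in B) (T x * (w x - df i x) * (w x - df i x)) = 0.
    pose J := \int[leb3]_(x in B) (T x * (w x - df i x) * (w x - df i x)).
    have l0 : cst (- J) n @[n --> \oo] --> (0 : R).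
      have -> : cst (- J) = (fun n => \int[leb3]_(x in B)
          (T x * (w x - df i x) * (dphi n i x - w x))).
        by apply/funext => n; rewrite E.
      exact: lim5.
    have l1 : cst (- J) n @[n --> \oo] --> - J by exact: cvg_cst.
    have h : - J = 0 by exact: (cvg_unique (@Rhausdorff R) l1 l0).
    by apply/eqP; rewrite -oppr_eq0; apply/eqP.
  have iT : leb3.-integrable B (EFin \o (fun x => T x * (w x - df i x) * (w x - df i x))).
    apply: sqr_int_measurable => //.
    * by apply: BS; apply: measurable_funB => //; exact: mreg.
    * under eq_fun do rewrite -sqrrN opprB.
      exact: isub.
  have T0 x : 0 <= T x by rewrite sqr_ge0.
  have : (\int[leb3]_(x in B) `|(T x * (w x - df i x) * (w x - df i x))%:E| = 0)%E.
    transitivity (\int[leb3]_(x in B) (T x * (w x - df i x) * (w x - df i x))%:E)%E.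
      apply: eq_integral => x _ /=; rewrite ger0_norm// -mulrA mulr_ge0// -expr2 sqr_ge0//.
    rewrite -[LHS]fineK; last exact: (integrable_fin_num _ iT).
    by congr EFin; exact: Z.
  move=> /(ae_eq_integral_abs _ mB (measurable_int _ iT)).
  apply: filterS => x /= h [Dx xN].
  have Bx : B x.
    by split => //=; rewrite in_itv/= -ler_norml ltW.
  have Tx : T x != 0.
    rewrite /T /weight sqrf_eq0 mulf_neq0//; last first.
      by have /(annulus_weight_gt0 R1_gt0 R1_lt_R2)/gt_eqF -> := Dx.
    rewrite /zcut subr_eq0; apply: contraTneq xN => e.
    by rewrite -leNgt -(@ler_pXn2r _ 2) ?nnegrE// real_normK ?num_real// e.
  have {}h : T x * (w x - df i x) * (w x - df i x) = 0 by have [] := h Bx.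
  apply/eqP; rewrite -subr_eq0; move/eqP: h.
  by rewrite -mulrA mulf_eq0 (negbTE Tx)/= mulf_eq0 orbb.
have := ae_foralln main; apply: filterS => x h Dx.
apply: (h (Num.truncn `|x.2|).+1); split => //; exact: truncnS_gt.
Qed.

End WeakDerivative.

(** * Energy balance over slabs and smallness of the flow *)

Section Energy.
#[local] Set Implicit Arguments.
#[local] Unset Strict Implicit.
Context {R : realType}.
Local Notation mR := (measurableTypeR R).
Variables (R1 R2 : R).
Hypotheses (R1_gt0 : 0 < R1) (R1_lt_R2 : R1 < R2).
Let R2_gt0 : 0 < R2. Proof. exact: lt_trans R1_lt_R2. Qed.
Local Notation D := (Omega R1 R2).
Local Notation A := (annulus R1 R2).
Local Notation regD0 := (reg0 D (@slabs R)).
Local Notation regD1 := (reg1 evec D (@slabs R)).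
Local Notation s := (annulus_weight R1 R2).
Variables (v U : 'I_3 -> pt R -> R) (dv dU : 'I_3 -> 'I_3 -> pt R -> R)
  (ddv : 'I_3 -> 'I_3 -> 'I_3 -> pt R -> R) (q : pt R -> R) (dq : 'I_3 -> pt R -> R).
Variable MU : R.
Hypotheses
  (rv : forall i, regD1 (v i) (dv i)) (rdv : forall i j, regD1 (dv i j) (ddv i j))
  (rU : forall i, regD1 (U i) (dU i)) (rq : regD1 q dq)
  (momentum : forall i x, D x -> - (\sum_j ddv i j j x) +
     \sum_j (U j x + v j x) * dv i j x + \sum_j v j x * dU i j x + dq i x = 0)
  (div_v : forall x, D x -> \sum_j dv j j x = 0)
  (div_U : forall x, D x -> \sum_j dU j j x = 0)
  (U_tangent : forall x, x.1.1 * U 0 x + x.1.2 * U 1 x = 0)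
  (U_bounded : forall x, D x -> `|U 2%:R x| <= MU)
  (cv : forall i, {within closure D, continuous (v i)})
  (cdv : forall i j, {within closure D, continuous (dv i j)})
  (v_inner : forall i x, Gamma R1 x -> v i x = 0)
  (v_outer : forall x, Gamma R2 x -> x.1.1 * v 0 x + x.1.2 * v 1 x = 0)
  (vort_outer : forall x, Gamma R2 x ->
      [/\ vort dv 2%:R x * x.1.1 = 0, vort dv 2%:R x * x.1.2 = 0 &
        vort dv 0 x * x.1.2 - vort dv 1 x * x.1.1 = 0]).

Local Notation om := (vort dv).
Local Notation F := (flux v U dv q).
Let oD : open D. Proof. exact: Omega_open. Qed.
Let mA : measurable (A : set (mR * mR)). Proof. exact: annulus_measurable. Qed.
Let rom i := vort_reg1 rdv i.

Let rX (b : bool) : regD1 (fun x => coord2 b x.1) (fun j _ => kron (if b then 1 else 0) j).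
Proof.
case: b.
- by apply: (coordY_reg1 (E := D)) => B _; exists R2 => x Dx _;
    exact: (annulus_coord R1_gt0 R1_lt_R2 true Dx).
- by apply: (coordX_reg1 (E := D)) => B _; exists R2 => x Dx _;
    exact: (annulus_coord R1_gt0 R1_lt_R2 false Dx).
Qed.

Definition flow (z : R) : R := \int[leb2]_(p in A) F 2%:R (p, z).

Definition density (x : pt R) : R :=
  \sum_i v i x ^+ 2 + \sum_i \sum_j dv i j x ^+ 2 + q x ^+ 2.

Definition level (z : R) : R := \int[leb2]_(p in A) density (p, z).

Lemma density_reg0 : regD0 density.
Proof.
have [rq0 _ _] := rq; apply: reg0D; last exact: reg0X.
apply: reg0D; apply: reg0_sum => i.
  by apply: reg0X; have [] := rv i.
by apply: reg0_sum => j; apply: reg0X; have [] := rdv i j.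
Qed.

Lemma v_slice_vanish i z : exists C, forall p, A p ->
  `|v i (p, z)| <= C * (rsq p - R1 ^+ 2).
Proof.
have [C hC] := boundary_estimate R1_gt0 R1_lt_R2 z (@cv i) (rv i) (or_introl erefl) (@v_inner i).
exists C => p Ap; apply: le_trans (hC p Ap) _; rewrite ger0_norm// subr_ge0.
by move: Ap => /andP[/ltW].
Qed.

Let outer (f : pt R -> R) df z : {within closure D, continuous f} -> regD1 f df ->
  (forall x, Gamma R2 x -> f x = 0) ->
  exists C, forall p, A p -> `|f (p, z)| <= C * (R2 ^+ 2 - rsq p).
Proof.
move=> cf rf f0.
have [C hC] := boundary_estimate R1_gt0 R1_lt_R2 z cf rf (or_intror erefl) f0.
exists C => p Ap; apply: le_trans (hC p Ap) _; rewrite ler0_norm ?opprB//.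
by rewrite subr_le0; move: Ap => /andP[_ /ltW].
Qed.

(** [U] drops out since it is tangent to the cylinders. Each remaining term pairs a component of
    [v], small at the inner circle, with a component of (curl v) x nu, small at the outer one, or
    contains the radial velocity, small at both. *)
Lemma flux_normal z : exists C, forall p, A p ->
  `|p.1 * F 0 (p, z) + p.2 * F 1 (p, z)| <= C * s p.
Proof.
have com i : {within closure D, continuous (om i)}.
  by move: i; apply: ord3; rewrite /vort /tri /=; apply: withinB; exact: cdv.
have cX b := @coord_within R R1 R2 b.
have [C0 h0] := v_slice_vanish 0 z; have [C1 h1] := v_slice_vanish 1 z.
have [C2 h2] := v_slice_vanish 2%:R z.
have [W0 w0] := outer z (withinM (com 2%:R) (cX true)) (reg1M (rom 2%:R) (rX true))
  (fun x Gx => let: And3 _ e _ := vort_outer Gx in e).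
have [W1 w1] := outer z (withinM (com 2%:R) (cX false)) (reg1M (rom 2%:R) (rX false))
  (fun x Gx => let: And3 e _ _ := vort_outer Gx in e).
have [W2 w2] := outer z
  (withinB (withinM (com 0) (cX true)) (withinM (com 1) (cX false)))
  (reg1B (reg1M (rom 0) (rX true)) (reg1M (rom 1) (rX false)))
  (fun x Gx => let: And3 _ _ e := vort_outer Gx in e).
have [X2 hX2] := outer z
  (withinD (withinM (cX false) (@cv 0)) (withinM (cX true) (@cv 1)))
  (reg1D (reg1M (rX false) (rv 0)) (reg1M (rX true) (rv 1))) (@v_outer).
have rk : regD0 (fun x => kin v x + q x).
  have [rq0 _ _] := rq; have [r0 _ _] := rv 0; have [r1 _ _] := rv 1.
  have [r2 _ _] := rv 2%:R; apply: reg0D => //; apply: reg0M; last exact: reg0_cst.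
  by apply: reg0D; [apply: reg0D|]; apply: reg0M.
have [_ /(_ setT erefl) [K hK]] := slice_reg0 z rk.
pose dl := R2 ^+ 2 - R1 ^+ 2.
have dl0 : 0 < dl by rewrite subr_gt0 ltr_pXn2r// nnegrE ltW.
exists (C0 * W0 + C1 * W1 + C2 * W2 + (R2 * C0 + R2 * C1 + X2) / dl * K) => p Ap.
have a0 : 0 <= rsq p - R1 ^+ 2 by rewrite subr_ge0; move: Ap => /andP[/ltW].
have b0 : 0 <= R2 ^+ 2 - rsq p by rewrite subr_ge0; move: Ap => /andP[_ /ltW].
pose y : pt R := (p, z).
have -> : p.1 * F 0 y + p.2 * F 1 y =
    v 0 y * (om 2%:R y * p.2) - v 1 y * (om 2%:R y * p.1)
    - v 2%:R y * (om 0 y * p.2 - om 1 y * p.1)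
    + (p.1 * v 0 y + p.2 * v 1 y) * (kin v y + q y).
  have UT := U_tangent y; rewrite /flux /lamb /tri /=.
  transitivity ((p.1 * U 0 y + p.2 * U 1 y) * kin v y +
    (v 0 y * (om 2%:R y * p.2) - v 1 y * (om 2%:R y * p.1)
    - v 2%:R y * (om 0 y * p.2 - om 1 y * p.1)
    + (p.1 * v 0 y + p.2 * v 1 y) * (kin v y + q y))); first by ring.
  by rewrite UT mul0r add0r.
have T (a b a' b' : R) : `|a| <= a' * (rsq p - R1 ^+ 2) ->
    `|b| <= b' * (R2 ^+ 2 - rsq p) -> `|a * b| <= a' * b' * s p.
  move=> ha hb; rewrite normrM /annulus_weight.
  rewrite (_ : a' * b' * _ = (a' * (rsq p - R1 ^+ 2)) * (b' * (R2 ^+ 2 - rsq p))); last by ring.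
  exact: ler_pM.
(* The radial velocity is bounded by each factor of [s] separately; multiplication by [dl], the sum
   of the factors, gives a bound by their product. *)
have Xv : `|p.1 * v 0 y + p.2 * v 1 y| <= (R2 * C0 + R2 * C1 + X2) / dl * s p.
  rewrite mulrAC ler_pdivlMr//.
  have cc0 := annulus_coord R1_gt0 R1_lt_R2 false Ap.
  have cc1 := annulus_coord R1_gt0 R1_lt_R2 true Ap.
  set t := `| _ |.
  have t1 : t <= (R2 * C0 + R2 * C1) * (rsq p - R1 ^+ 2).
    rewrite mulrDl -!mulrA; apply: le_trans (ler_normD _ _) _.
    by rewrite !normrM; apply: lerD; apply: ler_pM => //; [exact: h0|exact: h1].
  have t2 : t <= X2 * (R2 ^+ 2 - rsq p) by exact: hX2.
  rewrite (_ : t * dl = t * (R2 ^+ 2 - rsq p) + t * (rsq p - R1 ^+ 2)); last by rewrite /dl; ring.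
  rewrite [leRHS]mulrDl; apply: lerD.
    rewrite [leRHS](_ : _ = (R2 * C0 + R2 * C1) * (rsq p - R1 ^+ 2) *
      (R2 ^+ 2 - rsq p)); last by rewrite /annulus_weight; ring.
    by rewrite ler_wpM2r.
  by rewrite /annulus_weight mulrA ler_wpM2r.
rewrite [leRHS]mulrDl; apply: le_trans (ler_normD _ _) _; apply: lerD; last first.
  by rewrite normrM [leRHS]mulrAC; apply: ler_pM => //; exact: (hK p Ap I).
rewrite [leRHS]mulrDl; apply: le_trans (ler_normB _ _) _; apply: lerD.
  rewrite [leRHS]mulrDl; apply: le_trans (ler_normB _ _) _; apply: lerD.
    by apply: T; [exact: h0|exact: w0].
  by apply: T; [exact: h1|exact: w1].
by apply: T; [exact: h2|exact: w2].
Qed.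

(** The horizontal divergence integrates to zero on each section by [slice_div] and [flux_normal];
    the vertical derivative leaves the two end sections. *)
Lemma slab_energy a b : a <= b ->
  \int[leb3]_(x in slab R1 R2 a b) dissipation v dv dU x = flow a - flow b.
Proof.
move=> ab; have [dF [rF idF]] := flux_identity oD rv rdv rU rq momentum div_v div_U.
have r0 : regD0 (dF 0 0) by have [_ h _] := rF 0.
have r1 : regD0 (dF 1 1) by have [_ h _] := rF 1.
have r2 : regD0 (dF 2%:R 2%:R) by have [_ h _] := rF 2%:R.
have mB : measurable (slab R1 R2 a b : set (mR * mR * mR)) by exact: slab_measurable.
transitivity (\int[leb3]_(x in slab R1 R2 a b)
    (- (dF 0 0 x + dF 1 1 x) - dF 2%:R 2%:R x)).
  apply: Rintegral_ext => x Bx; have := idF x (slab_sub Bx); rewrite sum3 => /eqP.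
  by rewrite addr_eq0 => /eqP ->; ring.
have r01 := reg0D r0 r1.
rewrite RintegralB//; [|by apply: regD0_slab_int => //; exact: reg0N|exact: regD0_slab_int].
rewrite (slab_vertical R1_gt0 R1_lt_R2 ab (rF 2%:R)) -/(flow a) -/(flow b).
rewrite (slab_fubini_slices R1_gt0 R1_lt_R2 _ _ (reg0N r01)).
rewrite (@Rintegral_ext _ _ _ _ _ _ (cst 0)); last first.
  move=> z _ /=; rewrite -[RHS]oppr0.
  have := slice_div R1_gt0 R1_lt_R2 (slice_reg1 z (rF 0)) (slice_reg1 z (rF 1)) (flux_normal z).
  rewrite /= => <-.
  rewrite -mulN1r -RintegralZl//; first by apply: Rintegral_ext => p _; rewrite mulN1r.
  by apply: reg0A_int => //; exact: (slice_reg0 z r01).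
have mi : measurable (`[a, b] : set mR) by exact: measurable_itv.
by rewrite Rintegral_cst// mul0r; ring.
Qed.

(* The quadratic terms of the flux are bounded by the level at z and the cubic
   one by slice_cubic. *)
Lemma flow_bound : exists2 K, 0 <= K &
  forall z, `|flow z| <= K * (level z + level z ^+ 2).
Proof.
have [Kc Kc0 hKc] := slice_cubic R1_gt0 R1_lt_R2.
have MU0 : 0 <= `|MU| by [].
exists (2 + `|MU| + 2 * Kc) => [|z]; first by rewrite !addr_ge0// mulr_ge0.
have iA f : regD0 f -> leb2.-integrable A (EFin \o (fun p => f (p, z))).
  by move=> rf; apply: reg0A_int => //; exact: slice_reg0.
have rH := density_reg0.
have sq3 (f : 'I_3 -> R) i : f i ^+ 2 <= \sum_j f j ^+ 2.
  have a := sqr_ge0 (f 0); have b := sqr_ge0 (f 1); have c := sqr_ge0 (f 2%:R).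
  by move: i; apply: ord3; rewrite sum3; lra.
have E i : \int[leb2]_(p in A) energy2 (fun p => v i (p, z))
    (fun b p => dv i (idx2 b) (p, z)) p <= level z.
  apply: le_Rintegral => //.
  - by apply: reg0A_int => //; exact: (energy2_reg0 (slice_reg1 z (rv i))).
  - exact: iA.
  move=> p Ap; rewrite /energy2 /density -[leLHS]addr0 lerD ?sqr_ge0// -addrA lerD//.
    exact: (sq3 (fun j => v j (p, z))).
  apply: (@le_trans _ _ (\sum_j dv i j (p, z) ^+ 2)).
    by rewrite sum3 /idx2 lerDl sqr_ge0.
  have P j : 0 <= \sum_l dv j l (p, z) ^+ 2 by apply: sumr_ge0 => l _; exact: sqr_ge0.
  have a := P 0; have b := P 1; have c := P 2%:R.
  rewrite [leRHS]sum3; move: i; apply: ord3; lra.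
have C i : `|\int[leb2]_(p in A) (v 2%:R (p, z) * v i (p, z) ^+ 2)| <=
    Kc * (level z + level z ^+ 2).
  exact: (hKc _ _ _ _ (slice_reg1 z (rv i)) (slice_reg1 z (rv 2%:R)) (v_slice_vanish i z)
   (v_slice_vanish 2%:R z) (level z) (E i) (E 2%:R)).
have lz : 0 <= level z.
  apply: le_trans (E 0); apply: Rintegral_ge0 => p _.
  by rewrite /energy2 !addr_ge0// sqr_ge0.
have rv0 i : regD0 (v i) by have [] := rv i.
have rU0 i : regD0 (U i) by have [] := rU i.
have rom0 i : regD0 (om i) by have [] := rom i.
have rq0 : regD0 q by have [] := rq.
have rk0 : regD0 (kin v).
  by apply: reg0M; [apply: reg0D; [apply: reg0D|]; exact: reg0M|exact: reg0_cst].
(* The quadratic part of the axial flux; the remainder v_z |v|^2 / 2 is cubic. *)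
pose G x := lamb v dv 2%:R x + U 2%:R x * kin v x + q x * v 2%:R x.
have rG : regD0 G.
  apply: reg0D; last exact: reg0M; apply: reg0D; last exact: reg0M.
  by rewrite /lamb /tri /=; apply: reg0B; exact: reg0M.
have rc i : regD0 (fun x => v 2%:R x * v i x ^+ 2).
  by apply: reg0M => //; exact: reg0X.
have fE : flow z = \int[leb2]_(p in A) G (p, z) + 2^-1 *
   (\int[leb2]_(p in A) (v 2%:R (p, z) * v 0 (p, z) ^+ 2) +
    \int[leb2]_(p in A) (v 2%:R (p, z) * v 1 (p, z) ^+ 2) +
    \int[leb2]_(p in A) (v 2%:R (p, z) * v 2%:R (p, z) ^+ 2)).
  have i01 := reg0D (rc 0) (rc 1); have i012 := reg0D i01 (rc 2%:R).
  have ih := reg0M (reg0_cst D (@slabs R) (2^-1 : R)) i012.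
  rewrite -(RintegralD mA (iA _ (rc 0)) (iA _ (rc 1))).
  rewrite -(RintegralD mA (iA _ i01) (iA _ (rc 2%:R))).
  rewrite -(RintegralZl _ mA (iA _ i012)) -(RintegralD mA (iA _ rG) (iA _ ih)).
  by apply: Rintegral_ext => p _; rewrite /flux /G /kin; field.
have GB : `|\int[leb2]_(p in A) G (p, z)| <= (2 + `|MU|) * level z.
  apply: le_trans (le_normr_Rintegral mA (iA _ rG)) _.
  rewrite -(RintegralZl _ mA (iA _ rH)); apply: le_Rintegral => //.
  - exact: (iA _ (reg0_norm rG)).
  - exact: (iA _ (reg0M (reg0_cst _ _ _) rH)).
  move=> p Ap; rewrite /G /density /lamb /vort /tri /= !sum3; set y := (p, z).
  have UB := U_bounded (Ap : D y); have UB' := le_trans UB (ler_norm MU).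
  have k0 : 0 <= kin v y by rewrite /kin; have := sqr_ge0 (v 0 y); have := sqr_ge0 (v 1 y);
    have := sqr_ge0 (v 2%:R y); nra.
  have UK : `|U 2%:R y * kin v y| <= `|MU| * kin v y.
    by rewrite normrM (ger0_norm k0) ler_wpM2r.
  have kE : kin v y <= v 0 y ^+ 2 + v 1 y ^+ 2 + v 2%:R y ^+ 2.
    by rewrite /kin; have := sqr_ge0 (v 0 y); have := sqr_ge0 (v 1 y);
      have := sqr_ge0 (v 2%:R y); nra.
  set L := (_ - _) * _ - _; set W := q y * _.
  have bp (a b : R) : `|a * b| <= 2^-1 * (a ^+ 2 + b ^+ 2).
    by rewrite ler_norml; have := sqr_ge0 (a - b); have := sqr_ge0 (a + b);
      move=> u1 u2; apply/andP; split; nra.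
  have WB : `|W| <= 2^-1 * (q y ^+ 2 + v 2%:R y ^+ 2) by exact: bp.
  have d2 (a b : R) : (a - b) ^+ 2 <= 2 * (a ^+ 2 + b ^+ 2).
    by have := sqr_ge0 (a + b); nra.
  have LB : `|L| <= 2^-1 * (2 * (dv 2%:R 1 y ^+ 2 + dv 1 2%:R y ^+ 2) + v 1 y ^+ 2) +
      2^-1 * (2 * (dv 0 2%:R y ^+ 2 + dv 2%:R 0 y ^+ 2) + v 0 y ^+ 2).
    apply: le_trans (ler_normB _ _) _; apply: lerD; apply: le_trans (bp _ _) _;
      by rewrite ler_wpM2l ?invr_ge0// lerD2r.
  set N := (X in _ <= _ * X).
  have kN : kin v y <= N.
    rewrite /N; apply: le_trans kE _.
    have h := sqr_ge0 (q y).
    have h00 := sqr_ge0 (dv 0 0 y); have h01 := sqr_ge0 (dv 0 1 y).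
    have h02 := sqr_ge0 (dv 0 2%:R y); have h10 := sqr_ge0 (dv 1 0 y).
    have h11 := sqr_ge0 (dv 1 1 y); have h12 := sqr_ge0 (dv 1 2%:R y).
    have h20 := sqr_ge0 (dv 2%:R 0 y); have h21 := sqr_ge0 (dv 2%:R 1 y).
    have h22 := sqr_ge0 (dv 2%:R 2%:R y); lra.
  have LN : `|L| + `|W| <= 2 * N.
    rewrite /N; apply: le_trans (lerD LB WB) _.
    have h := sqr_ge0 (q y).
    have h0 := sqr_ge0 (v 0 y); have h1 := sqr_ge0 (v 1 y); have h2 := sqr_ge0 (v 2%:R y).
    have h00 := sqr_ge0 (dv 0 0 y); have h01 := sqr_ge0 (dv 0 1 y).
    have h02 := sqr_ge0 (dv 0 2%:R y); have h10 := sqr_ge0 (dv 1 0 y).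
    have h11 := sqr_ge0 (dv 1 1 y); have h12 := sqr_ge0 (dv 1 2%:R y).
    have h20 := sqr_ge0 (dv 2%:R 0 y); have h21 := sqr_ge0 (dv 2%:R 1 y).
    have h22 := sqr_ge0 (dv 2%:R 2%:R y); lra.
  have mk : `|MU| * kin v y <= `|MU| * N by rewrite ler_wpM2l.
  apply: le_trans (ler_normD _ _) _.
  have := ler_normD L (U 2%:R y * kin v y); rewrite mulrDl; lra.
rewrite fE; apply: le_trans (ler_normD _ _) _.
have T3 (a b c : R) : `|2^-1 * (a + b + c)| <= 2^-1 * (`|a| + `|b| + `|c|).
  rewrite normrM ger0_norm ?invr_ge0// ler_wpM2l ?invr_ge0//.
  by apply: le_trans (ler_normD _ _) _; rewrite lerD2r ler_normD.
have t3 := T3 (\int[leb2]_(p in A) (v 2%:R (p, z) * v 0 (p, z) ^+ 2))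
    (\int[leb2]_(p in A) (v 2%:R (p, z) * v 1 (p, z) ^+ 2))
    (\int[leb2]_(p in A) (v 2%:R (p, z) * v 2%:R (p, z) ^+ 2)).
apply: le_trans (lerD GB t3) _.
have c0 := C 0; have c1 := C 1; have c2 := C 2%:R.
have l2 := sqr_ge0 (level z).
have m1 : 0 <= (2 + `|MU|) * level z ^+ 2 by rewrite mulr_ge0// addr_ge0.
have m2 : 0 <= Kc * (level z + level z ^+ 2) by rewrite mulr_ge0// addr_ge0.
rewrite [leRHS](_ : _ = (2 + `|MU|) * level z + (2 + `|MU|) * level z ^+ 2 +
  2 * (Kc * (level z + level z ^+ 2))); last by ring.
lra.
Qed.

Lemma level_slab a b : \int[leb3]_(x in slab R1 R2 a b) density x =
  \int[lebesgue_measure]_(z in `[a, b]) level z.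
Proof. exact: slab_fubini_slices density_reg0. Qed.

Lemma level_integrable a b :
  (@lebesgue_measure R).-integrable `[a, b] (EFin \o level).
Proof. exact: slab_slices_int density_reg0. Qed.

Lemma density_ge0 x : 0 <= density x.
Proof.
rewrite !addr_ge0 ?sqr_ge0//; apply: sumr_ge0 => i _; rewrite ?sqr_ge0//.
by apply: sumr_ge0 => j _; exact: sqr_ge0.
Qed.

(** Otherwise the level would be at least [e] on the whole interval, and its integral at least e (hi
    - lo) > M. *)
Lemma small_level M e lo hi : 0 < e -> lo <= hi -> M < e * (hi - lo) ->
  \int[leb3]_(x in slab R1 R2 lo hi) density x <= M ->
  exists2 z, lo <= z <= hi & level z <= e.
Proof.
move=> e0 lohi Me; rewrite level_slab => IM; apply: contrapT => h.
have {}h z : lo <= z <= hi -> e <= level z.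
  by move=> zi; rewrite leNgt; apply/negP => lz; apply: h; exists z => //; exact: ltW.
have mi : measurable (`[lo, hi] : set mR) by exact: measurable_itv.
have : \int[lebesgue_measure]_(z in `[lo, hi]) cst e z <=
    \int[lebesgue_measure]_(z in `[lo, hi]) level z.
  apply: le_Rintegral => //.
  - by apply: bdd_measurable_integrable => //; [exact: itv_finite|exact: bdd_measurable_cst].
  - exact: level_integrable.
rewrite Rintegral_cst_itv//.
by move=> /(lt_le_trans Me) /lt_le_trans /(_ IM); rewrite ltxx.
Qed.

Lemma slab_dissipation_small M N e :
  (forall a b, \int[leb3]_(x in slab R1 R2 a b) density x <= M) -> 0 <= N -> 0 < e ->
  exists a b, [/\ a <= - N, N <= b &
    \int[leb3]_(x in slab R1 R2 a b) dissipation v dv dU x <= e].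
Proof.
move=> dM N0 e0; have [K K0 flK] := flow_bound.
(* At a level at most d <= 1, [flow_bound] gives |flow| <= 2 K d <= e / 2. *)
pose d := Num.min 1 (e / (4 * (K + 1))).
have K1 : 0 < K + 1 by rewrite ltr_wpDl.
have d0 : 0 < d by rewrite lt_min ltr01/= divr_gt0// mulr_gt0.
have d1 : d <= 1 by rewrite ge_min lexx.
have de : 4 * (K + 1) * d <= e.
  rewrite mulrC -ler_pdivlMr ?mulr_gt0//; first by rewrite ge_min lexx orbT.
(* A window of length [L] contains such a level, since d L = |M| + 1 > M. *)
pose L := (`|M| + 1) / d.
have L0 : 0 <= L by rewrite divr_ge0 ?addr_ge0// ltW.
have dL : d * L = `|M| + 1 by rewrite /L; field; rewrite gt_eqF.
have small lo hi : hi - lo = L -> exists2 z, lo <= z <= hi & `|flow z| <= e / 2.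
  move=> hlL; have [||z zi lz] := @small_level M d lo hi d0 _ _ (dM lo hi).
  - by rewrite -subr_ge0 hlL.
  - by rewrite hlL dL; have := ler_norm M; lra.
  exists z => //; apply: le_trans (flK z) _.
  have l0 : 0 <= level z by apply: Rintegral_ge0 => p _; exact: density_ge0.
  apply: (@le_trans _ _ (K * (d + d))).
    rewrite ler_wpM2l// lerD// expr2; apply: le_trans (ler_pM l0 l0 lz lz) _.
    by rewrite -[leRHS]mulr1 ler_wpM2l// ltW.
  by have Kd := mulr_ge0 K0 (ltW d0); lra.
have [a /andP[_ aN] fa] := small (- N - L) (- N) ltac:(by ring).
have [b /andP[Nb _] fb] := small N (N + L) ltac:(by ring).
exists a, b; split=> //; rewrite slab_energy; last by lra.
by have := ler_norm (flow a); have := ler_norm (- flow b); rewrite normrN; lra.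
Qed.

End Energy.

(** * The strain of the base flow *)

Section Strain.
#[local] Set Implicit Arguments.
#[local] Unset Strict Implicit.
Context {R : realType}.
Variables (R1 R2 alpha beta gamma : R).
Hypotheses (R1_gt0 : 0 < R1) (R1_lt_R2 : R1 < R2).
Local Notation D := (Omega R1 R2).
Local Notation M := (M_in R1 R2 alpha beta gamma).

(** The largest eigenvalue of the symmetric gradient of the base flow at radius [rho]; the other two
    are 0 and its opposite. *)
Definition strain (rho : R) : R := Num.sqrt
  (alpha ^+ 2 * (R1 ^+ 4 * R2 ^+ 2 / ((R2 ^+ 2 - R1 ^+ 2) ^+ 2 * rho ^+ 4))
    + (rho^-1 * ((beta - gamma) / 4 * R2 ^+ 2
        - beta / 8 * ((R2 ^+ 2 - R1 ^+ 2) / ln (R2 / R1))) + rho * (gamma / 4)) ^+ 2).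

Lemma strain_le_M_in rho : R1 <= rho <= R2 -> strain rho <= M.
Proof.
move=> rR; apply: ub_le_sup; last by exists rho => //=; rewrite in_itv.
have h1 := R1_gt0; have h2 := R1_lt_R2.
have d0 : 0 < R2 ^+ 2 - R1 ^+ 2 by rewrite subr_gt0 ltr_pXn2r// nnegrE ltW// (lt_trans h1).
pose c := (beta - gamma) / 4 * R2 ^+ 2 - beta / 8 * ((R2 ^+ 2 - R1 ^+ 2) / ln (R2 / R1)).
(* An upper bound, so that [sup] is a genuine supremum: negative powers of rho are largest at R1,
   and rho is at most R2. *)
exists (Num.sqrt (alpha ^+ 2 * (R1 ^+ 4 * R2 ^+ 2 / ((R2 ^+ 2 - R1 ^+ 2) ^+ 2 * R1 ^+ 4))
  + (R1^-1 * `|c| + R2 * `|gamma / 4|) ^+ 2)).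
move=> ? [r /=]; rewrite in_itv/= => /andP[r1 r2] <-.
have r0 : 0 < r by exact: lt_le_trans r1.
apply: ler_wsqrtr; apply: lerD.
  rewrite ler_wpM2l ?sqr_ge0// ler_wpM2l ?mulr_ge0 ?exprn_ge0 ?(ltW h1) ?(ltW (lt_trans h1 h2))//.
  rewrite lef_pV2 ?posrE ?mulr_gt0 ?exprn_gt0//.
  by rewrite ler_wpM2l ?exprn_ge0 ?(ltW d0)// ler_pXn2r// nnegrE ltW.
rewrite -real_normK ?num_real// ler_pXn2r// ?nnegrE ?addr_ge0 ?mulr_ge0 ?invr_ge0 ?(ltW h1)
  ?(ltW (lt_trans h1 h2))//.
apply: le_trans (ler_normD _ _) _; rewrite -/c.
by apply: lerD; rewrite normrM gtr0_norm ?invr_gt0// ler_wpM2r// lef_pV2.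
Qed.

Lemma M_in_ge0 : 0 <= M.
Proof.
by apply: le_trans (strain_le_M_in (rho := R1) _); rewrite ?sqrtr_ge0// lexx ltW.
Qed.

(* Writing w for v in the orthonormal frame e_rho, e_theta, e_z, the quadratic form is
   2 w_rho (s t w_theta + t' w_z), where (s, t') is the vector whose length is strain. *)
Lemma strain_bound (v : 'I_3 -> pt R -> R) x : D x ->
  - (\sum_i \sum_j v i x * v j x * dUb R1 R2 alpha beta gamma i j x) <=
  M * \sum_i v i x ^+ 2.
Proof.
move=> Dx; have h1 := R1_gt0; have h2 := R1_lt_R2.
have h3 : 0 < R2 by exact: lt_trans R1_lt_R2.
pose r := Defs.radius x.
have q0 : 0 < rsq x.1 by move: Dx => /andP[+ _]; apply: lt_trans; rewrite exprn_gt0.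
have r0 : 0 < r by rewrite sqrtr_gt0.
have rE : rsq x.1 = r ^+ 2 by rewrite sqr_sqrtr// ltW.
have rR : R1 <= r <= R2.
  move: Dx => /andP[a b]; apply/andP; split; rewrite -(@ler_pXn2r _ 2) ?nnegrE ?ltW//.
    by rewrite -rE.
  by rewrite -rE.
have d0 : 0 < R2 ^+ 2 - R1 ^+ 2 by rewrite subr_gt0 ltr_pXn2r// nnegrE ltW.
have l0 : 0 < ln (R2 / R1) by rewrite ln_gt0// ltr_pdivlMr// mul1r.
apply: (@le_trans _ _ (strain r * \sum_i v i x ^+ 2)); last first.
  rewrite ler_wpM2r ?strain_le_M_in//; apply: sumr_ge0 => i _; exact: sqr_ge0.
(* [A] and [B] are half the azimuthal and half the axial shear; [S], [T], [c] are the radial,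
   azimuthal and axial components of [v]. *)
pose A := kB R1 R2 alpha * R1 ^+ 2 / r ^+ 2.
pose B := r * (a1B gamma + a2B R1 R2 beta gamma / r ^+ 2).
pose S := (x.1.1 * v 0 x + x.1.2 * v 1 x) / r.
pose T := (x.1.1 * v 1 x - x.1.2 * v 0 x) / r.
pose c := v 2%:R x.
have sE : strain r = Num.sqrt (A ^+ 2 + B ^+ 2).
  rewrite /strain /A /B /kB /a1B /a2B /omega01; congr Num.sqrt.
  by field; rewrite ?gt_eqF.
have vE : \sum_i v i x ^+ 2 = S ^+ 2 + T ^+ 2 + c ^+ 2.
  rewrite sum3 /S /T /c; have e : x.1.2 ^+ 2 = r ^+ 2 - x.1.1 ^+ 2 by rewrite -rE /rsq; ring.
  by field: e; rewrite gt_eqF.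
have QE : \sum_i \sum_j v i x * v j x * dUb R1 R2 alpha beta gamma i j x =
    2 * S * (A * T + B * c).
  rewrite !sum3 /dUb /dub /tri /= /dub0 /dub1 /dub2 /xh /kron /uh /g2 /iq /= rE /S /T /A /B /c.
  by field; rewrite gt_eqF.
rewrite QE vE sE; set m := Num.sqrt _.
have m0 : 0 <= m by exact: sqrtr_ge0.
have mE : m ^+ 2 = A ^+ 2 + B ^+ 2 by rewrite sqr_sqrtr// addr_ge0 ?sqr_ge0.
pose n := Num.sqrt (T ^+ 2 + c ^+ 2).
have n0 : 0 <= n by exact: sqrtr_ge0.
have nE : n ^+ 2 = T ^+ 2 + c ^+ 2 by rewrite sqr_sqrtr// addr_ge0 ?sqr_ge0.
have wn : `|A * T + B * c| <= m * n.
  rewrite -(@ler_pXn2r _ 2) ?nnegrE ?mulr_ge0// real_normK ?num_real// exprMn mE nE.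
  (* Lagrange's identity: (A c - B T)^2 is the defect in the Cauchy-Schwarz inequality. *)
  by have := sqr_ge0 (A * c - B * T); rewrite -subr_ge0 => h; nra.
have -> : S ^+ 2 + T ^+ 2 + c ^+ 2 = `|S| ^+ 2 + n ^+ 2 by rewrite nE real_normK ?num_real ?addrA.
apply: le_trans (ler_norm _) _; rewrite normrN normrM (normrM 2) (ger0_norm (ler0n _ 2)).
apply: (@le_trans _ _ (2 * `|S| * (m * n))); first by rewrite ler_wpM2l ?mulr_ge0.
by have := mulr_ge0 m0 (sqr_ge0 (`|S| - n)); nra.
Qed.

Lemma Ub_tangent x : x.1.1 * Ub R1 R2 alpha beta gamma 0 x +
  x.1.2 * Ub R1 R2 alpha beta gamma 1 x = 0.
Proof. by rewrite /Ub /ub /tri /= /ub0 /ub1; ring. Qed.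

Lemma Ub_axial_bounded : exists C, forall x, D x -> `|Ub R1 R2 alpha beta gamma 2%:R x| <= C.
Proof.
have [r _ _] := Ub_reg alpha beta gamma R1_gt0 R1_lt_R2 2%:R.
have [_ /(_ setT erefl) [C hC]] := slice_reg0 0 r.
by exists C => x Dx; exact: (hC x.1 Dx I).
Qed.

End Strain.

(** * From slabs to the whole domain *)

Section Whole.
#[local] Set Implicit Arguments.
#[local] Unset Strict Implicit.
Context {R : realType}.
Local Notation mR := (measurableTypeR R).
Variables (R1 R2 : R).
Hypotheses (R1_gt0 : 0 < R1) (R1_lt_R2 : R1 < R2).
Local Notation D := (Omega R1 R2).
Local Notation A := (annulus R1 R2).
Local Notation regD0 := (reg0 D (@slabs R)).
Local Notation regD1 := (reg1 evec D (@slabs R)).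

Let mD : measurable (D : set (mR * mR * mR)). Proof. exact: Omega_measurable. Qed.
Let mB a b : measurable (slab R1 R2 a b : set (mR * mR * mR)).
Proof. exact: slab_measurable. Qed.

Lemma leb3_ball_gt0 (x : pt R) e : 0 < e ->
  measurable (ball x e : set (mR * mR * mR)) /\ (0 < leb3 (ball x e))%E.
Proof.
move=> e0.
have -> : ball x e = (ball x.1.1 e `*` ball x.1.2 e) `*` ball x.2 e by [].
have mb (y : R) : measurable (ball y e : set mR) by exact: measurable_ball.
have m2 : measurable ((ball x.1.1 e `*` ball x.1.2 e) : set (mR * mR)) by exact: measurableX.
split; first by apply: measurableX.
have -> : leb3 ((ball x.1.1 e `*` ball x.1.2 e) `*` ball x.2 e) =
    (leb2 (ball x.1.1 e `*` ball x.1.2 e) * lebesgue_measure (ball x.2 e))%E.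
  exact: product_measure1E.
have -> : leb2 (ball x.1.1 e `*` ball x.1.2 e) =
    (lebesgue_measure (ball x.1.1 e) * lebesgue_measure (ball x.1.2 e))%E.
  exact: product_measure1E.
have l (y : R) : lebesgue_measure (ball y e) = (e *+ 2)%:E.
  by rewrite lebesgue_measure_ball// ltW.
by rewrite !l -!EFinM lte_fin !mulr_gt0// pmulrn_lgt0.
Qed.

(** A continuous function that is nonzero at a point is nonzero on a ball, which has positive
    measure. *)
Lemma ae_zero (f : pt R -> R) : regD0 f -> {ae leb3, forall x, D x -> f x = 0} ->
  forall x, D x -> f x = 0.
Proof.
move=> [cf _] [N [mN N0 sN]] x Dx; apply: contrapT => /eqP fx.
have : nbhs x (D `&` [set y | f y != 0]).
  apply: filterI; first by apply: open_nbhs_nbhs; split => //; exact: Omega_open.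
  have h : nbhs (f x) [set y | y != 0] by apply: open_nbhs_nbhs; split; [exact: open_neq|].
  exact: (cf x Dx _ h).
move=> /nbhs_ballP[e /= e0 sub].
have [mb b0] := leb3_ball_gt0 x e0.
have : (leb3 (ball x e) <= leb3 N)%E.
  apply: le_measure; rewrite ?inE//.
  move=> y /sub [Dy fy]; apply: sN => /= /(_ Dy) fy0.
  by move: fy; rewrite /= fy0 eqxx.
by rewrite N0 leNgt b0.
Qed.

Lemma slab_sq_zero (f : pt R -> R) : regD0 f ->
  (forall a b, a <= b -> \int[leb3]_(x in slab R1 R2 a b) (f x ^+ 2) <= 0) ->
  forall x, D x -> f x = 0.
Proof.
move=> rf If; apply: ae_zero => //.
have main (N : nat) : {ae leb3, forall x, D x /\ `|x.2| < N%:R -> f x = 0}.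
  have iT := regD0_slab_int R1_gt0 R1_lt_R2 (- N%:R) N%:R (reg0X 2 rf).
  have : (\int[leb3]_(x in slab R1 R2 (- N%:R) N%:R) `|(f x ^+ 2)%:E| = 0)%E.
    transitivity (\int[leb3]_(x in slab R1 R2 (- N%:R) N%:R) (f x ^+ 2)%:E)%E.
      by apply: eq_integral => x _ /=; rewrite ger0_norm// sqr_ge0.
    rewrite -[LHS]fineK; last exact: (integrable_fin_num _ iT).
    have NN : - N%:R <= N%:R :> R by have := ler0n R N; lra.
    congr EFin; apply/eqP; rewrite eq_le If//=.
    by apply: Rintegral_ge0 => x _; exact: sqr_ge0.
  move=> /(ae_eq_integral_abs _ (mB _ _) (measurable_int _ iT)).
  apply: filterS => x /= h [Dx xN].
  have Bx : slab R1 R2 (- N%:R) N%:R x by split => //=; rewrite in_itv/= -ler_norml ltW.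
  by have [/eqP] := h Bx; rewrite sqrf_eq0 => /eqP.
have := ae_foralln main; apply: filterS => x h Dx.
apply: (h (Num.truncn `|x.2|).+1); split => //; exact: truncnS_gt.
Qed.

Lemma L2_sq_int (f : pt R -> R) : L2 leb3 D f -> leb3.-integrable D (EFin \o (fun x => f x ^+ 2)).
Proof.
move=> [mf f2]; apply/integrableP; split.
  by apply/measurable_EFinP; apply: measurable_funX.
rewrite (le_lt_trans _ f2)// /sqnorm le_eqVlt; apply/orP; left; apply/eqP.
by apply: eq_integral => x _ /=; rewrite ger0_norm// sqr_ge0.
Qed.

(** Monotone convergence along the slabs |z| <= N. The extended integral is used because its
    finiteness is part of the conclusion. *)
Lemma whole_le_slab (g : pt R -> R) C : regD0 g -> (forall x, 0 <= g x) ->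
  (forall N : nat, \int[leb3]_(x in slab R1 R2 (- N%:R) N%:R) g x <= C) ->
  (\int[leb3]_(x in D) (g x)%:E <= C%:E)%E.
Proof.
move=> rg g0 gC; pose F (N : nat) : set (pt R) := slab R1 R2 (- N%:R) N%:R.
have UF : \bigcup_i F i = D.
  apply/seteqP; split=> x; first by move=> [N _]; exact: slab_sub.
  move=> Dx; exists (Num.truncn `|x.2|).+1 => //; split => //=.
  by rewrite in_itv/= -ler_norml ltW// truncnS_gt.
have cvF : (\int[leb3]_(x in F i) (g x)%:E)%E @[i --> \oo] --> (\int[leb3]_(x in D) (g x)%:E)%E.
  rewrite -UF; apply: ge0_nondecreasing_set_cvg_integral.
  - move=> n m nm; apply/subsetPset => x [Ax /=]; rewrite in_itv/= => /andP[h1 h2].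
    have nm' : n%:R <= m%:R :> R by rewrite ler_nat.
    split => //=; rewrite in_itv/=; apply/andP; split; first by apply: le_trans h1; rewrite lerN2.
    exact: le_trans nm'.
  - by move=> n; exact: mB.
  - move=> n; exact: (measurable_int _ (regD0_slab_int R1_gt0 R1_lt_R2 _ _ rg)).
  - by move=> n x _; rewrite lee_fin.
rewrite -(cvg_lim _ cvF)//; apply: lime_le; first by apply/cvg_ex; eexists; exact: cvF.
apply: nearW => N; rewrite -[leLHS]fineK ?lee_fin; first exact: gC.
exact: (integrable_fin_num (mB _ _) (regD0_slab_int R1_gt0 R1_lt_R2 _ _ rg)).
Qed.

End Whole.

(** * The energy inequality and the vanishing of the pressure *)

Section Uniqueness.
#[local] Set Implicit Arguments.
#[local] Unset Strict Implicit.
Context {R : realType}.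
Local Notation mR := (measurableTypeR R).
Variables (R1 R2 alpha beta gamma : R).
Hypotheses (R1_gt0 : 0 < R1) (R1_lt_R2 : R1 < R2).
Local Notation D := (Omega R1 R2).
Local Notation A := (annulus R1 R2).
Local Notation regD0 := (reg0 D (@slabs R)).
Local Notation regD1 := (reg1 evec D (@slabs R)).
Local Notation M := (M_in R1 R2 alpha beta gamma).
Local Notation U := (Ub R1 R2 alpha beta gamma).
Local Notation dU := (dUb R1 R2 alpha beta gamma).
Variables (v : 'I_3 -> pt R -> R) (dv : 'I_3 -> 'I_3 -> pt R -> R)
  (ddv : 'I_3 -> 'I_3 -> 'I_3 -> pt R -> R) (q : pt R -> R) (dq : 'I_3 -> pt R -> R).
Hypotheses
  (rv : forall i, regD1 (v i) (dv i)) (rdv : forall i j, regD1 (dv i j) (ddv i j))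
  (rq : regD1 q dq)
  (momentum : forall i x, D x -> - (\sum_j ddv i j j x) +
     \sum_j (U j x + v j x) * dv i j x + \sum_j v j x * dU i j x + dq i x = 0).

Let mD : measurable (D : set (mR * mR * mR)). Proof. exact: Omega_measurable. Qed.
Let mB a b : measurable (slab R1 R2 a b : set (mR * mR * mR)).
Proof. exact: slab_measurable. Qed.

(* Integrate the energy balance over slabs whose end sections carry little flow. *)
Lemma energy_inequality :
  leb3.-integrable D (EFin \o density v dv q) ->
  (forall x, D x -> \sum_j dv j j x = 0) ->
  (forall i, {within closure D, continuous (v i)}) ->
  (forall i j, {within closure D, continuous (dv i j)}) ->
  (forall i x, Gamma R1 x -> v i x = 0) ->
  (forall x, Gamma R2 x -> x.1.1 * v 0 x + x.1.2 * v 1 x = 0) ->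
  (forall x, Gamma R2 x ->
      [/\ vort dv 2%:R x * x.1.1 = 0, vort dv 2%:R x * x.1.2 = 0 &
        vort dv 0 x * x.1.2 - vort dv 1 x * x.1.1 = 0]) ->
  (\int[leb3]_(x in D) (\sum_i vort dv i x ^+ 2)%:E <=
    (M * \int[leb3]_(x in D) (\sum_i v i x ^+ 2))%:E)%E.
Proof.
move=> iH div_v cv cdv v_inner v_outer vort_outer.
have [MU hMU] := Ub_axial_bounded alpha beta gamma R1_gt0 R1_lt_R2.
have rU := Ub_reg alpha beta gamma R1_gt0 R1_lt_R2.
have rv0 i : regD0 (v i) by have [] := rv i.
have rE : regD0 (fun x => \sum_i v i x ^+ 2) by apply: reg0_sum => i; exact: reg0X.
have rW : regD0 (fun x => \sum_i vort dv i x ^+ 2).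
  by apply: reg0_sum => i; apply: reg0X; have [] := vort_reg1 rdv i.
have rdis : regD0 (dissipation v dv dU).
  apply: reg0D => //; apply: reg0_sum => i; apply: reg0_sum => j.
  by apply: reg0M; [exact: reg0M|have [_ h _] := rU i; exact: h].
have rH : regD0 (density v dv q) by exact: (density_reg0 rv rdv rq).
have dens0 := density_ge0 v dv q.
have E0 x : 0 <= \sum_i v i x ^+ 2 by apply: sumr_ge0 => i _; exact: sqr_ge0.
have W0 x : 0 <= \sum_i vort dv i x ^+ 2 by apply: sumr_ge0 => i _; exact: sqr_ge0.
have iE : leb3.-integrable D (EFin \o (fun x => \sum_i v i x ^+ 2)).
  apply: (le_integrable mD _ _ iH).
    by apply/measurable_EFinP; exact: regD0_measurable.
  move=> x _ /=; rewrite lee_fin !ger0_norm// /density -addrA lerDl addr_ge0 ?sqr_ge0//.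
  by apply: sumr_ge0 => i _; apply: sumr_ge0 => j _; exact: sqr_ge0.
have M0 := M_in_ge0 alpha beta gamma R1_gt0 R1_lt_R2.
(* For each [N] and [e], a larger slab is chosen whose dissipation is at most [e]; the slack [e]
   then disappears. *)
apply: whole_le_slab => // N; apply/ler_addgt0Pr => e e0.
have densM a b : \int[leb3]_(x in slab R1 R2 a b) density v dv q x <=
    \int[leb3]_(x in D) density v dv q x.
  by apply: ge0_le_Rintegral_subset => //; exact: slab_sub.
have [a [b [aN Nb dis]]] := slab_dissipation_small R1_gt0 R1_lt_R2 rv rdv rU rq momentum div_v
  (fun x _ => base_divergence _ _ _ _ x) (Ub_tangent R1 R2 alpha beta gamma) hMU
  cv cdv v_inner v_outer vort_outer densM (ler0n R N) e0.
pose B := slab R1 R2 a b.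
have iB g : regD0 g -> leb3.-integrable B (EFin \o g) by exact: regD0_slab_int.
apply: (@le_trans _ _ (\int[leb3]_(x in B) (\sum_i vort dv i x ^+ 2))).
  apply: ge0_le_Rintegral_subset => //; [exact: mB|exact: iB|].
  move=> x [Ax /=]; rewrite in_itv/= => /andP[x1 x2]; split => //=.
  by rewrite in_itv/= (le_trans aN x1) (le_trans x2 Nb).
apply: (@le_trans _ _ (\int[leb3]_(x in B) (dissipation v dv dU x + M * \sum_i v i x ^+ 2))).
  apply: le_Rintegral; [exact: mB|exact: iB| |].
    by apply: iB; apply: reg0D => //; apply: reg0M => //; exact: reg0_cst.
  move=> x Bx; have := strain_bound alpha beta gamma R1_gt0 R1_lt_R2 v (slab_sub Bx).
  by rewrite /dissipation; lra.
rewrite RintegralD; [|exact: mB|exact: iB|]; last first.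
  by apply: iB; apply: reg0M => //; exact: reg0_cst.
rewrite RintegralZl; [|exact: mB|exact: iB].
rewrite addrC lerD// ler_wpM2l//; apply: ge0_le_Rintegral_subset => //; [exact: mB|exact: slab_sub].
Qed.

(* The pressure is constant along the axis, hence zero since it is in L2. *)
Lemma pressure_zero : (forall i x, D x -> v i x = 0) -> L2 leb3 D q ->
  forall x, D x -> q x = 0.
Proof.
move=> v0 q2; have oD : open D by exact: Omega_open.
have dv0 i := reg1_zero oD (rv i) (v0 i).
have ddv0 i j := reg1_zero oD (rdv i j) (dv0 i j).
have dq0 x : D x -> dq 2%:R x = 0.
  move=> Dx; have := momentum 2%:R Dx; rewrite big1 ?oppr0 ?add0r => [|j _]; last exact: ddv0.
  rewrite big1 ?add0r => [|j _]; last by rewrite dv0// mulr0.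
  by rewrite big1 ?add0r => [|j _] //; rewrite v0// mul0r.
have qz p z : A p -> q (p, z) = q (p, 0).
  move=> Ap; have [_ _ Dq] := rq.
  apply: (@is_derive_0_is_cst _ (fun t => q (p, t))) => t.
  have := Dq (p, t) 2%:R Ap; rewrite dq0//; case: p Ap => x y Axy /derive_column; exact.
have [rq0 _ _] := rq; have rq2 := reg0X 2 rq0.
pose Q := \int[leb2]_(p in A) (q (p, 0) ^+ 2).
have slabQ a b : a <= b -> \int[leb3]_(x in slab R1 R2 a b) (q x ^+ 2) = Q * (b - a).
  move=> ab; rewrite (slab_fubini_slices R1_gt0 R1_lt_R2 _ _ rq2).
  rewrite (@Rintegral_ext _ _ _ _ _ _ (cst Q)); last first.
    by move=> z _; apply: Rintegral_ext => p Ap; rewrite qz.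
  exact: Rintegral_cst_itv.
have iq := L2_sq_int q2.
pose C := \int[leb3]_(x in D) (q x ^+ 2).
have Qle L : 0 <= L -> Q * L <= C.
  move=> L0; rewrite -[L in Q * L]subr0 -slabQ//.
  apply: ge0_le_Rintegral_subset => //; [by move=> x; exact: sqr_ge0|exact: slab_sub].
have Q0 : Q <= 0.
  rewrite leNgt; apply/negP => Qp; have C0 := Qle 0 (lexx 0).
  (* At this length the inequality would read C + 1 <= C. *)
  have := Qle ((C + 1) / Q); rewrite mulr0 in C0.
  rewrite divr_ge0 ?addr_ge0 ?(ltW Qp)// => /(_ isT).
  by rewrite mulrC divfK ?gt_eqF//; lra.
by apply: slab_sq_zero => // a b ab; rewrite slabQ// mulr_le0_ge0// subr_ge0.
Qed.

End Uniqueness.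

(** * The norms of the statement in classical terms *)

Section Norms.
#[local] Set Implicit Arguments.
#[local] Unset Strict Implicit.
Context {R : realType}.
Local Notation mR := (measurableTypeR R).
Variables (R1 R2 : R).
Hypotheses (R1_gt0 : 0 < R1) (R1_lt_R2 : R1 < R2).
Local Notation D := (Omega R1 R2).
Local Notation regD0 := (reg0 D (@slabs R)).
Local Notation regD1 := (reg1 evec D (@slabs R)).
Variables (v : vector_field R) (dv : 'I_3 -> 'I_3 -> pt R -> R)
  (ddv : 'I_3 -> 'I_3 -> 'I_3 -> pt R -> R).
Hypotheses (v_in_V : V_space R1 R2 v)
  (rv : forall i, regD1 (component v i) (dv i)) (rdv : forall i j, regD1 (dv i j) (ddv i j)).

Let mD : measurable (D : set (mR * mR * mR)). Proof. exact: Omega_measurable. Qed.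

Let aeF : Filter (almost_everywhere (leb3 : {measure set (mR * mR * mR) -> \bar R})).
Proof. exact: ae_filter_ringOfSetsType. Qed.

Lemma wpd_component_ae i j :
  {ae leb3, forall x, D x -> wpd D j (component v i) x = dv i j x}.
Proof. by have [h _ t _] := v_in_V; exact: (wpd_ae R1_gt0 R1_lt_R2 j (h i) (t i)). Qed.

Lemma wpd_component_measurable i j :
  measurable_fun (D : set (mR * mR * mR)) (wpd D j (component v i)).
Proof. by have [h _ _ _] := v_in_V; have [[]] := getPex (proj2 (h i) j). Qed.

(** [weak_partial] includes square integrability of the weak derivative, which passes to [dv] by
    equality almost everywhere. *)
Lemma L2_derivative i j : L2 leb3 D (dv i j).
Proof.
have m : measurable_fun (D : set (mR * mR * mR)) (dv i j).
  by apply: regD0_measurable; have [_ h _] := rv i; exact: h.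
have [h _ _ _] := v_in_V; have [[mw w2] _] := getPex (proj2 (h i) j).
split=> //; apply: le_lt_trans w2; rewrite le_eqVlt; apply/orP; left; apply/eqP.
apply: ae_eq_integral => //.
- by apply/measurable_EFinP; apply: measurable_funX.
- by apply/measurable_EFinP; apply: measurable_funX.
by apply: (@filterS _ _ aeF) (wpd_component_ae i j) => x e Dx; rewrite -(e Dx).
Qed.

Lemma energy_integrable :
  leb3.-integrable D (EFin \o (fun x => \sum_i component v i x ^+ 2)).
Proof.
have [h _ _ _] := v_in_V.
by apply: integrable_Rsum => // i; exact: L2_sq_int (proj1 (h i)).
Qed.

Lemma density_integrable q : L2 leb3 D q ->
  leb3.-integrable D (EFin \o density (component v) dv q).
Proof.
move=> q2; have Dd f g : leb3.-integrable D (EFin \o f) -> leb3.-integrable D (EFin \o g) ->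
    leb3.-integrable D (EFin \o (fun x : pt R => f x + g x)).
  by move=> i j; exact: (integrableD mD i j).
apply: (Dd) (L2_sq_int q2); apply: (Dd) energy_integrable _.
by apply: integrable_Rsum => // i; apply: integrable_Rsum => // j;
  exact: L2_sq_int (L2_derivative i j).
Qed.

Lemma sqnormvE (u : vector_field R) :
  (forall i, measurable_fun (D : set (mR * mR * mR)) (component u i)) ->
  sqnormv D u = \int[leb3]_(x in D) (\sum_i component u i x ^+ 2).
Proof.
move=> mu; congr fine; rewrite /sqnorm -ge0_integral_sum//.
- by apply: eq_integral => x _; rewrite sumEFin.
- by move=> i; apply/measurable_EFinP; apply: measurable_funX.
- by move=> i x _; rewrite lee_fin sqr_ge0.
Qed.

Lemma curl_wpd_measurable i :
  measurable_fun (D : set (mR * mR * mR)) (component (curl (wpd D) v) i).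
Proof.
have m := wpd_component_measurable.
apply: (eq_measurable_fun (fun x => wpd D (i + 1) (component v (i + 2%:R)) x -
  wpd D (i + 2%:R) (component v (i + 1)) x)).
  by move=> x _; rewrite /component mxE.
by apply: measurable_funB; exact: m.
Qed.

(** Weak and classical derivatives agree almost everywhere, so the weak curl in [Lambda] may be
    replaced by the vorticity of the energy inequality. *)
Lemma sqnormv_curl : sqnormv D (curl (wpd D) v) =
  \int[leb3]_(x in D) (\sum_i vort dv i x ^+ 2).
Proof.
rewrite sqnormvE; last exact: curl_wpd_measurable.
congr fine; apply: ae_eq_integral => //.
- apply/measurable_EFinP; apply: measurable_sum => i; apply: measurable_funX.
  exact: curl_wpd_measurable.
- apply/measurable_EFinP; apply: measurable_sum => i; apply: measurable_funX.
  by apply: regD0_measurable; have [] := vort_reg1 rdv i.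
have e := @filter_forall _ _ _ _ aeF (fun i => @filter_forall _ _ _ _ aeF (wpd_component_ae i)).
apply: (@filterS _ _ aeF) e => x e Dx; congr EFin; apply: eq_bigr => i _; congr (_ ^+ 2).
by rewrite /component curlE; move: i; apply: ord3; rewrite /vort /tri /= !e.
Qed.

Lemma sqnormv_ge0 (E : set (pt R)) (u : vector_field R) : 0 <= sqnormv E u.
Proof.
by apply: fine_ge0; apply: sume_ge0 => i _; apply: integral_ge0 => x _; rewrite lee_fin sqr_ge0.
Qed.

End Norms.

Theorem theorem4p3 (R : realType) (R1 R2 : R) (alpha beta gamma : R)
  (R1_gt0 : 0 < R1) (R1_lt_R2 : R1 < R2)
  (v : vector_field R) (q : scalar_field R)
  (v_in_V : V_space R1 R2 v)
  (q_in_L2 : L2 leb3 (Omega R1 R2) q)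
  (sol : classical_solution R1 R2 alpha beta
           (fun x => U_tilde R1 R2 alpha beta gamma x + v x)
           (fun x => P_tilde R1 R2 alpha gamma x + q x))
  (small : M_in R1 R2 alpha beta gamma < Lambda R1 R2) :
  forall x, Omega R1 R2 x -> v x = 0 /\ q x = 0.
Proof.
have [dv [ddv [dq [[rv rdv rq cv cdv] [momentum div_v v_inner v_outer vort_outer]]]]] :=
  perturbation_facts R1_gt0 R1_lt_R2 sol.
have [h _ _ _] := v_in_V.
have rv0 i : reg0 (Omega R1 R2) (@slabs R) (component v i) by have [] := rv i.
have v0 i x : Omega R1 R2 x -> component v i x = 0.
  (* [Lambda] constrains only fields that are not zero almost everywhere; the others vanish
     pointwise by continuity. *)
  have [nz|/contrapT z] := pselect (V_nonzero R1 R2 v); last first.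
    apply: ae_zero; first exact: rv0.
    apply: (@filterS _ _ (ae_filter_ringOfSetsType leb3)) z => y e Dy.
    by rewrite /component e// mxE.
  have mv j := proj1 (proj1 (h j)).
  have S0 := sqnormv_ge0 (Omega R1 R2) v.
  (* A zero denominator makes the quotient meaningless; in that case the integrals of the squared
     components over slabs are at most 0. *)
  have [E|S1] := eqVneq (sqnormv (Omega R1 R2) v) 0; last first.
    have {}S0 : 0 < sqnormv (Omega R1 R2) v by rewrite lt_def S1.
    have le1 : Lambda R1 R2 <= sqnormv (Omega R1 R2) (curl (wpd (Omega R1 R2)) v) /
        sqnormv (Omega R1 R2) v.
      (* The quotients are bounded below by 0, so [inf] is a true lower bound. *)
      apply: ge_inf; last by exists v.
      by exists 0 => ? [u _ <-]; rewrite divr_ge0 ?sqnormv_ge0.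
    have : sqnormv (Omega R1 R2) (curl (wpd (Omega R1 R2)) v) <=
        M_in R1 R2 alpha beta gamma * sqnormv (Omega R1 R2) v.
      rewrite (sqnormv_curl R1_gt0 R1_lt_R2 v_in_V rv rdv) (sqnormvE mv).
      have en := energy_inequality R1_gt0 R1_lt_R2 rv rdv rq momentum
        (density_integrable R1_gt0 R1_lt_R2 v_in_V rv rdv q_in_L2) div_v cv cdv
        v_inner v_outer vort_outer.
      (* The extended inequality shows that the integral of the squared vorticity is finite, so
         [fine] loses nothing. *)
      rewrite -lee_fin fineK// ge0_fin_numE; first exact: (le_lt_trans en (ltry _)).
      apply: integral_ge0 => y _; rewrite lee_fin; apply: sumr_ge0 => j _; exact: sqr_ge0.
    by rewrite -ler_pdivrMr// => /(le_trans le1); rewrite leNgt small.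
  have iE := energy_integrable v_in_V.
  apply: slab_sq_zero => // a b _.
  have mB := @slab_measurable R R1 R2 a b.
  rewrite -E (sqnormvE mv); apply: (@le_trans _ _ (\int[leb3]_(x in slab R1 R2 a b)
    (\sum_j component v j x ^+ 2))).
    apply: le_Rintegral => //.
    - by apply: regD0_slab_int => //; exact: reg0X.
    - by apply: regD0_slab_int => //; apply: reg0_sum => j; exact: reg0X.
    - by move=> y _; rewrite (bigD1 i)//= lerDl; apply: sumr_ge0 => j _; exact: sqr_ge0.
  apply: ge0_le_Rintegral_subset => //; [exact: Omega_measurable| |exact: slab_sub].
  by move=> y; apply: sumr_ge0 => j _; exact: sqr_ge0.
move=> x Dx; split; last exact: (pressure_zero R1_gt0 R1_lt_R2 rv rdv rq momentum v0 q_in_L2).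
by apply/rowP => i; rewrite mxE; exact: v0.
Qed.
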